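(* Consider the mixed formulation: find $(B,E,p)\in H_{h,\mathrm{imp}}(\mathrm{div})\times H_{h,\mathrm{imp}}(\mathrm{curl})\times H_{h,0}(\mathrm{grad})$ such that for all $(C,F,q)\in H_{h,\mathrm{imp}}(\mathrm{div})\times H_{h,\mathrm{imp}}(\mathrm{curl})\times H_{h,0}(\mathrm{grad})$ $$\tfrac{2}{\tau}\langle\mu^{-1}B,C\rangle+\langle\mu^{-1}\mathrm{curl}\,E,C\rangle=(g_B,C),$$ $$\tfrac{2}{\tau}\langle\varepsilon E,F\rangle+\langle\varepsilon\,\mathrm{grad}\,p,F\rangle-\langle\mu^{-1}B,\mathrm{curl}\,F\rangle+(1+\gamma)\int_{\Gamma_i}\langle E_{\mathrm{tan}},F_{\mathrm{tan}}\rangle=(g_E,F),$$ $$\tfrac{2}{\tau}\langle p,q\rangle-\langle\varepsilon E,\mathrm{grad}\,q\rangle=(g_p,q),$$ with the dual functionals $g_B,g_E,g_p$ on the right-hand side described in the context. If $g_B\in\big(H^0_{h,\mathrm{imp}}(\mathrm{div})\big)'$, then this mixed formulation is well-posed.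
   Context: Setting. $\mathcal O\subset\mathbb R^3$ is a bounded connected domain (the obstacle), $\mathcal S$ is a ball of sufficiently large radius containing $\mathcal O$, and $\Omega=\mathcal S\setminus\overline{\mathcal O}$ is the bounded (Lipschitz) computational domain. $\Gamma_i=\partial\Omega\cap\partial\mathcal O$, $\Gamma_o=\partial\Omega\setminus\Gamma_i$, and $n$ is the unit normal on $\partial\Omega$. The permittivity $\varepsilon$ and permeability $\mu$ are positive continuous functions depending only on $x\in\Omega$. $\gamma$ is the parameter of the dissipative (impedance) boundary condition $(1+\gamma)E_{\mathrm{tan}}=-n\wedge B$ on $\Gamma_i$ for Maxwell's equations, where $F_{\mathrm{tan}}=F-\langle F,n\rangle n$ for a vector field $F$. $\tau$ is the time step size. The problem is one step of a Crank–Nicolson time discretization of Maxwell's equations with electric field $E$, magnetic field $B$, and an auxiliary variable $p$ associated with the divergence constraint on $E$. Notation. $\langle u,v\rangle=\int_\Omega u\cdot v\,dx$, $\|u\|^2=\langle u,u\rangle$, $\|u\|_\varepsilon^2=\langle\varepsilon u,u\rangle$, $\|u\|_{\mu^{-1}}^2=\langle\mu^{-1}u,u\rangle$, and $\|E\|_{\Gamma_i}^2=\int_{\Gamma_i}\langle E_{\mathrm{tan}},E_{\mathrm{tan}}\rangle$. Spaces. $H_0(\mathrm{grad})=H_0^1(\Omega)$; $H_{\mathrm{imp}}(\mathrm{curl})=\{v\in H(\mathrm{curl}): v\wedge n|_{\Gamma_o}=0\}$; $H_{\mathrm{imp}}(\mathrm{div})=\{v\in H(\mathrm{div}): \langle v,n\rangle|_{\Gamma_o}=0\}$.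 The spaces $H_{h,0}(\mathrm{grad})\subset H_0(\mathrm{grad})$, $H_{h,\mathrm{imp}}(\mathrm{curl})\subset H_{\mathrm{imp}}(\mathrm{curl})$ and $H_{h,\mathrm{imp}}(\mathrm{div})\subset H_{\mathrm{imp}}(\mathrm{div})$ are standard Lagrange, Nédélec and Raviart–Thomas finite element spaces, chosen so that they satisfy the exact sequence $$H_{h,0}(\mathrm{grad})\xrightarrow{\ \mathrm{grad}\ }H_{h,\mathrm{imp}}(\mathrm{curl})\xrightarrow{\ \mathrm{curl}\ }H_{h,\mathrm{imp}}(\mathrm{div})\xrightarrow{\ \mathrm{div}\ }L_h^2,$$ where $L_h^2$ is the corresponding piecewise polynomial subspace of $L^2(\Omega)$. $H^0_{h,\mathrm{imp}}(\mathrm{div})=\{v\in H_{h,\mathrm{imp}}(\mathrm{div}):\mathrm{div}\,v=0\}$, and the prime denotes the dual space. Right-hand sides. Let $(B_h^{n-1},E_h^{n-1},p_h^{n-1})$ be the discrete solution at the previous time step and $j^{n-1},j^n$ the given current density at the previous and current time steps. The dual functionals are $(g_B,C)=\frac2\tau\langle\mu^{-1}B_h^{n-1},C\rangle-\langle\mu^{-1}\mathrm{curl}\,E_h^{n-1},C\rangle$, $(g_E,F)=\frac2\tau\langle\varepsilon E_h^{n-1},F\rangle-\langle\varepsilon\,\mathrm{grad}\,p_h^{n-1},F\rangle+\langle\mu^{-1}B_h^{n-1},\mathrm{curl}\,F\rangle-(1+\gamma)\int_{\Gamma_i}\langle E^{n-1}_{h,\mathrm{tan}},F_{\mathrm{tan}}\rangle-\langle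 j^n+j^{n-1},F\rangle$, $(g_p,q)=\frac2\tau\langle p_h^{n-1},q\rangle+\langle\varepsilon E_h^{n-1},\mathrm{grad}\,q\rangle$. ''Well-posed'' is meant in the usual (Babuška–Brezzi) sense: a unique solution exists and depends continuously on the data. The weighted norms used are $\|B\|_{\mathrm{div}}^2=\frac{2}{\tau}\|B\|_{\mu^{-1}}^2+\|\mathrm{div}\,B\|^2$, $\|E\|_{\mathrm{curl}}^2=\frac{2}{\tau}\|E\|_\varepsilon^2+\frac{\tau}{2}\|\mathrm{curl}\,E\|_{\mu^{-1}}^2+(1+\gamma)\|E\|_{\Gamma_i}^2$, and $\|p\|_{\mathrm{grad}}^2=\frac{2}{\tau}\|p\|^2+\frac{\tau}{2}\|\mathrm{grad}\,p\|_\varepsilon^2$. *)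

(* Defs.v *)
From HB Require Import structures.
From mathcomp Require Import all_boot all_order all_algebra all_fingroup.
From mathcomp Require Import all_classical all_reals all_analysis.

Set Implicit Arguments.
Unset Strict Implicit.
Unset Printing Implicit Defensive.

Import Order.TTheory GRing.Theory Num.Theory.
Import numFieldNormedType.Exports.

Local Open Scope classical_set_scope.
Local Open Scope ring_scope.

(** * Vectors and Lebesgue measure in R^3 *)

(* The norm that the library puts on ['rV[R]_3] is the max norm; Euclidean
   lengths are always taken through [dot]. *)
Definition dot (R : realType) (u v : 'rV[R]_3) : R := \sum_i u 0 i * v 0 i.

Definition enorm (R : realType) (u : 'rV[R]_3) : R := Num.sqrt (dot u u).

(* Indices are computed modulo 3 in ['I_3]. *)
Definition cross (R : realType) (u v : 'rV[R]_3) : 'rV[R]_3 :=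
  \row_(i < 3) (u 0 (i + 1) * v 0 (i + 2) - u 0 (i + 2) * v 0 (i + 1)).

Definition eball (R : realType) (c : 'rV[R]_3) (r : R) : set 'rV[R]_3 :=
  [set x | enorm (x - c) < r].

Definition bnd (T : topologicalType) (A : set T) : set T := closure A `\` interior A.

Notation leb2 R := ((@lebesgue_measure R \x @lebesgue_measure R)%E).

Notation leb3 R := ((leb2 R \x @lebesgue_measure R)%E).

(* Product measures live on [R * R * R], calculus on ['rV[R]_3]; [vec]
   identifies the two. *)
Definition vec (R : realType) (t : R * R * R) : 'rV[R]_3 :=
  \row_(i < 3) tnth [tuple t.1.1; t.1.2; t.2] i.

Definition integ (R : realType) (Om : set 'rV[R]_3) (f : 'rV[R]_3 -> R) : R :=
  \int[leb3 R]_(t in @vec R @^-1` Om) f (vec t).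

Definition ae_eq_on (R : realType) (T : Type) (Om : set 'rV[R]_3)
    (f g : 'rV[R]_3 -> T) : Prop :=
  {ae leb3 R, forall t, Om (vec t) -> f (vec t) = g (vec t)}.

Definition L2 (R : realType) (Om : set 'rV[R]_3) (f : 'rV[R]_3 -> R) : Prop :=
  measurable_fun (@vec R @^-1` Om) (f \o @vec R) /\
  (leb3 R).-integrable (@vec R @^-1` Om) (fun t => (f (vec t) ^+ 2)%:E).

Definition L2v (R : realType) (Om : set 'rV[R]_3) (v : 'rV[R]_3 -> 'rV[R]_3)
    : Prop :=
  forall i : 'I_3, L2 Om (fun x => v x 0 i).

Definition ips (R : realType) (Om : set 'rV[R]_3) (f g : 'rV[R]_3 -> R) : R :=
  integ Om (fun x => f x * g x).

Definition ipv (R : realType) (Om : set 'rV[R]_3) (w : 'rV[R]_3 -> R)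
    (u v : 'rV[R]_3 -> 'rV[R]_3) : R :=
  integ Om (fun x => w x * dot (u x) (v x)).

Definition one_w (R : realType) : 'rV[R]_3 -> R := fun=> 1.

Definition inv_w (R : realType) (w : 'rV[R]_3 -> R) : 'rV[R]_3 -> R :=
  fun x => (w x)^-1.

(** * Classical differential operators, used on test functions *)

Definition pd (R : realType) (i : 'I_3) (f : 'rV[R]_3 -> R) (x : 'rV[R]_3) : R :=
  'D_(delta_mx 0 i) (f : 'rV[R]_3 -> R^o) x.

Definition C1 (R : realType) (f : 'rV[R]_3 -> R) : Prop :=
  (forall x, differentiable (f : 'rV[R]_3 -> R^o) x) /\
  (forall i, continuous (pd i f)).

Definition C1v (R : realType) (f : 'rV[R]_3 -> 'rV[R]_3) : Prop :=
  forall i : 'I_3, C1 (fun x => f x 0 i).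

Definition cgrad (R : realType) (f : 'rV[R]_3 -> R) (x : 'rV[R]_3)
    : 'rV[R]_3 :=
  \row_(i < 3) pd i f x.

Definition ccurl (R : realType) (f : 'rV[R]_3 -> 'rV[R]_3) (x : 'rV[R]_3)
    : 'rV[R]_3 :=
  \row_(i < 3) (pd (i + 1) (fun y => f y 0 (i + 2)) x
                - pd (i + 2) (fun y => f y 0 (i + 1)) x).

Definition cdiv (R : realType) (f : 'rV[R]_3 -> 'rV[R]_3) (x : 'rV[R]_3) : R :=
  \sum_(i < 3) pd i (fun y => f y 0 i) x.

Definition supported_in (R : realType) (T : zmodType) (Om : set 'rV[R]_3)
    (f : 'rV[R]_3 -> T) : Prop :=
  exists K : set 'rV[R]_3,
    [/\ compact K, K `<=` Om & forall x, ~ K x -> f x = 0].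

Definition vanishes_near (R : realType) (T : zmodType) (A : set 'rV[R]_3)
    (f : 'rV[R]_3 -> T) : Prop :=
  exists U : set 'rV[R]_3, [/\ open U, A `<=` U & forall x, U x -> f x = 0].

(** * Weak differential operators and Sobolev spaces *)

(* Compactly supported C^1 test functions define the same weak derivatives and
   the same space H_0^1 as smooth ones, by mollification. *)

Definition weak_grad (R : realType) (Om : set 'rV[R]_3) (p : 'rV[R]_3 -> R)
    (w : 'rV[R]_3 -> 'rV[R]_3) : Prop :=
  L2v Om w /\
  forall phi : 'rV[R]_3 -> 'rV[R]_3, C1v phi -> supported_in Om phi ->
    integ Om (fun x => p x * cdiv phi x)
    = - integ Om (fun x => dot (w x) (phi x)).

Definition weak_curl (R : realType) (Om : set 'rV[R]_3)
    (v w : 'rV[R]_3 -> 'rV[R]_3) : Prop :=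
  L2v Om w /\
  forall phi : 'rV[R]_3 -> 'rV[R]_3, C1v phi -> supported_in Om phi ->
    integ Om (fun x => dot (v x) (ccurl phi x))
    = integ Om (fun x => dot (w x) (phi x)).

Definition weak_div (R : realType) (Om : set 'rV[R]_3)
    (v : 'rV[R]_3 -> 'rV[R]_3) (d : 'rV[R]_3 -> R) : Prop :=
  L2 Om d /\
  forall phi : 'rV[R]_3 -> R, C1 phi -> supported_in Om phi ->
    integ Om (fun x => dot (v x) (cgrad phi x))
    = - integ Om (fun x => d x * phi x).

(* The L^2 weak derivative, which is unique up to a null set; the value is 0 if
   there is none. *)
Definition grad (R : realType) (Om : set 'rV[R]_3) (p : 'rV[R]_3 -> R)
    : 'rV[R]_3 -> 'rV[R]_3 :=
  xget (fun=> 0) [set w | weak_grad Om p w].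

Definition curl (R : realType) (Om : set 'rV[R]_3) (v : 'rV[R]_3 -> 'rV[R]_3)
    : 'rV[R]_3 -> 'rV[R]_3 :=
  xget (fun=> 0) [set w | weak_curl Om v w].

Definition div (R : realType) (Om : set 'rV[R]_3) (v : 'rV[R]_3 -> 'rV[R]_3)
    : 'rV[R]_3 -> R :=
  xget (fun=> 0) [set d | weak_div Om v d].

Definition Hgrad (R : realType) (Om : set 'rV[R]_3) (p : 'rV[R]_3 -> R)
    : Prop :=
  L2 Om p /\ exists w, weak_grad Om p w.

Definition Hcurl (R : realType) (Om : set 'rV[R]_3)
    (v : 'rV[R]_3 -> 'rV[R]_3) : Prop :=
  L2v Om v /\ exists w, weak_curl Om v w.

Definition Hdiv (R : realType) (Om : set 'rV[R]_3)
    (v : 'rV[R]_3 -> 'rV[R]_3) : Prop :=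
  L2v Om v /\ exists d, weak_div Om v d.

(* H_0(grad): the closure of the test functions in H^1. *)
Definition H0grad (R : realType) (Om : set 'rV[R]_3) (p : 'rV[R]_3 -> R)
    : Prop :=
  Hgrad Om p /\
  exists phi : nat -> 'rV[R]_3 -> R,
    [/\ forall n, C1 (phi n) /\ supported_in Om (phi n),
        (fun n => integ Om (fun x => (p x - phi n x) ^+ 2)) @ \oo --> (0 : R)
      & (fun n => integ Om (fun x => dot (grad Om p x - cgrad (phi n) x)
                                         (grad Om p x - cgrad (phi n) x)))
        @ \oo --> (0 : R)].

(* The trace v /\ n of v in H(curl) is the functional given by Green's formula
     phi |-> int_Om (v . curl phi - curl v . phi);
   it vanishes on the part Go = bnd Om \ Gi of the boundary when it kills the
   fields phi that vanish near Gi.  The same applies to <v, n> in H(div). *)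
Definition Himp_curl (R : realType) (Om Gi : set 'rV[R]_3)
    (v : 'rV[R]_3 -> 'rV[R]_3) : Prop :=
  Hcurl Om v /\
  forall phi : 'rV[R]_3 -> 'rV[R]_3, C1v phi -> vanishes_near Gi phi ->
    integ Om (fun x => dot (v x) (ccurl phi x))
    = integ Om (fun x => dot (curl Om v x) (phi x)).

Definition Himp_div (R : realType) (Om Gi : set 'rV[R]_3)
    (v : 'rV[R]_3 -> 'rV[R]_3) : Prop :=
  Hdiv Om v /\
  forall phi : 'rV[R]_3 -> R, C1 phi -> vanishes_near Gi phi ->
    integ Om (fun x => dot (v x) (cgrad phi x))
    = - integ Om (fun x => div Om v x * phi x).

(** * The domain and the coefficients *)

Definition lipschitz_domain (R : realType) (Om : set 'rV[R]_3) : Prop :=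
  open Om /\
  forall x, bnd Om x ->
    exists (A : 'M[R]_3) (phi : R -> R -> R) (L r : R),
      [/\ A *m A^T = 1%:M, 0 < r,
          forall a b a' b', `|phi a b - phi a' b'| <= L * (`|a - a'| + `|b - b'|)
        & forall y, eball x r y ->
            let z := (y - x) *m A in Om y <-> phi (z 0 0) (z 0 1) < z 0 2].

Definition comp_domain (R : realType) (Ob S : set 'rV[R]_3) : set 'rV[R]_3 :=
  S `\` closure Ob.

Definition Gamma_i (R : realType) (Ob S : set 'rV[R]_3) : set 'rV[R]_3 :=
  bnd (comp_domain Ob S) `&` bnd Ob.

Definition Gamma_o (R : realType) (Ob S : set 'rV[R]_3) : set 'rV[R]_3 :=
  bnd (comp_domain Ob S) `\` Gamma_i Ob S.

(* A positive continuous coefficient, bounded above and away from zero, as is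
   automatic for one that is positive and continuous up to the boundary. *)
Definition coefficient (R : realType) (Om : set 'rV[R]_3) (w : 'rV[R]_3 -> R)
    : Prop :=
  (forall x, Om x -> {for x, continuous w}) /\
  exists a b : R, 0 < a /\ forall x, Om x -> a <= w x <= b.

(** * Polynomials on R^3 *)

(* [c] ranges over coefficient families; only exponents whose total degree
   satisfies [P] occur. *)
Definition poly_of (R : realType) (k : nat) (P : pred nat)
    (f : 'rV[R]_3 -> R) : Prop :=
  exists c : nat -> nat -> nat -> R, forall x, f x =
    \sum_(a < k.+1) \sum_(b < k.+1) \sum_(d < k.+1 | P (a + b + d)%N)
      c a b d * x 0 0 ^+ a * x 0 1 ^+ b * x 0 2 ^+ d.

Definition poly_le (R : realType) (k : nat) : set ('rV[R]_3 -> R) :=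
  poly_of k (fun m => m <= k)%N.

Definition poly_hom (R : realType) (k : nat) : set ('rV[R]_3 -> R) :=
  poly_of k (fun m => m == k)%N.

(* Nedelec's first family: P_k^3 + { q homogeneous of degree k+1, x . q = 0 }. *)
Definition nedelec_ref (R : realType) (k : nat)
    : set ('rV[R]_3 -> 'rV[R]_3) :=
  [set v | exists u q : 'rV[R]_3 -> 'rV[R]_3,
    [/\ forall i, poly_le k (fun x => u x 0 i),
        forall i, poly_hom k.+1 (fun x => q x 0 i),
        forall x, dot x (q x) = 0
      & forall x, v x = u x + q x]].

(* Raviart-Thomas: P_k^3 + x P~_k. *)
Definition rt_ref (R : realType) (k : nat) : set ('rV[R]_3 -> 'rV[R]_3) :=
  [set v | exists (u : 'rV[R]_3 -> 'rV[R]_3) (s : 'rV[R]_3 -> R),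
    [/\ forall i, poly_le k (fun x => u x 0 i),
        poly_hom k s
      & forall x, v x = u x + s x *: x]].

(** * Tetrahedral meshes *)

(* Vertex 0 of the reference tetrahedron is the origin, vertex m+1 is the m-th
   unit vector. *)
Definition ref_vertex (R : realType) (j : 'I_4) : 'rV[R]_3 :=
  \row_(m < 3) (j == lift ord0 m)%:R.

(* Barycentric coordinates. *)
Definition bc (R : realType) (x : 'rV[R]_3) (j : 'I_4) : R :=
  if unlift ord0 j is Some m then x 0 m else 1 - \sum_m x 0 m.

Definition ref_tet (R : realType) : set 'rV[R]_3 :=
  [set x | forall j, 0 <= bc x j].

Definition ref_int (R : realType) : set 'rV[R]_3 :=
  [set x | forall j, 0 < bc x j].

(* The subsimplex spanned by the vertices in [I]. *)
Definition ref_sub (R : realType) (I : {set 'I_4}) : set 'rV[R]_3 :=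
  [set x | ref_tet x /\ forall j, j \notin I -> bc x j = 0].

Definition ref_face (R : realType) (i : 'I_4) : set 'rV[R]_3 :=
  @ref_sub R (~: [set i]).

(* Cells are images of the reference tetrahedron under C^1 diffeomorphisms, as
   needed to fit a domain whose outer boundary is a sphere; affine maps give
   the usual straight meshes. *)
Definition cell_map (R : realType) (F : 'rV[R]_3 -> 'rV[R]_3) : Prop :=
  [/\ exists U : set 'rV[R]_3, [/\ open U, @ref_tet R `<=` U
        & forall x, U x -> differentiable F x /\ {for x, continuous (jacobian F)}],
      set_inj (@ref_tet R) F
    & forall x, ref_tet x -> 'J F x \in unitmx].

Record is_mesh (R : realType) (Om Gi Go : set 'rV[R]_3) (N : nat)
    (Phi : 'I_N -> 'rV[R]_3 -> 'rV[R]_3) : Prop := IsMesh {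
  mesh_maps : forall K, cell_map (Phi K) ;
  mesh_int : forall K, Phi K @` @ref_int R `<=` Om ;
  mesh_cover : closure Om = \bigcup_K (Phi K @` @ref_tet R) ;
  (* automatic: the skeleton is a finite union of C^1 surface pieces *)
  mesh_null : (leb3 R).-negligible
    (@vec R @^-1` (Om `\` \bigcup_K (Phi K @` @ref_int R))) ;
  mesh_disjoint : forall K L, K != L ->
    Phi K @` @ref_int R `&` Phi L @` @ref_int R = set0 ;
  (* Two cells meet in a common subsimplex (empty if [I] is), on which the two
     parametrizations agree up to the numbering [s] of the vertices. *)
  mesh_conforming : forall K L, K != L ->
    exists (I : {set 'I_4}) (s : {perm 'I_4}),
      Phi K @` @ref_tet R `&` Phi L @` @ref_tet R
        `<=` Phi K @` @ref_sub R I /\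
      (forall x y, ref_sub I x -> (forall j, bc y (s j) = bc x j) ->
        Phi L y = Phi K x) ;
  mesh_boundary : forall x, bnd Om x ->
    exists K i, (Phi K @` @ref_face R i) x /\
      (Phi K @` @ref_face R i `<=` Gi \/ Phi K @` @ref_face R i `<=` Go)
}.

(** * Finite element spaces *)

(* ['J F x] acts on row vectors, hence is the transpose of the usual Jacobian
   DF.  Fields are transported by the covariant map DF^-T v (Nedelec) and the
   contravariant map (det DF)^-1 DF v (Raviart-Thomas).  Members are determined
   by their polynomials inside the cells, and arbitrary on the skeleton. *)

Definition lagrange_space (R : realType) (Om : set 'rV[R]_3) (N : nat)
    (Phi : 'I_N -> 'rV[R]_3 -> 'rV[R]_3) (k : nat) : set ('rV[R]_3 -> R) :=
  [set p | H0grad Om p /\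
    forall K, exists2 ph, poly_le k ph &
      forall x, ref_int x -> p (Phi K x) = ph x].

Definition nedelec_space (R : realType) (Om Gi : set 'rV[R]_3) (N : nat)
    (Phi : 'I_N -> 'rV[R]_3 -> 'rV[R]_3) (k : nat)
    : set ('rV[R]_3 -> 'rV[R]_3) :=
  [set v | Himp_curl Om Gi v /\
    forall K, exists2 vh, nedelec_ref k vh &
      forall x, ref_int x ->
        v (Phi K x) = vh x *m invmx ('J (Phi K) x)^T].

Definition rt_space (R : realType) (Om Gi : set 'rV[R]_3) (N : nat)
    (Phi : 'I_N -> 'rV[R]_3 -> 'rV[R]_3) (k : nat)
    : set ('rV[R]_3 -> 'rV[R]_3) :=
  [set v | Himp_div Om Gi v /\
    forall K, exists2 vh, rt_ref k vh &
      forall x, ref_int x ->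
        v (Phi K x) = (\det ('J (Phi K) x))^-1 *: (vh x *m 'J (Phi K) x)].

Definition L2h (R : realType) (Om : set 'rV[R]_3) (N : nat)
    (Phi : 'I_N -> 'rV[R]_3 -> 'rV[R]_3) (k : nat) : set ('rV[R]_3 -> R) :=
  [set d | L2 Om d /\
    forall K, exists2 dh, poly_le k dh &
      forall x, ref_int x -> d (Phi K x) = (\det ('J (Phi K) x))^-1 * dh x].

(* The sequence Vg -grad-> Vc -curl-> Vd -div-> Vl: each operator maps into the
   next space, and its range lies in the kernel of the next operator.  The
   reverse inclusion ker curl <= range grad is not required: it never holds
   here, because Vg vanishes on Gi while Vc has no condition there. *)
Definition discrete_sequence (R : realType) (Om : set 'rV[R]_3)
    (Vg : set ('rV[R]_3 -> R)) (Vc Vd : set ('rV[R]_3 -> 'rV[R]_3))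
    (Vl : set ('rV[R]_3 -> R)) : Prop :=
  [/\ forall p, Vg p -> exists2 E, Vc E & ae_eq_on Om (grad Om p) E,
      forall E, Vc E -> exists2 B, Vd B & ae_eq_on Om (curl Om E) B,
      forall B, Vd B -> exists2 d, Vl d & ae_eq_on Om (div Om B) d,
      forall p, Vg p -> ae_eq_on Om (curl Om (grad Om p)) (fun=> 0)
    & forall E, Vc E -> ae_eq_on Om (div Om (curl Om E)) (fun=> 0)].

(* The kernel of div in the Raviart-Thomas space. *)
Definition ker_div (R : realType) (Om : set 'rV[R]_3)
    (Vd : set ('rV[R]_3 -> 'rV[R]_3)) : set ('rV[R]_3 -> 'rV[R]_3) :=
  [set B | Vd B /\ ae_eq_on Om (div Om B) (fun=> 0)].

(** * The boundary term *)

Definition ref_triangle (R : realType) : set (R * R) :=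
  [set z | [/\ 0 <= z.1, 0 <= z.2 & z.1 + z.2 <= 1]].

Definition face_edge1 (R : realType) (i : 'I_4) : 'rV[R]_3 :=
  ref_vertex R (lift i 1) - ref_vertex R (lift i 0).

Definition face_edge2 (R : realType) (i : 'I_4) : 'rV[R]_3 :=
  ref_vertex R (lift i 2) - ref_vertex R (lift i 0).

Definition face_point (R : realType) (i : 'I_4) (z : R * R) : 'rV[R]_3 :=
  ref_vertex R (lift i 0) + z.1 *: face_edge1 R i + z.2 *: face_edge2 R i.

(* The cross product of the two tangent vectors of the parametrization
   [F \o face_point i]: normal to the face, of length the area density. *)
Definition face_cross (R : realType) (F : 'rV[R]_3 -> 'rV[R]_3) (i : 'I_4)
    (z : R * R) : 'rV[R]_3 :=
  let x := face_point i z in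
  cross (face_edge1 R i *m 'J F x) (face_edge2 R i *m 'J F x).

(* Defined up to orientation, on which tangential parts do not depend. *)
Definition face_normal (R : realType) (F : 'rV[R]_3 -> 'rV[R]_3) (i : 'I_4)
    (z : R * R) : 'rV[R]_3 :=
  (enorm (face_cross F i z))^-1 *: face_cross F i z.

Definition tangential (R : realType) (n v : 'rV[R]_3) : 'rV[R]_3 :=
  v - dot v n *: n.

(* The boundary value of a field, taken from inside the cell. *)
Definition cell_trace (R : realType) (F : 'rV[R]_3 -> 'rV[R]_3)
    (v : 'rV[R]_3 -> 'rV[R]_3) (x : 'rV[R]_3) : 'rV[R]_3 :=
  lim (v y @[y --> within (F @` @ref_int R) (nbhs x)]).

(* int_Gi <E_tan, F_tan>, as a sum of surface integrals over the boundary faces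
   of the mesh that make up Gi. *)
Definition bform (R : realType) (Gi : set 'rV[R]_3) (N : nat)
    (Phi : 'I_N -> 'rV[R]_3 -> 'rV[R]_3) (E F : 'rV[R]_3 -> 'rV[R]_3) : R :=
  \sum_(K < N) \sum_(i < 4 | `[< Phi K @` @ref_face R i `<=` Gi >])
    \int[leb2 R]_(z in @ref_triangle R)
      (let x := Phi K (face_point i z) in
       let n := face_normal (Phi K) i z in
       dot (tangential n (cell_trace (Phi K) E x))
           (tangential n (cell_trace (Phi K) F x))
       * enorm (face_cross (Phi K) i z)).

(** * The mixed problem *)

Record data (R : realType) := Data {
  rhs_B : ('rV[R]_3 -> 'rV[R]_3) -> R ;
  rhs_E : ('rV[R]_3 -> 'rV[R]_3) -> R ;
  rhs_p : ('rV[R]_3 -> R) -> R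
}.

(* [b E F] stands for the boundary integral of <E_tan, F_tan> over Gi. *)
Definition solves (R : realType) (Om : set 'rV[R]_3)
    (Vg : set ('rV[R]_3 -> R)) (Vc Vd : set ('rV[R]_3 -> 'rV[R]_3))
    (b : ('rV[R]_3 -> 'rV[R]_3) -> ('rV[R]_3 -> 'rV[R]_3) -> R)
    (eps mu : 'rV[R]_3 -> R) (gamma tau : R) (g : data R)
    (B E : 'rV[R]_3 -> 'rV[R]_3) (p : 'rV[R]_3 -> R) : Prop :=
  [/\ Vd B, Vc E, Vg p &
    forall C F q, Vd C -> Vc F -> Vg q ->
    [/\ 2 / tau * ipv Om (inv_w mu) B C + ipv Om (inv_w mu) (curl Om E) C
          = rhs_B g C,
        2 / tau * ipv Om eps E F + ipv Om eps (grad Om p) F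
          - ipv Om (inv_w mu) B (curl Om F) + (1 + gamma) * b E F
          = rhs_E g F
      & 2 / tau * ips Om p q - ipv Om eps E (grad Om q) = rhs_p g q]].

Definition norm_div (R : realType) (Om : set 'rV[R]_3) (mu : 'rV[R]_3 -> R)
    (tau : R) (B : 'rV[R]_3 -> 'rV[R]_3) : R :=
  Num.sqrt (2 / tau * ipv Om (inv_w mu) B B + ips Om (div Om B) (div Om B)).

Definition norm_curl (R : realType) (Om : set 'rV[R]_3)
    (b : ('rV[R]_3 -> 'rV[R]_3) -> ('rV[R]_3 -> 'rV[R]_3) -> R)
    (eps mu : 'rV[R]_3 -> R) (gamma tau : R) (E : 'rV[R]_3 -> 'rV[R]_3) : R :=
  Num.sqrt (2 / tau * ipv Om eps E E
            + tau / 2 * ipv Om (inv_w mu) (curl Om E) (curl Om E)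
            + (1 + gamma) * b E E).

Definition norm_grad (R : realType) (Om : set 'rV[R]_3) (eps : 'rV[R]_3 -> R)
    (tau : R) (p : 'rV[R]_3 -> R) : R :=
  Num.sqrt (2 / tau * ips Om p p + tau / 2 * ipv Om eps (grad Om p) (grad Om p)).

Definition dual_norm (R : realType) (X : Type) (V : set X) (nrm : X -> R)
    (g : X -> R) : \bar R :=
  ereal_sup [set `|g v|%:E | v in [set v | V v /\ nrm v <= 1]].

(* The dual of the divergence-free subspace, as a space of functionals on Vd:
   those that vanish on its complement, orthogonal for <mu^-1 . , . > or,
   equivalently, for the inner product of [norm_div]. *)
Definition in_dual_ker_div (R : realType) (Om : set 'rV[R]_3)
    (Vd : set ('rV[R]_3 -> 'rV[R]_3)) (mu : 'rV[R]_3 -> R)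
    (g : ('rV[R]_3 -> 'rV[R]_3) -> R) : Prop :=
  forall C, Vd C ->
    (forall D, ker_div Om Vd D -> ipv Om (inv_w mu) C D = 0) -> g C = 0.

(* [B0 E0 p0] is the solution at the previous time step, [j0] and [j1] the
   current densities at the previous and the current one. *)
Definition step_data (R : realType) (Om : set 'rV[R]_3)
    (b : ('rV[R]_3 -> 'rV[R]_3) -> ('rV[R]_3 -> 'rV[R]_3) -> R)
    (eps mu : 'rV[R]_3 -> R) (gamma tau : R)
    (B0 E0 : 'rV[R]_3 -> 'rV[R]_3) (p0 : 'rV[R]_3 -> R)
    (j0 j1 : 'rV[R]_3 -> 'rV[R]_3) : data R :=
  Data
    (fun C => 2 / tau * ipv Om (inv_w mu) B0 C
              - ipv Om (inv_w mu) (curl Om E0) C)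
    (fun F => 2 / tau * ipv Om eps E0 F - ipv Om eps (grad Om p0) F
              + ipv Om (inv_w mu) B0 (curl Om F) - (1 + gamma) * b E0 F
              - ipv Om (@one_w R) (fun x => j1 x + j0 x) F)
    (fun q => 2 / tau * ips Om p0 q + ipv Om eps E0 (grad Om q)).

Definition admissible_data (R : realType) (Om : set 'rV[R]_3)
    (Vg : set ('rV[R]_3 -> R)) (Vc Vd : set ('rV[R]_3 -> 'rV[R]_3))
    (b : ('rV[R]_3 -> 'rV[R]_3) -> ('rV[R]_3 -> 'rV[R]_3) -> R)
    (eps mu : 'rV[R]_3 -> R) (gamma tau : R) : set (data R) :=
  [set g | (exists B0 E0 p0 j0 j1,
      [/\ Vd B0, Vc E0, Vg p0, L2v Om j0 /\ L2v Om j1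
        & g = step_data Om b eps mu gamma tau B0 E0 p0 j0 j1]) /\
    in_dual_ker_div Om Vd mu (rhs_B g)].

(* Existence, uniqueness (of functions modulo null sets) and continuous
   dependence on the data, in the weighted norms and their dual norms; the
   constant does not depend on the data. *)
Definition well_posed (R : realType) (Om : set 'rV[R]_3)
    (Vg : set ('rV[R]_3 -> R)) (Vc Vd : set ('rV[R]_3 -> 'rV[R]_3))
    (b : ('rV[R]_3 -> 'rV[R]_3) -> ('rV[R]_3 -> 'rV[R]_3) -> R)
    (eps mu : 'rV[R]_3 -> R) (gamma tau : R) (D : set (data R)) : Prop :=
  exists2 c : R, 0 < c & forall g : data R, D g ->
  exists B E p,
    [/\ solves Om Vg Vc Vd b eps mu gamma tau g B E p,
        forall B' E' p', solves Om Vg Vc Vd b eps mu gamma tau g B' E' p' ->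
          [/\ ae_eq_on Om B' B, ae_eq_on Om E' E & ae_eq_on Om p' p]
      & ((norm_div Om mu tau B + norm_curl Om b eps mu gamma tau E
            + norm_grad Om eps tau p)%:E
         <= c%:E * (dual_norm (ker_div Om Vd) (norm_div Om mu tau) (rhs_B g)
                    + dual_norm Vc (norm_curl Om b eps mu gamma tau) (rhs_E g)
                    + dual_norm Vg (norm_grad Om eps tau) (rhs_p g)))%E].

(* Main.v *)
(* In the system tested with its own solution the skew terms cancel and what is
   left is the energy 2/tau (|B|^2 + |E|^2 + |p|^2) + (1 + gamma) |E|_{Gamma_i}^2,
   which vanishes only for null fields.  The finite element spaces are finite
   dimensional modulo fields that vanish inside every cell, so uniqueness gives
   existence; the weighted norms are controlled by the energy through an inverse
   inequality, whose constant depends on the mesh, and the energy of a solution is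
   its load, which is at most the sum of the dual norms times the weighted norm.
   The system is first solved with B divergence free; the equation for B then holds
   against all of the Raviart-Thomas space because curl E is divergence free and
   g_B vanishes on the orthogonal complement of the divergence-free fields.

   For this the forms must be bilinear on the spaces modulo null sets.  The L^2
   weak derivatives are unique (du Bois-Reymond), hence linear up to null sets, and
   the cell traces in the boundary term exist because each cell map is a
   homeomorphism from the closed reference tetrahedron onto its image. *)

Require Import Defs.
From mathcomp Require Import all_boot all_order all_algebra.
From mathcomp Require Import all_classical all_reals all_analysis.
From mathcomp Require Import ring lra measurable_realfun perm.
Import Order.TTheory GRing.Theory Num.Theory.
Import numFieldNormedType.Exports.
Local Open Scope classical_set_scope.
Local Open Scope ring_scope.

Set Implicit Arguments.
Unset Strict Implicit.
Unset Printing Implicit Defensive.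

(** * Bilinear forms on finite-dimensional spaces *)

Definition subspace (R : realType) (X : lmodType R) (V : set X) : Prop :=
  V 0 /\ forall (a : R) u v, V u -> V v -> V (a *: u + v).

Definition linear_on (R : realType) (X : lmodType R) (V : set X) (f : X -> R)
    : Prop :=
  forall (a : R) u v, V u -> V v -> f (a *: u + v) = a * f u + f v.

Definition bilinear_on (R : realType) (X : lmodType R) (V : set X)
    (f : X -> X -> R) : Prop :=
  (forall v, V v -> linear_on V (f ^~ v)) /\ (forall u, V u -> linear_on V (f u)).

Definition lspan (R : realType) (X : lmodType R) (s : seq X) : set X :=
  [set v | forall W : set X, subspace W -> (forall x, x \in s -> W x) -> W v].

(* Only modulo [N], and with generators that need not lie in [V]; both make
   finite dimension pass to subsets of [V] at no cost. *)
Definition fin_dim (R : realType) (X : lmodType R) (N V : set X) : Prop :=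
  exists s : seq X, forall v, V v -> exists2 w, lspan s w & N (v - w).

Section LinearAlgebra.
Variables (R : realType) (X : lmodType R).
Implicit Types (V W N : set X) (s : seq X) (u v w e : X).

Lemma subspace0 V : subspace V -> V 0.
Proof. by case. Qed.

Lemma subspaceP V a u v : subspace V -> V u -> V v -> V (a *: u + v).
Proof. by case=> _; apply. Qed.

Lemma subspaceD V u v : subspace V -> V u -> V v -> V (u + v).
Proof. by move=> hV Vu Vv; rewrite -[u]scale1r; apply: subspaceP. Qed.

Lemma subspaceZ V a u : subspace V -> V u -> V (a *: u).
Proof.
by move=> hV Vu; rewrite -[_ *: _]addr0; apply: subspaceP => //; apply: subspace0.
Qed.

Lemma subspaceB V u v : subspace V -> V u -> V v -> V (u - v).
Proof.
by move=> hV Vu Vv; rewrite addrC -scaleN1r; apply: subspaceP.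
Qed.

Lemma linear_on0 V f : subspace V -> linear_on V f -> f 0 = 0.
Proof.
move=> /subspace0 V0 /(_ 1 0 0 V0 V0); rewrite scaler0 addr0 mul1r.
by move/eqP; rewrite -subr_eq subrr eq_sym => /eqP.
Qed.

Lemma linear_onZ V f a u : subspace V -> linear_on V f -> V u ->
  f (a *: u) = a * f u.
Proof.
move=> hV hf Vu; have /= := hf a u 0 Vu (subspace0 hV).
by rewrite !addr0 (linear_on0 hV hf) addr0.
Qed.

Lemma linear_onD V f u v : linear_on V f -> V u -> V v -> f (u + v) = f u + f v.
Proof. by move=> hf Vu Vv; rewrite -{1}[u]scale1r hf // mul1r. Qed.

Lemma linear_onB V f u v : linear_on V f -> V u -> V v -> f (u - v) = f u - f v.
Proof.
by move=> hf Vu Vv; rewrite addrC -scaleN1r hf // mulN1r addrC.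
Qed.

Lemma lspan_subspace s : subspace (lspan s).
Proof.
split=> [W [W0 _] //|a u v su sv W hW hs].
by apply: subspaceP => //; [apply: su|apply: sv].
Qed.

Lemma lspan0 s : lspan s 0.
Proof. exact: subspace0 (lspan_subspace s). Qed.

Lemma lspanP s a u v : lspan s u -> lspan s v -> lspan s (a *: u + v).
Proof. exact: (subspaceP a (lspan_subspace s)). Qed.

#[local] Hint Resolve lspan_subspace : core.

Lemma lspan_mem s x : x \in s -> lspan s x.
Proof. by move=> xs W _; apply. Qed.

Lemma lspan_sub s1 s2 : {subset s1 <= s2} -> lspan s1 `<=` lspan s2.
Proof. by move=> s12 v sv W hW hs; apply: sv => // x /s12; apply: hs. Qed.

Lemma lspan_cons e s v : lspan (e :: s) v <-> exists a : R, lspan s (v - a *: e).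
Proof.
split=> [|[a sv]]; last first.
  rewrite -[v](subrK (a *: e)) addrC; apply: lspanP.
  - by apply: lspan_mem; rewrite mem_head.
  - by apply: lspan_sub sv => x xs; rewrite inE xs orbT.
move=> sv; apply: (sv [set v | exists a : R, lspan s (v - a *: e)]).
  split=> [|c u w [a au] [b bw]].
    by exists 0; rewrite scale0r subr0; apply: lspan0.
  exists (c * a + b).
  by rewrite scalerDl opprD addrACA -scalerA -scalerBr; apply: lspanP.
move=> x; rewrite inE => /predU1P[->|xs].
  by exists 1; rewrite scale1r subrr; apply: lspan0.
by exists 0; rewrite scale0r subr0; apply: lspan_mem.
Qed.

Lemma lspan_nil v : lspan [::] v -> v = 0.
Proof.
move=> /(_ [set 0]); apply => //.
by split=> // a _ _ -> ->; rewrite scaler0 addr0.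
Qed.

(* Eliminate the generators one at a time: if some [v0] in [V] has a nonzero
   coefficient on the first one, [v0] replaces it. *)
Lemma fin_dim_generators N V : subspace N -> subspace V -> fin_dim N V ->
  exists s, (forall x, x \in s -> V x) /\
    forall v, V v -> exists2 w, lspan s w & N (v - w).
Proof.
move=> hN hV [s]; elim: s V hV => [|e s IH] V hV hs.
  by exists [::].
pose V' := [set v | V v /\ exists2 w, lspan s w & N (v - w)].
have hs' := lspan_subspace s.
have hV' : subspace V'.
  split=> [|a u v [Vu [w sw Nw]] [Vv [z sz Nz]]].
    split; first exact: subspace0.
    by exists 0; [apply: lspan0|rewrite subr0; apply: subspace0].
  split; first by apply: subspaceP.
  exists (a *: w + z); first by apply: lspanP.
  by rewrite opprD addrACA -scalerBr; apply: subspaceP.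
have [t [tV' ht]] := IH V' hV' (fun v Vv => Vv.2).
have [VV'|] := pselect (V `<=` V').
  by exists t; split=> [x /tV'[]//|v /VV']; apply: ht.
move=> /existsNP[v0 /not_implyP[Vv0 nV'v0]].
have [w0 /lspan_cons[a0 sw0] Nw0] := hs v0 Vv0.
have a0N : a0 != 0.
  apply/eqP => a00; apply: nV'v0; split=> //; exists w0 => //.
  by move: sw0; rewrite a00 scale0r subr0.
exists (v0 :: t); split=> [x|v Vv].
  by rewrite inE => /predU1P[->//|/tV'[]].
have [w /lspan_cons[a sw] Nw] := hs v Vv.
have [b ba] : exists b, b * a0 = - a by exists (- a / a0); rewrite divfK.
have V'v : V' (b *: v0 + v).
  split; first by apply: subspaceP.
  exists (b *: w0 + w); last first.
    by rewrite opprD addrACA -scalerBr; apply: subspaceP.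
  have -> : b *: w0 + w = b *: (w0 - a0 *: e) + (w - a *: e).
    rewrite scalerBr scalerA ba scaleNr opprK.
    by rewrite addrACA subrr addr0.
  by apply: lspanP.
have [z sz Nz] := ht _ V'v; exists (z - b *: v0).
  apply/lspan_cons; exists (- b); rewrite scaleNr opprK subrK //.
by rewrite opprB addrA [v + _]addrC.
Qed.

Lemma fin_dimS N V W : V `<=` W -> fin_dim N W -> fin_dim N V.
Proof. by move=> VW [s hs]; exists s => v /VW; apply: hs. Qed.

(* A linear functional on the span of [s] is represented by [a] as soon as it
   vanishes on the kernel of the quadratic form of [a]; the induction makes the
   generators orthogonal from one side. *)
Lemma lspan_representation V a s : subspace V -> bilinear_on V a ->
    (forall x, x \in s -> V x) ->
    (forall u v, V u -> V v -> a v v = 0 -> a u v = 0) ->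
  forall l, linear_on V l -> (forall v, V v -> a v v = 0 -> l v = 0) ->
  exists2 u, lspan s u & forall v, lspan s v -> a u v = l v.
Proof.
move=> hV [al ar]; elim: s => [|e s IH] sV ker l hl l0.
  exists 0 => [|v /lspan_nil ->]; first exact: lspan0.
  by rewrite (linear_on0 hV hl) (linear_on0 hV) //; apply: ar; apply: subspace0.
have {}IH := IH (fun x xs => sV x (mem_behead (s := e :: s) xs)) ker.
have Ve : V e by apply: sV; rewrite mem_head.
have sWV v : lspan s v -> V v.
  by apply => // x xs; apply: sV; rewrite inE xs orbT.
have [u0 su0 hu0] := IH l hl l0.
have [z sz hz] := IH (a e) (ar e Ve) (fun v Vv => ker e v Ve Vv).
have [Vu0 Vz] := (sWV _ su0, sWV _ sz).
have Vez : V (e - z) by apply: subspaceB.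
have az v : lspan s v -> a (e - z) v = 0.
  by move=> sv; rewrite (linear_onB (al v (sWV _ sv))) // hz // subrr.
have [c hc] : exists c, a u0 (e - z) + c * a (e - z) (e - z) = l (e - z).
  have [a0|aN] := eqVneq (a (e - z) (e - z)) 0.
    by exists 0; rewrite mul0r addr0 ker // l0.
  by exists ((l (e - z) - a u0 (e - z)) / a (e - z) (e - z)); rewrite divfK // addrC subrK.
exists (c *: (e - z) + u0).
  apply/lspan_cons; exists c.
  rewrite scalerBr -[_ - _ + u0]addrA [X in lspan s X]addrC addKr -scaleNr.
  by apply: lspanP.
move=> v /lspan_cons[d sv].
set y := v - d *: e in sv.
have -> : v = d *: (e - z) + (d *: z + y).
  by rewrite addrA -scalerDr subrK /y addrC subrK.
have sdz : lspan s (d *: z + y) by apply: lspanP.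
have Vdz := sWV _ sdz.
have Vu : V (c *: (e - z) + u0) by apply: subspaceP.
rewrite (ar _ Vu) // hl // -hc -(hu0 _ sdz) !al // (az _ sdz).
by ring.
Qed.

Lemma representation N V a : subspace N -> subspace V -> fin_dim N V ->
    bilinear_on V a ->
    (forall v, V v -> N v -> a v v = 0) ->
    (forall u v, V u -> V v -> a v v = 0 -> a u v = 0) ->
  forall l, linear_on V l -> (forall v, V v -> a v v = 0 -> l v = 0) ->
  exists2 u, V u & forall v, V v -> a u v = l v.
Proof.
move=> hN hV fV ha aN ker l hl l0.
have [s [sV hs]] := fin_dim_generators hN hV fV.
have sWV v : lspan s v -> V v by apply.
have [u su hu] := lspan_representation hV ha sV ker hl l0.
exists u => [|v Vv]; first exact: sWV.
have [w sw Nvw] := hs v Vv.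
have [Vu Vw] := (sWV _ su, sWV _ sw).
have Vvw : V (v - w) by apply: subspaceB.
have avw0 := aN _ Vvw Nvw.
rewrite -(subrK w v) (linear_onD (ha.2 u Vu)) // (linear_onD hl) //.
by rewrite ker // l0 // hu.
Qed.

Lemma psd_cauchy_schwarz V a u v : subspace V -> bilinear_on V a ->
    (forall u v, V u -> V v -> a u v = a v u) -> (forall u, V u -> 0 <= a u u) ->
  V u -> V v -> a v v = 0 -> a u v = 0.
Proof.
move=> hV [al ar] sym pos Vu Vv v0.
have key (t : R) : 0 <= a u u + 2 * t * a u v.
  have Vt : V (t *: v + u) by apply: subspaceP.
  have := pos _ Vt; rewrite (al _ Vt) // !ar // v0 (sym v u) //.
  by rewrite mulr0 add0r; congr (0 <= _); ring.
apply/eqP; apply/negPn/negP => a0.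
have := key (- (a u u + 1) / (2 * a u v)).
have -> : 2 * (- (a u u + 1) / (2 * a u v)) * a u v = - (a u u + 1) by field.
by lra.
Qed.

Lemma psd_sum_le V a u v : subspace V -> bilinear_on V a ->
    (forall u v, V u -> V v -> a u v = a v u) -> (forall u, V u -> 0 <= a u u) ->
  V u -> V v -> a (u + v) (u + v) <= 2 * a u u + 2 * a v v.
Proof.
move=> hV [al ar] sym pos Vu Vv.
have Vd := subspaceD hV Vu Vv; have Vb := subspaceB hV Vu Vv.
have := pos _ Vb.
rewrite (linear_onB (al _ Vb)) // !(linear_onB (ar _ _)) //.
rewrite (linear_onD (al _ Vd)) // !(linear_onD (ar _ _)) // (sym v u) //.
by lra.
Qed.

(* Two quadratic forms on a finite-dimensional space, the kernel of one inside
   that of the other: peel off the generators, made orthogonal for [q]. *)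
Lemma inverse_inequality N V q p : subspace N -> subspace V -> fin_dim N V ->
    bilinear_on V q -> bilinear_on V p ->
    (forall u v, V u -> V v -> q u v = q v u) ->
    (forall u v, V u -> V v -> p u v = p v u) ->
    (forall u, V u -> 0 <= q u u) -> (forall u, V u -> 0 <= p u u) ->
    (forall v, V v -> N v -> q v v = 0) ->
    (forall v, V v -> q v v = 0 -> p v v = 0) ->
  exists2 k : R, 0 < k & forall v, V v -> p v v <= k * q v v.
Proof.
move=> hN hV fV hq hp qs ps q0 p0 qN qp.
have [s [sV hs]] := fin_dim_generators hN hV fV.
have qker u v Vu Vv := @psd_cauchy_schwarz V q u v hV hq qs q0 Vu Vv.
have pker u v Vu Vv := @psd_cauchy_schwarz V p u v hV hp ps p0 Vu Vv.
suff [k k0 hk] : exists2 k : R, 0 < k & forall v, lspan s v -> p v v <= k * q v v.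
  exists k => // v Vv; have [w sw Nvw] := hs v Vv.
  have Vw : V w by apply: sw.
  have Vd : V (v - w) by apply: subspaceB.
  have same a : bilinear_on V a -> (forall u v, V u -> V v -> a u v = a v u) ->
      (forall u v, V u -> V v -> a v v = 0 -> a u v = 0) ->
      a (v - w) (v - w) = 0 -> a v v = a w w.
    move=> [al ar] sa ka a0.
    rewrite -{1 2}(subrK w v) (linear_onD (al _ _)) ?subrK // sa //.
    rewrite (ka v) // add0r -{1}(subrK w v) (linear_onD (ar _ _)) //.
    by rewrite (ka w) // add0r.
  have qd := qN _ Vd Nvw.
  by rewrite (same p) // ?(same q) ?hk //; apply: qp.
elim: s sV {hs} => [|e s IH] sV.
  exists 1 => // v /lspan_nil ->; have V0 := subspace0 hV.
  by rewrite (linear_on0 hV (hp.2 _ V0)) (linear_on0 hV (hq.2 _ V0)) mulr0.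
have sV' x : x \in s -> V x by move=> xs; apply: sV; rewrite inE xs orbT.
have [k k0 hk] := IH sV'.
have Ve : V e by apply: sV; rewrite mem_head.
have sWV v : lspan s v -> V v by apply.
have [z sz hz] := lspan_representation hV hq sV' qker (hq.2 e Ve)
  (fun v Vv => qker e v Ve Vv).
have Vz := sWV _ sz; have Vez : V (e - z) by apply: subspaceB.
pose f := e - z.
pose m := p f f / q f f.
have m0 : 0 <= m by rewrite divr_ge0 ?q0 ?p0.
exists (2 * k + 2 * m); first by lra.
move=> v /lspan_cons[d sv].
set y := v - d *: e in sv.
have -> : v = d *: f + (d *: z + y).
  by rewrite addrA -scalerDr subrK /y addrC subrK.
have sw : lspan s (d *: z + y) by apply: lspanP.
move: (d *: z + y) sw => w sw; have Vw := sWV _ sw.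
have Vdf : V (d *: f) by apply: subspaceZ.
have qfw : q f w = 0.
  by rewrite (linear_onB (hq.1 w Vw)) // hz // subrr.
apply: (le_trans (psd_sum_le hV hp ps p0 Vdf Vw)).
have Vs := subspaceD hV Vdf Vw.
rewrite (linear_onD (hq.1 _ Vs)) // !(linear_onD (hq.2 _ _)) //.
rewrite (qs w (d *: f)) //.
rewrite !(linear_onZ _ hV (hq.1 _ _)) // !(linear_onZ _ hV (hp.1 _ _)) //.
rewrite !(linear_onZ _ hV (hq.2 _ _)) // !(linear_onZ _ hV (hp.2 _ _)) // qfw.
have -> : p f f = m * q f f.
  have [qf|qf] := eqVneq (q f f) 0; last by rewrite divfK.
  by rewrite qf mulr0 qp.
have := hk _ sw; have := q0 _ Vw; have := mulr_ge0 (sqr_ge0 d) (q0 _ Vez).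
rewrite -/f; set A := q f f; set B := q w w; set C := p w w => h1 h2 h3.
have h4 : 0 <= m * B by apply: mulr_ge0.
have h5 : 0 <= k * (d ^+ 2 * A) by apply: mulr_ge0 => //; apply: ltW.
rewrite !mulr0 addr0 add0r; nra.
Qed.

End LinearAlgebra.

Lemma lspan_image (R : realType) (X Y : lmodType R) (f : X -> Y) (s : seq X) v :
  (forall (a : R) x y, f (a *: x + y) = a *: f x + f y) ->
  lspan s v -> lspan [seq f x | x <- s] (f v).
Proof.
move=> hf /(_ [set x | lspan [seq f x | x <- s] (f x)]).
apply => [|x xs] /=; last by apply: lspan_mem; apply: map_f.
split=> [|a u w hu hw] /=; last by rewrite hf; apply: lspanP.
have := hf 1 0 0; rewrite !scale1r addr0 => /eqP.
by rewrite -subr_eq subrr eq_sym => /eqP ->; apply: lspan0.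
Qed.

Lemma fin_dim_prod (R : realType) (X Y : lmodType R) (N V : set X) (M W : set Y) :
  fin_dim N V -> fin_dim M W -> @fin_dim R (X * Y)%type (N `*` M) (V `*` W).
Proof.
move=> [s hs] [t ht].
exists ([seq ((x, 0) : X * Y) | x <- s] ++ [seq ((0, y) : X * Y) | y <- t]).
move=> [v1 v2] [/= /hs[w1 sw1 N1] /ht[w2 sw2 N2]].
exists (w1, w2) => //.
have -> : ((w1, w2) : X * Y) = (w1, 0) + (0, w2).
  by congr (_, _); rewrite /= ?addr0 ?add0r.
apply: (subspaceD (lspan_subspace _)).
  apply: (@lspan_sub _ _ [seq ((x, 0) : X * Y) | x <- s]).
    by move=> x xs; rewrite mem_cat xs.
  apply: (lspan_image (f := fun x => (x, 0) : X * Y)) sw1 => a x y.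
  by congr (_, _); rewrite /= scaler0 addr0.
apply: (@lspan_sub _ _ [seq ((0, y) : X * Y) | y <- t]).
  by move=> x xs; rewrite mem_cat xs orbT.
apply: (lspan_image (f := fun y => (0, y) : X * Y)) sw2 => a x y.
by congr (_, _); rewrite /= scaler0 addr0.
Qed.

(** * Square integrable functions *)

Section SquareIntegrable.
Context (d : measure_display) (T : measurableType d) (R : realType)
  (mu : {measure set T -> \bar R}) (D : set T).
Hypothesis mD : measurable D.
Implicit Types (f g w : T -> R) (a : R).

Definition sqint f : Prop :=
  measurable_fun D f /\ mu.-integrable D (fun t => (f t ^+ 2)%:E).

Definition bounded_measurable f : Prop :=
  measurable_fun D f /\ exists M : R, forall t, D t -> `|f t| <= M.

Lemma sqint_mul f g : sqint f -> sqint g ->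
  mu.-integrable D (EFin \o (fun t => f t * g t)).
Proof.
move=> [mf f2] [mg g2].
apply: (le_integrable mD _ _ (integrableD mD f2 g2)).
  by apply/measurable_EFinP; apply: measurable_funM.
move=> t Dt /=; rewrite lee_fin normrM [leRHS]ger0_norm ?addr_ge0 ?sqr_ge0 //.
rewrite -(real_normK (num_real (f t))) -(real_normK (num_real (g t))).
have key (x y : R) : 0 <= x * y -> x * y <= x ^+ 2 + y ^+ 2.
  by move=> h; have := sqr_ge0 (x - y) => h'; nra.
by apply: key; rewrite mulr_ge0.
Qed.

Lemma sqint_lin a f g : sqint f -> sqint g -> sqint (fun t => a * f t + g t).
Proof.
move=> hf hg; have [mf f2] := hf; have [mg g2] := hg.
split; first by apply: measurable_funD => //; apply: measurable_funM.
have fg := sqint_mul hf hg.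
have -> : (fun t => ((a * f t + g t) ^+ 2)%:E) =
    (fun t => ((a ^+ 2)%:E * (f t ^+ 2)%:E + (2 * a)%:E * (f t * g t)%:E
               + (g t ^+ 2)%:E)%E).
  by apply/funext => t; rewrite -!EFinM -!EFinD; congr EFin; ring.
by apply: integrableD => //; apply: integrableD => //; apply: integrableZl.
Qed.

Lemma sqint0 : sqint (fun=> 0).
Proof.
split; first exact: measurable_cst.
by under eq_fun do rewrite expr0n; apply: integrable0.
Qed.

Lemma eq_bounded_measurable f g : (forall t, D t -> f t = g t) ->
  bounded_measurable f -> bounded_measurable g.
Proof.
move=> fg [mf [M hM]]; split; last by exists M => t Dt; rewrite -fg ?hM.
by apply: eq_measurable_fun mf => t; rewrite inE => /fg.
Qed.

Lemma bounded_measurableM f g :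
  bounded_measurable f -> bounded_measurable g ->
  bounded_measurable (fun t => f t * g t).
Proof.
move=> [mf [M hM]] [mg [K hK]]; split; first exact: measurable_funM.
by exists (M * K) => t Dt; rewrite normrM ler_pM // ?hM ?hK.
Qed.

Lemma bounded_measurableD f g :
  bounded_measurable f -> bounded_measurable g ->
  bounded_measurable (fun t => f t + g t).
Proof.
move=> [mf [M hM]] [mg [K hK]]; split; first exact: measurable_funD.
by exists (M + K) => t Dt; rewrite (le_trans (ler_normD _ _)) // lerD ?hM ?hK.
Qed.

Lemma bounded_measurable_cst a : bounded_measurable (fun=> a).
Proof. by split; [exact: measurable_cst|exists `|a|]. Qed.

Lemma bounded_measurable_sum (I : Type) (s : seq I) (P : pred I)
    (F : I -> T -> R) : (forall i, bounded_measurable (F i)) ->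
  bounded_measurable (fun t => \sum_(i <- s | P i) F i t).
Proof.
move=> hF; elim: s => [|i s IH].
  have -> : (fun t => \sum_(i <- [::] | P i) F i t) = fun=> 0.
    by apply: funext => t; rewrite big_nil.
  exact: bounded_measurable_cst.
have [Pi|nPi] := boolP (P i); last first.
  have -> // : (fun t => \sum_(j <- i :: s | P j) F j t) =
      (fun t => \sum_(j <- s | P j) F j t).
  by apply: funext => t; rewrite big_cons (negbTE nPi).
have -> : (fun t => \sum_(j <- i :: s | P j) F j t) =
    (fun t => F i t + \sum_(j <- s | P j) F j t).
  by apply: funext => t; rewrite big_cons Pi.
exact: bounded_measurableD.
Qed.

Lemma bounded_measurable_bounded f : bounded_measurable f ->
  [bounded f t | t in D].
Proof.
move=> [_ [M hM]]; exists M; split; first exact: num_real.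
by move=> y My t Dt /=; rewrite (le_trans (hM t Dt)) // ltW.
Qed.

Lemma bounded_measurable_integrable f : (mu D < +oo)%E ->
  bounded_measurable f -> mu.-integrable D (EFin \o f).
Proof.
move=> Dfin hf; apply: measurable_bounded_integrable => //; first by case: hf.
exact: bounded_measurable_bounded.
Qed.

Lemma bounded_measurable_sqint f : (mu D < +oo)%E ->
  bounded_measurable f -> sqint f.
Proof.
move=> Dfin hf; split; first exact: hf.1.
exact: bounded_measurable_integrable (bounded_measurableM hf hf).
Qed.

Lemma sqintM w f : bounded_measurable w -> sqint f ->
  sqint (fun t => w t * f t).
Proof.
move=> hw [mf f2]; split; first by apply: measurable_funM => //; case: hw.
have hw2 := bounded_measurableM hw hw.
have -> : (fun t => ((w t * f t) ^+ 2)%:E) =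
    ((EFin \o (fun t => w t * w t)%R) \* (fun t => (f t ^+ 2)%R%:E))%E.
  by apply/funext => t /=; rewrite -EFinM exprMn expr2.
apply: integrableMr => //; first by case: hw2.
exact: bounded_measurable_bounded.
Qed.

Lemma Rintegral_ae_eq f g : measurable_fun D f -> measurable_fun D g ->
  {ae mu, forall t, D t -> f t = g t} ->
  \int[mu]_(t in D) f t = \int[mu]_(t in D) g t.
Proof.
move=> mf mg fg; rewrite /Rintegral; congr fine; apply: ae_eq_integral => //.
- by apply/measurable_EFinP.
- by apply/measurable_EFinP.
- by apply: filterS fg => t fg Dt; rewrite fg.
Qed.

Lemma Rintegral_ge0_eq0 f : mu.-integrable D (EFin \o f) ->
  (forall t, D t -> 0 <= f t) -> \int[mu]_(t in D) f t = 0 ->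
  {ae mu, forall t, D t -> f t = 0}.
Proof.
move=> fi f0 If.
have mf := measurable_int mu fi.
have [/(_ _)] := ae_eq_integral_abs mu mD mf.
have -> : (\int[mu]_(x in D) `|(EFin \o f) x| = 0)%E.
  have fin := integrable_fin_num mD fi.
  rewrite (eq_integral (EFin \o f)); last first.
    by move=> t; rewrite inE => Dt /=; rewrite ger0_norm ?f0.
  by rewrite -(fineK fin); move: If; rewrite /Rintegral /= => ->.
move=> /(_ erefl) + _.
by apply: filterS => t h Dt; have := h Dt; rewrite /= => -[].
Qed.

Lemma integrable_lin a f g : mu.-integrable D (EFin \o f) ->
  mu.-integrable D (EFin \o g) ->
  mu.-integrable D (EFin \o (fun t => a * f t + g t)).
Proof.
move=> fi gi.
have -> : EFin \o (fun t => a * f t + g t) =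
  (fun t => a%:E * (EFin \o f) t + (EFin \o g) t)%E by [].
by apply: integrableD => //; apply: integrableZl.
Qed.

Lemma Rintegral_lin a f g : mu.-integrable D (EFin \o f) ->
  mu.-integrable D (EFin \o g) ->
  \int[mu]_(t in D) (a * f t + g t) =
    a * \int[mu]_(t in D) f t + \int[mu]_(t in D) g t.
Proof.
move=> fi gi; rewrite RintegralD //; first by rewrite RintegralZl.
have -> : EFin \o (fun t => a * f t) = (fun t => a%:E * (EFin \o f) t)%E by [].
exact: integrableZl.
Qed.

End SquareIntegrable.

(** * Boxes and open sets in R^3 *)

Lemma sum_ord3 (V : nmodType) (F : 'I_3 -> V) : \sum_i F i = F 0 + F 1 + F 2.
Proof.
rewrite !big_ord_recl big_ord0 addr0 addrA.
by congr (F _ + F _ + F _); apply: val_inj.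
Qed.

Lemma prod_ord3 (V : comPzSemiRingType) (F : 'I_3 -> V) :
  \prod_i F i = F 0 * F 1 * F 2.
Proof.
rewrite !big_ord_recl big_ord0 mulr1 mulrA.
by congr (F _ * F _ * F _); apply: val_inj.
Qed.

Section Boxes.
Variable R : realType.
Implicit Types (a b t : R * R * R) (U : set 'rV[R]_3).

Definition unvec (x : 'rV[R]_3) : R * R * R := (x 0 0, x 0 1, x 0 2).

Lemma ord3P (P : 'I_3 -> Prop) : P 0 -> P 1 -> P 2 -> forall i, P i.
Proof.
move=> P0 P1 P2 [[|[|[|//]]] h].
- by rewrite (_ : Ordinal h = 0) //; apply: val_inj.
- by rewrite (_ : Ordinal h = 1) //; apply: val_inj.
- by rewrite (_ : Ordinal h = 2) //; apply: val_inj.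
Qed.

Lemma vec0 t : vec t 0 0 = t.1.1. Proof. by rewrite mxE. Qed.
Lemma vec1 t : vec t 0 1 = t.1.2. Proof. by rewrite mxE. Qed.
Lemma vec2 t : vec t 0 2 = t.2. Proof. by rewrite mxE. Qed.

Lemma unvecK x : vec (unvec x) = x.
Proof. by apply/rowP; apply: ord3P; rewrite ?vec0 ?vec1 ?vec2. Qed.

Lemma vecK t : unvec (vec t) = t.
Proof. by rewrite /unvec vec0 vec1 vec2; case: t => [[]]. Qed.

Definition obox a b : set (R * R * R) :=
  (`]a.1.1, b.1.1[ `*` `]a.1.2, b.1.2[) `*` `]a.2, b.2[.

Definition cbox a b : set (R * R * R) :=
  (`[a.1.1, b.1.1] `*` `[a.1.2, b.1.2]) `*` `[a.2, b.2].

Lemma obox_measurable a b : measurable (obox a b).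
Proof. by apply: measurableX => //; apply: measurableX. Qed.

Lemma obox_cbox a b : obox a b `<=` cbox a b.
Proof.
move=> t [[/= h1 h2] h3]; move: h1 h2 h3; rewrite !in_itv /=.
by move=> /andP[/ltW ? /ltW ?] /andP[/ltW ? /ltW ?] /andP[/ltW ? /ltW ?];
  split=> /=; [split=> /=|]; rewrite in_itv /=; apply/andP.
Qed.

Lemma open_vecP U t : open U -> U (vec t) ->
  exists2 e : R, 0 < e & forall u, `|t.1.1 - u.1.1| < e -> `|t.1.2 - u.1.2| < e ->
    `|t.2 - u.2| < e -> U (vec u).
Proof.
move=> oU Ut; have /nbhs_ballP[e /= e0 he] : nbhs (vec t) U by exact: open_nbhs_nbhs.
exists e => // u h1 h2 h3; apply: he; split => // i; apply: ord3P.
- by rewrite !ord1 !vec0.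
- by rewrite !ord1 !vec1.
- by rewrite !ord1 !vec2.
Qed.

Lemma open_box_cover U : open U -> exists a b : nat -> R * R * R,
  (forall n t, cbox (a n) (b n) t -> U (vec t)) /\
  (@vec R @^-1` U `<=` \bigcup_n obox (a n) (b n)).
Proof.
move=> oU.
pose lo (q : rat * rat * rat * rat) : R * R * R :=
  (ratr q.1.1.1 - ratr q.2, ratr q.1.1.2 - ratr q.2, ratr q.1.2 - ratr q.2).
pose hi (q : rat * rat * rat * rat) : R * R * R :=
  (ratr q.1.1.1 + ratr q.2, ratr q.1.1.2 + ratr q.2, ratr q.1.2 + ratr q.2).
pose ok q := `[< forall t, cbox (lo q) (hi q) t -> U (vec t) >].
pose get (c : rat * rat * rat * rat -> R * R * R) d n : R * R * R :=
  if unpickle n is Some q then (if ok q then c q else (d, d, d)) else (d, d, d).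
exists (get lo 1), (get hi 0); split.
  have emp t : ~ cbox (1, 1, 1) (0, 0, 0) t.
    move=> [[/= + _] _]; rewrite in_itv /= => /andP[h1 h2].
    by have := le_trans h1 h2; rewrite ler10.
  move=> n t; rewrite /get; case: unpickle => [q|]; last by move=> /emp.
  by case: ifP => [/asboolP + /[dup] h|_ /emp //]; apply.
move=> t Ut; have [e e0 he] := open_vecP oU Ut.
have [r] : exists r : rat, ratr r \in `]0, (e / 2)[ by apply: rat_in_itvoo; lra.
rewrite in_itv /= => /andP[r0 re].
have near (s : R) : exists q : rat, ratr q - ratr r < s < ratr q + ratr r.
  have [q] : exists q : rat, ratr q \in `]s - ratr r, (s + ratr r)[.
    by apply: rat_in_itvoo; lra.
  by rewrite in_itv /= => /andP[h1 h2]; exists q; apply/andP; split; lra.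
have [[q1 h1] [q2 h2] [q3 h3]] := And3 (near t.1.1) (near t.1.2) (near t.2).
have okq : ok (q1, q2, q3, r).
  apply/asboolP => u [[]] /=; rewrite !in_itv /= => k1 k2 k3.
  by apply: he; rewrite ltr_norml; lra.
by exists (pickle (q1, q2, q3, r)) => //; rewrite /get pickleK okq;
  split=> /=; [split=> /=|]; rewrite in_itv.
Qed.

Lemma open_vec_measurable U : open U -> measurable (@vec R @^-1` U).
Proof.
move=> oU; have [a [b [hU cov]]] := open_box_cover oU.
rewrite (_ : _ @^-1` _ = \bigcup_n obox (a n) (b n)).
  by apply: bigcupT_measurable => n; apply: obox_measurable.
by apply/seteqP; split=> // t [n _ /obox_cbox]; apply: hU.
Qed.

Lemma continuous_vec_measurable U (f : 'rV[R]_3 -> R) : open U ->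
  (forall x, U x -> {for x, continuous f}) ->
  measurable_fun (@vec R @^-1` U) (f \o @vec R).
Proof.
move=> oU cf; apply: (measurability _ (RGenOpens.measurableE R)).
move=> _ [_ [a [b ->] <-]].
rewrite (_ : _ `&` _ = @vec R @^-1` (U `&` f @^-1` `]a, b[)) //.
apply: open_vec_measurable; rewrite openE => x [Ux fx].
apply: filterI; first exact: open_nbhs_nbhs.
by apply: (cf x Ux); apply: open_nbhs_nbhs; split=> //; apply: interval_open.
Qed.

Lemma norm_coord_le n (x : 'rV[R]_n) i : `|x 0 i| <= `|x|.
Proof.
rewrite [leRHS]/Num.norm /= mx_normrE.
exact: (le_bigmax _ (fun j : 'I_1 * 'I_n => `|x j.1 j.2|) (0, i)).
Qed.

Lemma bounded_vec_lty (A : set 'rV[R]_3) : bounded_set A ->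
  measurable (@vec R @^-1` A) -> (leb3 R (@vec R @^-1` A) < +oo)%E.
Proof.
move=> [M [Mr hM]] mA.
pose m := `|M| + 1.
have sub : @vec R @^-1` A `<=` (`[- m, m] `*` `[- m, m]) `*` `[- m, m].
  move=> t At; have nt : `|vec t| <= m.
    by apply: (hM m) At; rewrite /m; have := ler_norm M; lra.
  have ht i : - m <= vec t 0 i <= m.
    rewrite -ler_norml; apply: le_trans nt.
    exact: norm_coord_le.
  split=> /=; [split=> /=|]; rewrite in_itv /=.
  - by rewrite -vec0.
  - by rewrite -vec1.
  - by rewrite -vec2.
apply: (@le_lt_trans _ _ (leb3 R ((`[- m, m] `*` `[- m, m]) `*` `[- m, m]))).
  by apply: le_measure => //; rewrite inE //; apply: measurableX => //; apply: measurableX.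
have mm : measurable (`[- m, m] : set R) by [].
have h2 := @product_measure1E _ _ _ _ R (@lebesgue_measure R) (@lebesgue_measure R)
  _ _ mm mm.
have h3 := @product_measure1E _ _ _ _ R (leb2 R) (@lebesgue_measure R)
  _ _ (measurableX mm mm) mm.
rewrite [X in (X < _)%E]h3 [X in (X * _)%E]h2.
have [r hr] : exists r : R, lebesgue_measure (`[- m, m] : set R) = r%:E.
  rewrite lebesgue_measure_itv /= lte_fin.
  by case: ifP => _; [exists (m - - m)|exists 0].
rewrite [X in (X * _ * _)%E]hr [X in (_ * X * _)%E]hr [X in (_ * _ * X)%E]hr.
by rewrite -!EFinM ltry.
Qed.

End Boxes.

(** * Test functions *)

Section TestFunctions.
Variable R : realType.
Implicit Types (f g : 'rV[R]_3 -> R) (x : 'rV[R]_3) (y s : R).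

Lemma C1_cst (a : R) : C1 (fun _ : 'rV[R]_3 => a).
Proof.
split=> [x|i]; first exact: differentiable_cst.
rewrite (_ : pd i _ = fun=> 0); first exact: cst_continuous.
by apply/funext => x; rewrite /pd (derive_cst (a : R^o)).
Qed.

Lemma C1_continuous f : C1 f -> continuous f.
Proof. by move=> [df _] x; apply: differentiable_continuous (df x). Qed.

Lemma pdD f g i x : C1 f -> C1 g ->
  pd i (fun z => f z + g z) x = pd i f x + pd i g x.
Proof. by move=> [df _] [dg _]; apply: deriveD; apply: diff_derivable. Qed.

Lemma pdM f g i x : C1 f -> C1 g ->
  pd i (fun z => f z * g z) x = f x * pd i g x + g x * pd i f x.
Proof.
move=> [df _] [dg _].
have := deriveM (@diff_derivable _ _ _ _ _ (delta_mx 0 i) (df x))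
  (@diff_derivable _ _ _ _ _ (delta_mx 0 i) (dg x)).
exact.
Qed.

Lemma C1D f g : C1 f -> C1 g -> C1 (fun z => f z + g z).
Proof.
move=> hf hg; split=> [x|i].
  by apply: differentiableD; [case: hf => + _; apply|case: hg => + _; apply].
rewrite (_ : pd i _ = fun x => pd i f x + pd i g x).
  by move=> x; exact: (cvgD (hf.2 i x) (hg.2 i x)).
by apply/funext => x; apply: pdD.
Qed.

Lemma C1M f g : C1 f -> C1 g -> C1 (fun z => f z * g z).
Proof.
move=> hf hg; split=> [x|i].
  by apply: differentiableM; [case: hf => + _; apply|case: hg => + _; apply].
rewrite (_ : pd i _ = fun x => f x * pd i g x + g x * pd i f x).
  have [cf cg] := (C1_continuous hf, C1_continuous hg).
  move=> x; have h1 : f z * pd i g z @[z --> x] --> f x * pd i g x.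
    exact: (cvgM (cf x) (hg.2 i x)).
  have h2 : g z * pd i f z @[z --> x] --> g x * pd i f x.
    exact: (cvgM (cg x) (hf.2 i x)).
  exact: (cvgD h1 h2).
by apply/funext => x; apply: pdM.
Qed.

Lemma C1_prod (I : Type) (r : seq I) (F : I -> 'rV[R]_3 -> R) :
  (forall i, C1 (F i)) -> C1 (fun z => \prod_(i <- r) F i z).
Proof.
move=> hF; elim: r => [|i r IH].
  rewrite (_ : (fun z => _) = fun=> 1); first exact: C1_cst.
  by apply: funext => z; rewrite big_nil.
have -> : (fun z => \prod_(j <- i :: r) F j z) =
    (fun z => F i z * \prod_(j <- r) F j z).
  by apply: funext => z; rewrite big_cons.
exact: C1M.
Qed.

Lemma derive_affine_coord (a b : R) (i : 'I_3) (x v : 'rV[R]_3) :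
  'D_v (fun z : 'rV[R]_3 => (a * z 0 i + b : R^o)) x = a * v 0 i.
Proof.
apply: cvg_lim => //; apply: cvg_near_cst.
near=> h; have h0 : h != 0 by near: h; apply: nbhs_dnbhs_neq.
rewrite /= /shift /= !mxE /GRing.scale /=.
by field.
Unshelve. all: by end_near. Qed.

Lemma differentiable_affine_coord (a b : R) (i : 'I_3) (x : 'rV[R]_3) :
  differentiable (fun z : 'rV[R]_3 => (a * z 0 i + b : R^o)) x.
Proof.
apply: differentiableD; last exact: differentiable_cst.
apply: differentiableM; first exact: differentiable_cst.
exact: differentiable_coord.
Qed.

Lemma C1_affine_coord (h : R -> R) (a b : R) (i : 'I_3) :
  (forall y, derivable (h : R^o -> R^o) y 1) ->
  continuous ((h : R^o -> R^o)^`()%classic : R -> R) ->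
  C1 (fun z : 'rV[R]_3 => h (a * z 0 i + b)).
Proof.
move=> dh ch; pose l := fun z : 'rV[R]_3 => (a * z 0 i + b : R^o).
have dl x : differentiable l x by apply: differentiable_affine_coord.
have dh' y : differentiable (h : R^o -> R^o) y by apply/derivable1_diffP.
have cl : continuous l by move=> x; apply: differentiable_continuous (dl x).
split=> [x|j]; first by apply: (differentiable_comp (dl x) (dh' (l x))).
rewrite (_ : pd j _ = fun x => (a * (j == i)%:R) * (h : R^o -> R^o)^`()%classic (l x)).
  have hd : continuous (fun x => (h : R^o -> R^o)^`()%classic (l x) : R).
    by move=> x; exact: (continuous_comp (cl x) (ch (l x))).
  by move=> x; exact: (cvgM (cvg_cst _) (hd x)).
apply/funext => x; rewrite /pd.
have -> : (fun z : 'rV[R]_3 => h (a * z 0 i + b)) = (h : R^o -> R^o) \o l by [].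
rewrite deriveE; last exact: differentiable_comp.
rewrite diff_comp //= -(deriveE _ (dl x)) derive_affine_coord mxE eqxx /= diff1E //.
by rewrite [j == i]eq_sym.
Qed.

(* The square of the positive part: C^1, with derivative [y + `|y|]. *)
Definition sqp y : R := y * (y + `|y|) / 2.

Lemma sqp_taylor y h : `|sqp (h + y) - sqp y - (y + `|y|) * h| <= h ^+ 2.
Proof.
rewrite /sqp ler_norml.
have [y0|y0] := ger0P y; have [k0|k0] := ger0P (h + y); apply/andP; split; nra.
Qed.

Lemma sqp_is_derive y : is_derive y 1 (sqp : R^o -> R^o) (y + `|y|).
Proof.
have lim : (fun h : R => h^-1 *: ((sqp \o shift y) (h *: 1) - sqp y) : R^o)
    @ 0^' --> (y + `|y| : R^o).
  apply/cvgrPdist_le => /= e e0; near=> h.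
  have h0 : h != 0 by near: h; apply: nbhs_dnbhs_neq.
  rewrite distrC /shift /= /GRing.scale /= mulr1.
  have -> : h^-1 * (sqp (h + y) - sqp y) - (y + `|y|) =
      h^-1 * (sqp (h + y) - sqp y - (y + `|y|) * h) by field.
  rewrite normrM normfV ler_pdivrMl ?normr_gt0 //.
  apply: (le_trans (sqp_taylor y h)).
  rewrite -(real_normK (num_real h)) expr2 ler_pM //.
  near: h; apply: dnbhs0_le => //.
split; first by apply/cvg_ex; eexists; apply: lim.
exact: cvg_lim lim.
Unshelve. all: by end_near. Qed.

Lemma C1_sqp (a b : R) (i : 'I_3) : C1 (fun z : 'rV[R]_3 => sqp (a * z 0 i + b)).
Proof.
apply: C1_affine_coord => [y|].
  by have [] := sqp_is_derive y.
rewrite (_ : (sqp : R^o -> R^o)^`()%classic = fun y => y + `|y|).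
  move=> y; have h : `|z| @[z --> y] --> `|y| by exact: norm_continuous.
  exact: (cvgD (@cvg_id _ (nbhs y)) h).
by apply/funext => y; rewrite derive1E; have [] := sqp_is_derive y.
Qed.

(* A C^1 step: its derivative is the hat function of height 2 on [0, 1]. *)
Definition ramp y : R := 2 * sqp y + (- 4 * sqp (y - 1 / 2) + 2 * sqp (y - 1)).

Lemma ramp_itv y : 0 <= ramp y <= 1.
Proof.
rewrite /ramp /sqp.
have [?|?] := ger0P y; have [?|?] := ger0P (y - 1 / 2);
  have [?|?] := ger0P (y - 1); apply/andP; split; try nra.
Qed.

Lemma ramp_ge0 y : 0 <= ramp y.
Proof. by case/andP: (ramp_itv y). Qed.

Lemma ramp_le1 y : ramp y <= 1.
Proof. by case/andP: (ramp_itv y). Qed.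

Lemma ramp_le0 y : y <= 0 -> ramp y = 0.
Proof. by move=> y0; rewrite /ramp /sqp !ler0_norm; lra. Qed.

Lemma ramp_ge1 y : 1 <= y -> ramp y = 1.
Proof. by move=> y1; rewrite /ramp /sqp !ger0_norm; lra. Qed.

Lemma C1_ramp (a b : R) (i : 'I_3) :
  C1 (fun z : 'rV[R]_3 => ramp (a * z 0 i + b)).
Proof.
rewrite /ramp; have h (c d : R) :
    C1 (fun z : 'rV[R]_3 => c * sqp (a * z 0 i + b - d)).
  apply: C1M; first exact: C1_cst.
  rewrite (_ : (fun z => _) = fun z : 'rV[R]_3 => sqp (a * z 0 i + (b - d))).
    exact: C1_sqp.
  by apply: funext => z; rewrite addrA.
apply: C1D; last by apply: C1D.
by have := h 2 0; under eq_fun do rewrite subr0.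
Qed.

Lemma ramp_cvg s : ramp (n%:R * s) @[n --> \oo] --> ((0 < s)%R%:R : R).
Proof.
have [s0|s0] := ltP 0 s; last first.
  apply: cvg_near_cst; apply: nearW => n.
  by rewrite ramp_le0 // mulr_ge0_le0.
apply: cvg_near_cst; near=> n; apply: ramp_ge1.
rewrite -ler_pdivrMr // div1r.
by near: n; apply: nbhs_infty_ger.
Unshelve. all: by end_near. Qed.

Definition bump (n : nat) (a b : 'rV[R]_3) (x : 'rV[R]_3) : R :=
  \prod_(i < 3) (ramp (n%:R * (x 0 i - a 0 i)) * ramp (n%:R * (b 0 i - x 0 i))).

Lemma C1_bump n (a b : 'rV[R]_3) : C1 (bump n a b).
Proof.
rewrite /bump; apply: C1_prod => i.
apply: C1M.
  rewrite (_ : (fun z => _) = fun z : 'rV[R]_3 =>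
    ramp (n%:R * z 0 i + (- (n%:R * a 0 i)))); first exact: C1_ramp.
  by apply: funext => z; rewrite mulrBr.
rewrite (_ : (fun z => _) = fun z : 'rV[R]_3 =>
  ramp (- n%:R * z 0 i + n%:R * b 0 i)); first exact: C1_ramp.
by apply: funext => z; rewrite mulrBr mulNr addrC.
Qed.

Lemma bump_itv n (a b : 'rV[R]_3) x : 0 <= bump n a b x <= 1.
Proof.
apply/andP; split.
  by apply: prodr_ge0 => i _; rewrite mulr_ge0 ?ramp_ge0.
apply: prodr_ile1 => i _; rewrite mulr_ge0 ?ramp_ge0 //=.
by rewrite mulr_ile1 ?ramp_ge0 ?ramp_le1.
Qed.

Lemma bump_eq0 n (a b : 'rV[R]_3) x i : ~~ (a 0 i < x 0 i < b 0 i) -> bump n a b x = 0.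
Proof.
rewrite negb_and -!leNgt => h; rewrite /bump (bigD1 i) //=.
have n0 : 0 <= n%:R :> R by [].
case/orP: h => h.
  by rewrite (@ramp_le0 (_ * (x 0 i - _))) ?mul0r // mulr_ge0_le0 // subr_le0.
by rewrite (@ramp_le0 (_ * (_ - x 0 i))) ?mulr0 ?mul0r // mulr_ge0_le0 // subr_le0.
Qed.

Lemma bump_cvg (a b : 'rV[R]_3) x : bump n a b x @[n --> \oo] -->
  ((\prod_(i < 3) (a 0 i < x 0 i < b 0 i)%R%:R) : R).
Proof.
have h i : ramp (n%:R * (x 0 i - a 0 i)) * ramp (n%:R * (b 0 i - x 0 i))
    @[n --> \oo] --> ((a 0 i < x 0 i < b 0 i)%R%:R : R).
  rewrite -mulnb natrM; apply: cvgM; rewrite -subr_gt0; exact: ramp_cvg.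
rewrite /bump !big_ord_recl big_ord0.
under eq_fun do rewrite !big_ord_recl big_ord0.
by do 3 (apply: cvgM; first exact: h); exact: cvg_cst.
Qed.

Lemma bump_supported n a b (Om : set 'rV[R]_3) :
  (forall t, cbox (unvec a) (unvec b) t -> Om (vec t)) ->
  supported_in Om (bump n a b).
Proof.
move=> hOm; exists [set v : 'rV[R]_3 | forall i, `[a 0 i, b 0 i]%classic (v 0 i)].
split.
- exact: (@rV_compact R 3 (fun i => `[a 0 i, b 0 i]%classic)
    (fun i => @segment_compact R _ _)).
- move=> v hv; rewrite -(unvecK v); apply: hOm.
  by split=> /=; [split=> /=|]; apply: hv.
- move=> v /existsNP[i hi]; apply: (@bump_eq0 _ _ _ _ i).
  by apply/negP => /andP[h1 h2]; apply: hi; rewrite /= in_itv /= !ltW.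
Qed.

End TestFunctions.

(** * The lemma of du Bois-Reymond *)

Section DuBoisReymond.
Variable R : realType.

Definition oboxes : set (set (R * R * R)) :=
  [set A | exists a b, A = obox a b].

Definition max3 (a c : R * R * R) : R * R * R :=
  (Num.max a.1.1 c.1.1, Num.max a.1.2 c.1.2, Num.max a.2 c.2).

Definition min3 (b d : R * R * R) : R * R * R :=
  (Num.min b.1.1 d.1.1, Num.min b.1.2 d.1.2, Num.min b.2 d.2).

Lemma obox_setI (a b c d : R * R * R) :
  obox a b `&` obox c d = obox (max3 a c) (min3 b d).
Proof.
apply/seteqP; split=> t.
  move=> [[[/= + +] +] [[/= + +] +]]; rewrite !in_itv /=.
  move=> /andP[? ?] /andP[? ?] /andP[? ?] /andP[? ?] /andP[? ?] /andP[? ?].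
  by split=> /=; [split=> /=|]; rewrite in_itv /= gt_max lt_min; apply/andP; split;
    apply/andP.
move=> [[/= + +] +]; rewrite !in_itv /= !gt_max !lt_min.
move=> /andP[/andP[? ?] /andP[? ?]] /andP[/andP[? ?] /andP[? ?]].
move=> /andP[/andP[? ?] /andP[? ?]].
by split; split=> /=; (try split=> /=); rewrite in_itv /=; apply/andP.
Qed.

Lemma cbox_setI (a b c d : R * R * R) :
  cbox (max3 a c) (min3 b d) `<=` cbox a b.
Proof.
move=> t [[/= + +] +]; rewrite !in_itv /= !ge_max !le_min.
move=> /andP[/andP[? _] /andP[? _]] /andP[/andP[? _] /andP[? _]].
move=> /andP[/andP[? _] /andP[? _]].
by split=> /=; [split=> /=|]; rewrite in_itv /=; apply/andP.
Qed.

Lemma oboxes_setI_closed : setI_closed oboxes.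
Proof.
move=> _ _ [a [b ->]] [c [d ->]].
by exists (max3 a c), (min3 b d); rewrite obox_setI.
Qed.

Lemma generated_by_oboxes (A : set (R * R * R)) : measurable A -> <<s oboxes >> A.
Proof.
pose G := g_sigma_algebraType oboxes.
have gbox a b : measurable (obox a b : set G).
  by apply: sub_sigma_algebra; exists a, b.
have cover (s : R) : exists n : nat, - n%:R < s < n%:R.
  exists (Num.truncn `|s|).+1; rewrite -ltr_norml.
  by have := truncn_itv (normr_ge0 s) => /andP[].
have m1 : measurable_fun setT (fun t : G => t.1.1).
  apply: (measurability _ (RGenOpens.measurableE R)) => _ [_ [x [y ->] <-]].
  rewrite (_ : _ `&` _ = \bigcup_n obox (x, - n%:R, - n%:R) (y, n%:R, n%:R)).
    exact: bigcupT_measurable.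
  apply/seteqP; split=> [t [_ /= h]|t [n _ [[h _] _]]] //.
  have [n hn] := cover (Num.max `|t.1.2| `|t.2|).
  move: hn; rewrite gt_max => /andP[_ /andP[]]; rewrite !ltr_norml => h1 h2.
  by exists n.
have m2 : measurable_fun setT (fun t : G => t.1.2).
  apply: (measurability _ (RGenOpens.measurableE R)) => _ [_ [x [y ->] <-]].
  rewrite (_ : _ `&` _ = \bigcup_n obox (- n%:R, x, - n%:R) (n%:R, y, n%:R)).
    exact: bigcupT_measurable.
  apply/seteqP; split=> [t [_ /= h]|t [n _ [[_ h] _]]] //.
  have [n hn] := cover (Num.max `|t.1.1| `|t.2|).
  move: hn; rewrite gt_max => /andP[_ /andP[]]; rewrite !ltr_norml => h1 h2.
  by exists n.
have m3 : measurable_fun setT (fun t : G => t.2).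
  apply: (measurability _ (RGenOpens.measurableE R)) => _ [_ [x [y ->] <-]].
  rewrite (_ : _ `&` _ = \bigcup_n obox (- n%:R, - n%:R, x) (n%:R, n%:R, y)).
    exact: bigcupT_measurable.
  apply/seteqP; split=> [t [_ /= h]|t [n _ [_ h]]] //.
  have [n hn] := cover (Num.max `|t.1.1| `|t.1.2|).
  move: hn; rewrite gt_max => /andP[_ /andP[]]; rewrite !ltr_norml => h1 h2.
  by exists n.
have mid : measurable_fun setT (fun t : G => (t.1.1, t.1.2, t.2)).
  exact: measurable_fun_pair (measurable_fun_pair m1 m2) m3.
move=> mA; have := mid measurableT _ mA.
by rewrite setTI (_ : _ @^-1` A = A) //; apply/funext => -[[]].
Qed.

Lemma integral_obox_ae0 (F : R * R * R -> \bar R) a0 b0 :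
  (leb3 R).-integrable setT F -> (forall t, ~ obox a0 b0 t -> F t = 0%E) ->
  (forall a b, \int[leb3 R]_(t in obox a b) F t = 0)%E ->
  ae_eq (leb3 R) setT F (cst 0%E).
Proof.
move=> Fi supp F0.
have ext : (\int[leb3 R]_t F t = 0)%E.
  rewrite -(F0 a0 b0) [RHS]integral_mkcond; congr integral; apply/funext => t.
  by rewrite patchE; case: ifPn => // /negP; rewrite inE => /supp.
have mF : measurable_fun setT F := measurable_int (leb3 R) Fi.
have FiS A : measurable A -> (leb3 R).-integrable A F.
  by move=> mA; apply: integrableS Fi.
pose H : set (set (R * R * R)) :=
  [set A | measurable A /\ (\int[leb3 R]_(t in A) F t = 0)%E].
have dynH : dynkin H.
  split=> [|A [mA A0]|B tB hB].
  - by split.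
  - have mC := measurableC mA; split=> //.
    move: ext; rewrite -(setUv A) integral_setU //.
    + by rewrite A0 add0e.
    + by rewrite setUv.
    + exact/disj_setPCl.
  - have mB n : measurable (B n) by case: (hB n).
    have mU : measurable (\bigcup_n B n) by apply: bigcupT_measurable.
    split=> //; rewrite integral_bigcup //; last exact: FiS.
    by rewrite eseries0 // => n _ _; case: (hB n).
have HT A : measurable A -> (\int[leb3 R]_(t in A) F t = 0)%E.
  move=> /generated_by_oboxes sA.
  suff [] : H A by [].
  apply: (lambda_system_subset oboxes_setI_closed _ _ _ sA) => //.
  - exact/dynkin_lambda_system.
  - move=> _ [a [b ->]]; split; first exact: obox_measurable.
    exact: F0.
apply: integral_ae_eq => //.
by move=> A _ mA; rewrite HT // integral_cst // mul0e.
Qed.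

Lemma du_bois_reymond (Om : set 'rV[R]_3) (f : 'rV[R]_3 -> R) : open Om ->
  (leb3 R).-integrable (@vec R @^-1` Om) (EFin \o (f \o @vec R)) ->
  (forall phi, C1 phi -> supported_in Om phi ->
    integ Om (fun x => f x * phi x) = 0) ->
  ae_eq_on Om f (fun=> 0).
Proof.
move=> oOm fi f0; set D := @vec R @^-1` Om.
have mD : measurable D by apply: open_vec_measurable.
have mf : measurable_fun D (f \o @vec R).
  by apply/measurable_EFinP; apply: (measurable_int (leb3 R)).
have box0 a b : (forall t, cbox a b t -> Om (vec t)) ->
    (\int[leb3 R]_(t in obox a b) (f (vec t))%:E = 0)%E.
  move=> sub.
  have subD : obox a b `<=` D by move=> t /obox_cbox /sub.
  pose phi n := bump n (vec a) (vec b).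
  have mphi n : measurable_fun D (phi n \o @vec R).
    apply: continuous_vec_measurable => // x _.
    exact: C1_continuous (C1_bump _ _ _) x.
  have mfphi n : measurable_fun D (fun t => f (vec t) * phi n (vec t)).
    exact: measurable_funM mf (mphi n).
  have lim : (fun n => \int[leb3 R]_(t in D) (f (vec t) * phi n (vec t))%:E)%E @ \oo
      --> (\int[leb3 R]_(t in D) ((EFin \o (f \o @vec R)) \_ (obox a b)) t)%E.
    apply: (@dominated_cvg _ _ _ (leb3 R) D mD
      (fun n t => (f (vec t) * phi n (vec t))%:E)
      ((EFin \o (f \o @vec R)) \_ (obox a b))
      (fun t => `|(f (vec t))%:E|%E)) => //.
    - by move=> n; apply/measurable_EFinP; apply: mfphi.
    - move=> t Dt.
      have -> : ((EFin \o (f \o vec (R:=R))) \_ (obox a b)) t =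
          (f (vec t) * \prod_(i < 3) (vec a 0 i < vec t 0 i < vec b 0 i)%R%:R)%:E.
        rewrite prod_ord3 -!natrM !mulnb patchE !vec0 !vec1 !vec2.
        have [h|h] := pselect (obox a b t).
          rewrite mem_set //; move: h => [[/= + +] +]; rewrite !in_itv /=.
          by move=> -> -> ->; rewrite mulr1.
        rewrite memNset //; case: andP => [[/andP[h1 h2] h3]|_]; last by rewrite mulr0.
        by case: h; split; [split|]; rewrite /= in_itv.
      apply: cvg_EFin; first exact: nearW.
      by apply: cvgM; [exact: cvg_cst|exact: bump_cvg].
    - exact: integrable_abse.
    - move=> n t Dt; rewrite /= lee_fin normrM ler_piMr //.
      by have /andP[h1 h2] := bump_itv n (vec a) (vec b) (vec t); rewrite ger0_norm.
  have -> : (\int[leb3 R]_(t in obox a b) (f (vec t))%:E =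
      \int[leb3 R]_(t in D) ((EFin \o (f \o @vec R)) \_ (obox a b)) t)%E.
    rewrite -integral_mkcondr; congr integral.
    by rewrite setIC; apply/esym/setIidl.
  rewrite -(cvg_lim _ lim) //.
  rewrite (_ : (fun n => _) = cst 0%E) ?lim_cst //.
  apply/funext => n.
  have fphi : (leb3 R).-integrable D (EFin \o (fun t => f (vec t) * phi n (vec t))).
    apply: (@le_integrable _ _ _ (leb3 R) D mD _ (EFin \o (f \o @vec R))) => //.
      by apply/measurable_EFinP; apply: mfphi.
    move=> t Dt; rewrite /= lee_fin normrM ler_piMr //.
    by have /andP[h1 h2] := bump_itv n (vec a) (vec b) (vec t); rewrite ger0_norm.
  rewrite -[LHS]fineK; last by apply: integrable_fin_num.
  congr EFin.
  apply: f0; first exact: C1_bump.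
  by apply: bump_supported => t; rewrite !vecK; apply: sub.
have [a [b [sub cov]]] := open_box_cover oOm.
have aebox n : (leb3 R).-negligible (obox (a n) (b n) `&` [set t | f (vec t) != 0]).
  pose F := (EFin \o (f \o @vec R)) \_ (obox (a n) (b n)).
  have mo := obox_measurable (a n) (b n).
  have subD : obox (a n) (b n) `<=` D by move=> t /obox_cbox /sub.
  have Fi : (leb3 R).-integrable setT F.
    have fo : (leb3 R).-integrable (obox (a n) (b n)) (EFin \o (f \o @vec R)).
      exact: integrableS fi.
    apply: (iffLR (@integrable_mkcond _ _ _ (leb3 R) _ _ _)) => //.
  have [||N [mN N0 hN]] := @integral_obox_ae0 F (a n) (b n) Fi.
  - by move=> t ht; rewrite /F patchE; case: ifPn => //; rewrite inE.
  - move=> c d; rewrite /F -integral_mkcondr.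
    by rewrite setIC obox_setI box0 // => t /cbox_setI /sub.
  exists N; split=> // t [ht /= /eqP ft]; apply: hN => /= /(_ I).
  by rewrite /F patchE mem_set // => -[].
have : (leb3 R).-negligible (\bigcup_n (obox (a n) (b n) `&` [set t | f (vec t) != 0])).
  exact: negligible_bigcup.
apply: negligibleS => t /= /not_implyP[Dt /eqP ft].
by have [n _ ht] := cov t Dt; exists n.
Qed.

End DuBoisReymond.

(** * Weak derivatives *)

#[export] Instance ae_leb3_filter (R : realType) :
  Filter (almost_everywhere (leb3 R)).
Proof. exact: ae_filter_ringOfSetsType. Qed.

Section Fields.
Variables (R : realType) (Om : set 'rV[R]_3).
Hypotheses (oOm : open Om) (bOm : bounded_set Om).
Implicit Types (p q f g w phi : 'rV[R]_3 -> R) (u v z : 'rV[R]_3 -> 'rV[R]_3).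

Let D : set (R * R * R) := @vec R @^-1` Om.

Definition bounded_weight w : Prop := bounded_measurable D (w \o @vec R).

Let mD : measurable D. Proof. exact: open_vec_measurable. Qed.
Let Dfin : (leb3 R D < +oo)%E. Proof. exact: bounded_vec_lty. Qed.

Lemma L2_lin a f g : L2 Om f -> L2 Om g -> L2 Om (fun x => a * f x + g x).
Proof. exact: (@sqint_lin _ _ _ (leb3 R) D mD a (f \o @vec R) (g \o @vec R)). Qed.

Lemma L2_0 : L2 Om (fun=> 0).
Proof. exact: (@sqint0 _ _ _ (leb3 R) D). Qed.

Lemma L2M w f : bounded_weight w -> L2 Om f -> L2 Om (fun x => w x * f x).
Proof. exact: (@sqintM _ _ _ (leb3 R) D mD (w \o @vec R) (f \o @vec R)). Qed.

Lemma bounded_weight_L2 f : bounded_weight f -> L2 Om f.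
Proof. exact: (@bounded_measurable_sqint _ _ _ (leb3 R) D mD (f \o @vec R) Dfin). Qed.

Lemma continuous_bounded_weight f : continuous f -> bounded_weight f.
Proof.
move=> cf; split; first by apply: continuous_vec_measurable => // x _; apply: cf.
have cl : compact (closure Om).
  apply: bounded_closed_compact; last exact: closed_closure.
  have [M [Mr hM]] := bOm; exists M; split=> // r Mr' x.
  pose B := [set y : 'rV[R]_3 | `|y| <= r].
  have cB : closed B.
    apply: (@closed_comp _ _ (fun y : 'rV[R]_3 => `|y|) [set s | s <= r]).
      by move=> y _; apply: norm_continuous.
    exact: closed_le.
  have sub : Om `<=` B by move=> y; apply: hM.
  by move=> /(closure_subset sub); rewrite -(closure_id _).1.
have [M [Mr hM]] : bounded_set (f @` closure Om).
  apply/compact_bounded/continuous_compact => //.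
  by apply: continuous_subspaceT.
exists (M + 1) => t Dt; apply: (hM (M + 1)); first by lra.
by exists (vec t) => //; apply: subset_closure.
Qed.

Let good f := (leb3 R).-integrable D (EFin \o (f \o @vec R)).

Lemma good_lin a f g : good f -> good g -> good (fun x => a * f x + g x).
Proof.
exact: (@integrable_lin _ _ _ (leb3 R) D mD a (f \o @vec R) (g \o @vec R)).
Qed.

Lemma integ_lin a f g : good f -> good g ->
  integ Om (fun x => a * f x + g x) = a * integ Om f + integ Om g.
Proof.
exact: (@Rintegral_lin _ _ _ (leb3 R) D mD a (f \o @vec R) (g \o @vec R)).
Qed.

Lemma L2_integrable f g : L2 Om f -> L2 Om g ->
  (leb3 R).-integrable D (EFin \o (fun t => f (vec t) * g (vec t))).
Proof. exact: (@sqint_mul _ _ _ (leb3 R) D mD (f \o @vec R) (g \o @vec R)). Qed.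

Lemma ipsC f g : ips Om f g = ips Om g f.
Proof. by rewrite /ips; congr integ; apply/funext => x; rewrite mulrC. Qed.

Lemma ips_linl a f g h : L2 Om f -> L2 Om g -> L2 Om h ->
  ips Om (fun x => a * f x + g x) h = a * ips Om f h + ips Om g h.
Proof.
move=> hf hg hh; rewrite -integ_lin; [|exact: L2_integrable..].
by congr integ; apply/funext => x; rewrite mulrDl mulrA.
Qed.

Lemma ips_ge0 f : 0 <= ips Om f f.
Proof. by apply: Rintegral_ge0 => t _; rewrite -expr2 sqr_ge0. Qed.

Lemma ae_eq_on_trans (T : Type) (f g h : 'rV[R]_3 -> T) :
  ae_eq_on Om f g -> ae_eq_on Om g h -> ae_eq_on Om f h.
Proof. by apply: filterS2 => t h1 h2 Ot; rewrite h1 // h2. Qed.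

Lemma ips_ae f g h : L2 Om f -> L2 Om g -> L2 Om h -> ae_eq_on Om f g ->
  ips Om f h = ips Om g h.
Proof.
move=> [mf _] [mg _] [mh _] fg.
apply: Rintegral_ae_eq => //.
- exact: measurable_funM mf mh.
- exact: measurable_funM mg mh.
- by apply: filterS fg => t e /e ->.
Qed.

Lemma ips_eq0 f : L2 Om f -> ips Om f f = 0 -> ae_eq_on Om f (fun=> 0).
Proof.
move=> hf f0.
have h : {ae leb3 R, forall t, D t -> f (vec t) * f (vec t) = 0}.
  apply: (@Rintegral_ge0_eq0 _ _ _ (leb3 R) D mD
    (fun t => f (vec t) * f (vec t))) => //; first exact: L2_integrable.
  by move=> t _; rewrite -expr2 sqr_ge0.
by apply: filterS h => t e /e /eqP; rewrite mulf_eq0 orbb => /eqP.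
Qed.

Lemma dotE u v x : dot (u x) (v x) = u x 0 0 * v x 0 0 + u x 0 1 * v x 0 1
  + u x 0 2 * v x 0 2.
Proof. by rewrite /dot sum_ord3. Qed.

Lemma dotC (x y : 'rV[R]_3) : dot x y = dot y x.
Proof. by apply: eq_bigr => i _; rewrite mulrC. Qed.

Lemma dot_ge0 (x : 'rV[R]_3) : 0 <= dot x x.
Proof. by apply: sumr_ge0 => i _; rewrite -expr2 sqr_ge0. Qed.

Lemma dot_eq0 (x : 'rV[R]_3) : dot x x = 0 -> x = 0.
Proof.
move=> /eqP; rewrite psumr_eq0 => [/allP h|i _]; last by rewrite -expr2 sqr_ge0.
apply/rowP => i; have := h i; rewrite mem_index_enum mulf_eq0 orbb mxE.
by move=> /(_ isT) /eqP.
Qed.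

Lemma L2v_lin a u v : L2v Om u -> L2v Om v -> L2v Om (a *: u + v).
Proof.
move=> hu hv i; have := L2_lin a (hu i) (hv i); congr L2.
by apply/funext => x; rewrite !mxE.
Qed.

Lemma L2v_0 : L2v Om 0.
Proof. by move=> i; have := L2_0; congr L2; apply/funext => x; rewrite mxE. Qed.

Lemma ipvE w u v : bounded_weight w -> L2v Om u -> L2v Om v ->
  ipv Om w u v = ips Om (fun x => w x * u x 0 0) (fun x => v x 0 0)
    + ips Om (fun x => w x * u x 0 1) (fun x => v x 0 1)
    + ips Om (fun x => w x * u x 0 2) (fun x => v x 0 2).
Proof.
move=> hw hu hv.
have h i : good (fun x => w x * u x 0 i * v x 0 i).
  exact: L2_integrable (L2M hw (hu i)) (hv i).
rewrite /ipv (_ : (fun x => _) = fun x => 1 * (w x * u x 0 0 * v x 0 0)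
    + (1 * (w x * u x 0 1 * v x 0 1) + w x * u x 0 2 * v x 0 2)).
  rewrite !integ_lin //; last exact: good_lin.
  by rewrite !mul1r addrA.
by apply/funext => x; rewrite dotE; ring.
Qed.

Lemma ipv_integrable w u v : bounded_weight w -> L2v Om u -> L2v Om v ->
  good (fun x => w x * dot (u x) (v x)).
Proof.
move=> hw hu hv.
have h i : good (fun x => w x * u x 0 i * v x 0 i).
  exact: L2_integrable (L2M hw (hu i)) (hv i).
rewrite (_ : (fun x => _) = fun x => 1 * (w x * u x 0 0 * v x 0 0)
    + (1 * (w x * u x 0 1 * v x 0 1) + w x * u x 0 2 * v x 0 2)).
  by apply: good_lin => //; apply: good_lin.
by apply/funext => x; rewrite dotE; ring.
Qed.

Lemma ipvC w u v : ipv Om w u v = ipv Om w v u.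
Proof. by congr integ; apply/funext => x; rewrite dotC. Qed.

Lemma ipv_linl w a u v z : bounded_weight w -> L2v Om u -> L2v Om v ->
  L2v Om z -> ipv Om w (a *: u + v) z = a * ipv Om w u z + ipv Om w v z.
Proof.
move=> hw hu hv hz; rewrite !ipvE //; last exact: L2v_lin.
have h i : ips Om (fun x => w x * (a *: u + v) x 0 i) (fun x => z x 0 i) =
    a * ips Om (fun x => w x * u x 0 i) (fun x => z x 0 i)
    + ips Om (fun x => w x * v x 0 i) (fun x => z x 0 i).
  rewrite -ips_linl //; [|exact: L2M..].
  by congr ips; apply/funext => x; rewrite !mxE; ring.
by rewrite !h; ring.
Qed.

Lemma ipv_linr w a u v z : bounded_weight w -> L2v Om u -> L2v Om v ->
  L2v Om z -> ipv Om w z (a *: u + v) = a * ipv Om w z u + ipv Om w z v.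
Proof. by move=> *; rewrite ![ipv Om w z _]ipvC ipv_linl. Qed.

Lemma ipv_ge0 w u : (forall x, Om x -> 0 <= w x) -> 0 <= ipv Om w u u.
Proof.
by move=> w0; apply: Rintegral_ge0 => t Dt; rewrite mulr_ge0 ?w0 ?dot_ge0.
Qed.

Lemma ipv_ae w u v z : bounded_weight w -> L2v Om u -> L2v Om v ->
  L2v Om z -> ae_eq_on Om u v -> ipv Om w u z = ipv Om w v z.
Proof.
move=> hw hu hv hz uv; rewrite !ipvE //.
have h i : ips Om (fun x => w x * u x 0 i) (fun x => z x 0 i) =
    ips Om (fun x => w x * v x 0 i) (fun x => z x 0 i).
  apply: ips_ae; [exact: L2M|exact: L2M|exact: hz|].
  by apply: filterS uv => t e /e ->.
by rewrite !h.
Qed.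

Lemma ipv_eq0 w u : bounded_weight w -> (forall x, Om x -> 0 < w x) ->
  L2v Om u -> ipv Om w u u = 0 -> ae_eq_on Om u (fun=> 0).
Proof.
move=> hw w0 hu u0.
have h : {ae leb3 R, forall t, D t -> w (vec t) * dot (u (vec t)) (u (vec t)) = 0}.
  apply: (@Rintegral_ge0_eq0 _ _ _ (leb3 R) D mD
    (fun t => w (vec t) * dot (u (vec t)) (u (vec t)))) => //; last first.
    by move=> t Dt; rewrite mulr_ge0 ?dot_ge0 // ltW // w0.
  exact: ipv_integrable.
apply: filterS h => t e Dt; move/eqP: (e Dt).
by rewrite mulf_eq0 gt_eqF ?w0 //= => /eqP /dot_eq0.
Qed.

Lemma ae_eq_on_row u v : (forall i, ae_eq_on Om (fun x => u x 0 i) (fun x => v x 0 i)) ->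
  ae_eq_on Om u v.
Proof.
move=> h; move: (h 0) (h 1) (h 2); apply: filterS3 => t h0 h1 h2 Ot; apply/rowP; apply: ord3P.
- exact: h0.
- exact: h1.
- exact: h2.
Qed.

Lemma integ_dotE u v :
  integ Om (fun x => dot (u x) (v x)) = ipv Om (@one_w R) u v.
Proof. by congr integ; apply/funext => x; rewrite mul1r. Qed.

Lemma one_w_bounded : bounded_weight (@one_w R).
Proof. by apply: continuous_bounded_weight => x; apply: cst_continuous. Qed.

Lemma C1_L2 phi : C1 phi -> L2 Om phi.
Proof.
by move=> h; apply/bounded_weight_L2/continuous_bounded_weight/C1_continuous.
Qed.

Lemma pd_L2 i phi : C1 phi -> L2 Om (pd i phi).
Proof.
by case=> _ h; apply/bounded_weight_L2/continuous_bounded_weight.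
Qed.

Lemma C1v_L2v u : C1v u -> L2v Om u.
Proof. by move=> h i; apply: C1_L2. Qed.

Lemma cgrad_L2v phi : C1 phi -> L2v Om (cgrad phi).
Proof.
move=> h i; have := pd_L2 i h; congr L2.
by apply/funext => x; rewrite mxE.
Qed.

Lemma ccurl_L2v u : C1v u -> L2v Om (ccurl u).
Proof.
move=> h i; have := L2_lin (-1) (pd_L2 (i + 2) (h (i + 1))) (pd_L2 (i + 1) (h (i + 2))).
by congr L2; apply/funext => x; rewrite mxE mulN1r addrC.
Qed.

Lemma cdiv_L2 u : C1v u -> L2 Om (cdiv u).
Proof.
move=> h; have k i := pd_L2 i (h i).
have := L2_lin 1 (k 0) (L2_lin 1 (k 1) (k 2)); congr L2.
by apply/funext => x; rewrite /cdiv sum_ord3 !mul1r addrA.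
Qed.

Lemma ae_eq_of_tests f g : L2 Om f -> L2 Om g ->
  (forall phi, C1 phi -> supported_in Om phi -> ips Om f phi = ips Om g phi) ->
  ae_eq_on Om f g.
Proof.
move=> hf hg h.
have fg := L2_lin (-1) hg hf.
suff : ae_eq_on Om (fun x => -1 * g x + f x) (fun=> 0).
  by apply: filterS => t e /e /eqP; rewrite mulN1r addrC subr_eq0 => /eqP.
apply: du_bois_reymond => //.
  have := L2_integrable fg (bounded_weight_L2 one_w_bounded).
  by congr integrable; apply/funext => t; rewrite /= mulr1.
move=> phi hphi sphi; have L2phi := C1_L2 hphi.
have := ips_linl (-1) hg hf L2phi; rewrite /ips => ->.
by move: (h _ hphi sphi); rewrite /ips => ->; rewrite mulN1r addNr.
Qed.

Lemma ae_eq_of_vtests u v : L2v Om u -> L2v Om v ->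
  (forall z, C1v z -> supported_in Om z ->
    ipv Om (@one_w R) u z = ipv Om (@one_w R) v z) ->
  ae_eq_on Om u v.
Proof.
move=> hu hv h; apply: ae_eq_on_row => i.
apply: ae_eq_of_tests => // psi hpsi [K [cK KO psi0]].
pose phi (x : 'rV[R]_3) : 'rV[R]_3 := psi x *: delta_mx 0 i.
have dphi z x : dot (z x) (phi x) = z x 0 i * psi x.
  rewrite /dot (bigD1 i) //= big1 ?addr0 => [|j ji]; rewrite !mxE.
    by rewrite !eqxx mulr1.
  by rewrite (negbTE ji) andbF !mulr0.
have := h phi; rewrite -!integ_dotE.
have e z : integ Om (fun x => dot (z x) (phi x)) = ips Om (fun x => z x 0 i) psi.
  by congr integ; apply/funext => x.
rewrite !e; apply.
  move=> j; rewrite (_ : (fun x => phi x 0 j) = fun x => psi x * (j == i)%:R).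
    exact: C1M hpsi (C1_cst _).
  by apply: funext => x; rewrite !mxE.
by exists K; split=> // x Kx; rewrite /phi psi0 // scale0r.
Qed.

Lemma weak_grad_ae p u v : weak_grad Om p u -> weak_grad Om p v -> ae_eq_on Om u v.
Proof.
move=> [hu eu] [hv ev]; apply: ae_eq_of_vtests => // phi h1 h2.
by rewrite -!integ_dotE; apply: oppr_inj; rewrite -eu // -ev.
Qed.

Lemma weak_curl_ae z u v : weak_curl Om z u -> weak_curl Om z v -> ae_eq_on Om u v.
Proof.
move=> [hu eu] [hv ev]; apply: ae_eq_of_vtests => // phi h1 h2.
by rewrite -!integ_dotE -eu // -ev.
Qed.

Lemma weak_div_ae u f g : weak_div Om u f -> weak_div Om u g -> ae_eq_on Om f g.
Proof.
move=> [hf ef] [hg eg]; apply: ae_eq_of_tests => // phi h1 h2.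
by apply: oppr_inj; rewrite /ips -ef // -eg.
Qed.

Lemma weak_grad_lin a p q u v : L2 Om p -> L2 Om q ->
  weak_grad Om p u -> weak_grad Om q v ->
  weak_grad Om (fun x => a * p x + q x) (a *: u + v).
Proof.
move=> hp hq [hu eu] [hv ev]; split; first exact: L2v_lin.
move=> phi h1 h2; have := ips_linl a hp hq (cdiv_L2 h1); rewrite /ips => ->.
rewrite eu // ev // !integ_dotE ipv_linl //.
- by rewrite opprD mulrN.
- exact: one_w_bounded.
- exact: C1v_L2v.
Qed.

Lemma weak_curl_lin a (w z u v : 'rV[R]_3 -> 'rV[R]_3) : L2v Om w -> L2v Om z ->
  weak_curl Om w u -> weak_curl Om z v -> weak_curl Om (a *: w + z) (a *: u + v).
Proof.
move=> hw hz [hu eu] [hv ev]; split; first exact: L2v_lin.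
have b1 := one_w_bounded.
move=> phi h1 h2; have p1 := C1v_L2v h1; have p2 := ccurl_L2v h1.
by rewrite !integ_dotE !ipv_linl // -!integ_dotE eu // ev.
Qed.

Lemma weak_div_lin a (w z : 'rV[R]_3 -> 'rV[R]_3) f g : L2v Om w -> L2v Om z ->
  weak_div Om w f -> weak_div Om z g ->
  weak_div Om (a *: w + z) (fun x => a * f x + g x).
Proof.
move=> hw hz [hf ef] [hg eg]; split; first exact: L2_lin.
have b1 := one_w_bounded.
move=> phi h1 h2; have p1 := C1_L2 h1; have p2 := cgrad_L2v h1.
have := ips_linl a hf hg p1; rewrite /ips => ->.
rewrite !integ_dotE ipv_linl // -!integ_dotE ef // eg //.
by rewrite opprD mulrN.
Qed.

Lemma gradP p : Hgrad Om p -> weak_grad Om p (grad Om p).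
Proof. by move=> [_ [w hw]]; apply: (@xgetPex _ _ [set w | weak_grad Om p w]); exists w. Qed.

Lemma curlP u : Hcurl Om u -> weak_curl Om u (curl Om u).
Proof. by move=> [_ [w hw]]; apply: (@xgetPex _ _ [set w | weak_curl Om u w]); exists w. Qed.

Lemma divP u : Hdiv Om u -> weak_div Om u (div Om u).
Proof. by move=> [_ [w hw]]; apply: (@xgetPex _ _ [set w | weak_div Om u w]); exists w. Qed.

Lemma Hgrad_lin a p q : Hgrad Om p -> Hgrad Om q -> Hgrad Om (fun x => a * p x + q x).
Proof.
move=> hp hq; split; first by apply: L2_lin; [case: hp|case: hq].
exists (a *: grad Om p + grad Om q).
by apply: weak_grad_lin; [case: hp|case: hq|apply: gradP|apply: gradP].
Qed.

Lemma Hcurl_lin a u v : Hcurl Om u -> Hcurl Om v -> Hcurl Om (a *: u + v).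
Proof.
move=> hp hq; split; first by apply: L2v_lin; [case: hp|case: hq].
exists (a *: curl Om u + curl Om v).
by apply: weak_curl_lin; [case: hp|case: hq|apply: curlP|apply: curlP].
Qed.

Lemma Hdiv_lin a u v : Hdiv Om u -> Hdiv Om v -> Hdiv Om (a *: u + v).
Proof.
move=> hp hq; split; first by apply: L2v_lin; [case: hp|case: hq].
exists (fun x => a * div Om u x + div Om v x).
by apply: weak_div_lin; [case: hp|case: hq|apply: divP|apply: divP].
Qed.

Lemma grad_lin a p q : Hgrad Om p -> Hgrad Om q ->
  ae_eq_on Om (grad Om (fun x => a * p x + q x)) (a *: grad Om p + grad Om q).
Proof.
move=> hp hq; apply: weak_grad_ae (gradP (Hgrad_lin a hp hq)) _.
by apply: weak_grad_lin; [case: hp|case: hq|apply: gradP|apply: gradP].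
Qed.

Lemma curl_lin a u v : Hcurl Om u -> Hcurl Om v ->
  ae_eq_on Om (curl Om (a *: u + v)) (a *: curl Om u + curl Om v).
Proof.
move=> hp hq; apply: weak_curl_ae (curlP (Hcurl_lin a hp hq)) _.
by apply: weak_curl_lin; [case: hp|case: hq|apply: curlP|apply: curlP].
Qed.

Lemma div_lin a u v : Hdiv Om u -> Hdiv Om v ->
  ae_eq_on Om (div Om (a *: u + v)) (fun x => a * div Om u x + div Om v x).
Proof.
move=> hp hq; apply: weak_div_ae (divP (Hdiv_lin a hp hq)) _.
by apply: weak_div_lin; [case: hp|case: hq|apply: divP|apply: divP].
Qed.

End Fields.

(** * The Sobolev spaces as linear spaces *)

Section SobolevSubspaces.
Variables (R : realType) (Om : set 'rV[R]_3).
Hypotheses (oOm : open Om) (bOm : bounded_set Om).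
Implicit Types (p q f g w phi : 'rV[R]_3 -> R^o) (u v z : 'rV[R]_3 -> 'rV[R]_3).

Lemma L2_subspace : @subspace R ('rV[R]_3 -> R^o) (L2 Om).
Proof.
split; first exact: L2_0.
by move=> a p q hp hq; apply: (L2_lin oOm a hp hq).
Qed.

Lemma L2v_subspace : subspace (L2v Om).
Proof. by split=> [|a u v hu hv]; [exact: L2v_0|exact: L2v_lin]. Qed.

Lemma ips_bilinear : @bilinear_on R ('rV[R]_3 -> R^o) (L2 Om) (ips Om).
Proof.
have h f : L2 Om f -> @linear_on R ('rV[R]_3 -> R^o) (L2 Om) (fun g => ips Om g f).
  by move=> hf a p q hp hq; apply: (ips_linl oOm a hp hq hf).
split=> // f hf; move: (h f hf); congr linear_on.
by apply: funext => g; apply: ipsC.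
Qed.

Lemma ipv_bilinear w : bounded_weight Om w -> bilinear_on (L2v Om) (ipv Om w).
Proof.
move=> hw; split=> z hz a u v hu hv.
- exact: (ipv_linl oOm a hw hu hv hz).
- exact: (ipv_linr oOm a hw hu hv hz).
Qed.

Lemma integ0 : integ Om (fun=> 0) = 0.
Proof. by rewrite /integ /Rintegral integral0. Qed.

Lemma dot0l (x : 'rV[R]_3) : dot 0 x = 0.
Proof. by rewrite /dot big1 // => i _; rewrite mxE mul0r. Qed.

Lemma weak_grad0 : weak_grad Om (fun=> 0) 0.
Proof.
split=> [|phi _ _]; first exact: L2v_0.
have e f : (forall x, f x = 0) -> integ Om f = 0.
  by move=> h; rewrite -[RHS]integ0; congr integ; apply: funext.
by rewrite !e ?oppr0 // => x; [apply: dot0l|apply: mul0r].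
Qed.

Lemma weak_curl0 : weak_curl Om 0 0.
Proof.
split=> [|phi _ _]; first exact: L2v_0.
by congr integ; apply: funext => x; rewrite !dot0l.
Qed.

Lemma weak_div0 : weak_div Om 0 (fun=> 0).
Proof.
split=> [|phi _ _]; first exact: L2_0.
have e f : (forall x, f x = 0) -> integ Om f = 0.
  by move=> h; rewrite -[RHS]integ0; congr integ; apply: funext.
by rewrite !e ?oppr0 // => x; [apply: mul0r|apply: dot0l].
Qed.

Lemma Hgrad0 : Hgrad Om (fun=> 0).
Proof. by split; [exact: L2_0|exists 0; exact: weak_grad0]. Qed.

Lemma Hcurl0 : Hcurl Om 0.
Proof. by split; [exact: L2v_0|exists 0; exact: weak_curl0]. Qed.

Lemma Hdiv0 : Hdiv Om 0.
Proof. by split; [exact: L2v_0|exists (fun=> 0); exact: weak_div0]. Qed.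

Lemma grad0 : ae_eq_on Om (grad Om (fun=> 0)) 0.
Proof. exact: (weak_grad_ae oOm bOm (gradP Hgrad0) weak_grad0). Qed.

Lemma curl0 : ae_eq_on Om (curl Om 0) 0.
Proof. exact: (weak_curl_ae oOm bOm (curlP Hcurl0) weak_curl0). Qed.

Lemma div0 : ae_eq_on Om (div Om 0) (fun=> 0).
Proof. exact: (weak_div_ae oOm bOm (divP Hdiv0) weak_div0). Qed.

Lemma Hgrad_L2 p : Hgrad Om p -> L2 Om p. Proof. by case. Qed.
Lemma Hcurl_L2v u : Hcurl Om u -> L2v Om u. Proof. by case. Qed.
Lemma Hdiv_L2v u : Hdiv Om u -> L2v Om u. Proof. by case. Qed.

Lemma grad_L2v p : Hgrad Om p -> L2v Om (grad Om p).
Proof. by move=> /gradP[]. Qed.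

Lemma curl_L2v u : Hcurl Om u -> L2v Om (curl Om u).
Proof. by move=> /curlP[]. Qed.

Lemma div_L2 u : Hdiv Om u -> L2 Om (div Om u).
Proof. by move=> /divP[]. Qed.

Lemma Himp_curl_subspace Gi : subspace (Himp_curl Om Gi).
Proof.
have b1 := one_w_bounded oOm bOm.
split=> [|a u v [hu bu] [hv bv]].
  split=> [|phi hphi _]; first exact: Hcurl0.
  rewrite !integ_dotE.
  rewrite (ipv_ae oOm b1 (curl_L2v Hcurl0) (L2v_0 _) (C1v_L2v oOm bOm hphi) curl0).
  by rewrite -!integ_dotE; congr integ; apply: funext => x; rewrite !dot0l.
split=> [|phi hphi vphi]; first exact: Hcurl_lin.
have [hu2 hv2] := (Hcurl_L2v hu, Hcurl_L2v hv).
have [cu2 cv2] := (curl_L2v hu, curl_L2v hv).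
have p1 := C1v_L2v oOm bOm hphi; have p2 := ccurl_L2v oOm bOm hphi.
have h := curl_L2v (Hcurl_lin oOm bOm a hu hv).
rewrite !integ_dotE (ipv_ae oOm b1 h _ p1 (curl_lin oOm bOm a hu hv)).
  by rewrite !ipv_linl // -!integ_dotE bu // bv.
exact: L2v_lin.
Qed.

Lemma Himp_div_subspace Gi : subspace (Himp_div Om Gi).
Proof.
have b1 := one_w_bounded oOm bOm.
split=> [|a u v [hu bu] [hv bv]].
  split=> [|phi hphi _]; first exact: Hdiv0.
  have := ips_ae oOm (div_L2 Hdiv0) (L2_0 _) (C1_L2 oOm bOm hphi) div0.
  rewrite /ips => ->; rewrite -[in RHS]integ0.
  have e f : (forall x, f x = 0) -> integ Om f = 0.
    by move=> h; rewrite -[RHS]integ0; congr integ; apply: funext.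
  by rewrite !e ?oppr0 // => x; [apply: mul0r|apply: dot0l].
split=> [|phi hphi vphi]; first exact: Hdiv_lin.
have [hu2 hv2] := (Hdiv_L2v hu, Hdiv_L2v hv).
have [cu2 cv2] := (div_L2 hu, div_L2 hv).
have p1 := C1_L2 oOm bOm hphi; have p2 := cgrad_L2v oOm bOm hphi.
have h := div_L2 (Hdiv_lin oOm bOm a hu hv).
have := ips_ae oOm h (L2_lin oOm a cu2 cv2) p1 (div_lin oOm bOm a hu hv).
rewrite (ips_linl oOm a cu2 cv2 p1) /ips => ->.
rewrite integ_dotE ipv_linl // -!integ_dotE bu // bv //.
by rewrite opprD mulrN.
Qed.

Lemma pd_lin a f g i x : C1 f -> C1 g ->
  pd i (fun y => a * f y + g y) x = a * pd i f x + pd i g x.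
Proof.
move=> hf hg; have ha : C1 (fun _ : 'rV[R]_3 => a : R) by exact: C1_cst.
rewrite (pdD _ _ (C1M ha hf) hg) (pdM _ _ ha hf).
by rewrite [pd i (fun=> a) x](derive_cst (a : R^o)) mulr0 addr0.
Qed.

Lemma cgrad_lin a f g : C1 f -> C1 g ->
  cgrad (fun y => a * f y + g y) = a *: cgrad f + cgrad g.
Proof.
by move=> hf hg; apply/funext => x; apply/rowP => i; rewrite !mxE pd_lin.
Qed.

Lemma H0grad_subspace : @subspace R ('rV[R]_3 -> R^o) (H0grad Om).
Proof.
have b1 := one_w_bounded oOm bOm.
have cg0 : cgrad (fun _ : 'rV[R]_3 => 0 : R) = 0.
  apply/funext => x; apply/rowP => i; rewrite !mxE /pd.
  exact: (derive_cst (0 : R^o)).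
split.
  split; first exact: Hgrad0.
  exists (fun=> fun=> 0); split=> [n||].
  - split; first exact: C1_cst.
    by exists set0; split=> //; exact: compact0.
  - rewrite (_ : (fun n => _) = fun=> 0); first exact: cvg_cst.
    apply/funext => n; rewrite -[RHS]integ0; congr integ; apply/funext => x.
    by rewrite subr0 expr0n.
  - rewrite (_ : (fun n => _) = fun=> 0); first exact: cvg_cst.
    apply/funext => n; have h0 := grad_L2v Hgrad0.
    have := ipv_ae oOm b1 h0 (L2v_0 _) h0 grad0.
    rewrite -!integ_dotE => e; transitivity (integ Om (fun x => dot (0 : 'rV[R]_3) (grad Om (fun=> 0) x))).
      by rewrite -e; congr integ; apply/funext => x; rewrite cg0 subr0.
    by rewrite -[RHS]integ0; congr integ; apply/funext => x; rewrite dot0l.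
move=> a p q [hp [phi [tp p1 p2]]] [hq [psi [tq q1 q2]]].
have Cl n : C1 (fun x => a * phi n x + psi n x).
  by apply: C1D; [apply: C1M; [exact: C1_cst|case: (tp n)]|case: (tq n)].
split; first exact: (Hgrad_lin oOm bOm a hp hq).
exists (fun n x => a * phi n x + psi n x); split=> [n||].
- split=> //; have [_ [K [cK KO K0]]] := tp n; have [_ [L [cL LO L0]]] := tq n.
  exists (K `|` L); split; first exact: compactU.
    by move=> x [/KO|/LO].
  by move=> x /not_orP[/K0 -> /L0 ->]; rewrite mulr0 addr0.
- have bnd n : integ Om (fun x => ((a *: p + q) x - (a * phi n x + psi n x)) ^+ 2)
      <= 2 * a ^+ 2 * integ Om (fun x => (p x - phi n x) ^+ 2)
         + 2 * integ Om (fun x => (q x - psi n x) ^+ 2).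
    have L2d f g : L2 Om f -> L2 Om g -> L2 Om (f - g).
      exact: subspaceB L2_subspace.
    have h1 := L2d _ _ (Hgrad_L2 hp) (C1_L2 oOm bOm (tp n).1).
    have h2 := L2d _ _ (Hgrad_L2 hq) (C1_L2 oOm bOm (tq n).1).
    have h1a := subspaceZ a L2_subspace h1.
    have := psd_sum_le L2_subspace ips_bilinear (fun f g _ _ => ipsC Om f g)
      (fun f _ => ips_ge0 Om f) h1a h2.
    rewrite (linear_onZ a L2_subspace (ips_bilinear.1 _ h1a)) //.
    rewrite (linear_onZ a L2_subspace (ips_bilinear.2 _ h1)) //.
    have e f : ips Om f f = integ Om (fun x => f x ^+ 2).
      by congr integ; apply/funext => x; rewrite expr2.
    rewrite !e => h; apply: (le_trans _ (le_trans h _)).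
      rewrite le_eqVlt; apply/orP; left; apply/eqP; congr integ.
      apply/funext => x; congr (_ ^+ 2).
      by rewrite /= !fctE /GRing.scale /=; ring.
    by rewrite expr2 !mulrA.
  apply: (@squeeze_cvgr _ _ _ _ (fun=> 0) (fun n => 2 * a ^+ 2 * integ Om (fun x => (p x - phi n x) ^+ 2)
         + 2 * integ Om (fun x => (q x - psi n x) ^+ 2))).
  + apply: nearW => n; rewrite bnd andbT.
    by apply: Rintegral_ge0 => t _; apply: sqr_ge0.
  + exact: cvg_cst.
  + rewrite -[0](addr0 (0 : R)) -{1}(mulr0 (2 * a ^+ 2)) -{2}(mulr0 (2 : R)).
    apply: cvgD; apply: cvgM; [exact: cvg_cst|exact: p1|exact: cvg_cst|exact: q1].
- pose U n := grad Om p - cgrad (phi n); pose V n := grad Om q - cgrad (psi n).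
  have hU n : L2v Om (U n).
    by apply: (subspaceB L2v_subspace); [exact: grad_L2v|apply: cgrad_L2v => //; case: (tp n)].
  have hV n : L2v Om (V n).
    by apply: (subspaceB L2v_subspace); [exact: grad_L2v|apply: cgrad_L2v => //; case: (tq n)].
  have bnd n : integ Om (fun x => dot (grad Om (a *: p + q) x - cgrad (fun x => a * phi n x + psi n x) x)
                     (grad Om (a *: p + q) x - cgrad (fun x => a * phi n x + psi n x) x))
      <= 2 * a ^+ 2 * integ Om (fun x => dot (U n x) (U n x))
         + 2 * integ Om (fun x => dot (V n x) (V n x)).
    have hUa := subspaceZ a L2v_subspace (hU n).
    have := psd_sum_le L2v_subspace (ipv_bilinear b1) (fun u v _ _ => ipvC Om _ u v)
      (fun u _ => @ipv_ge0 _ Om _ u (fun _ _ => ler01)) hUa (hV n).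
    rewrite (linear_onZ a L2v_subspace ((ipv_bilinear b1).1 _ hUa)) //.
    rewrite (linear_onZ a L2v_subspace ((ipv_bilinear b1).2 _ (hU n))) //.
    move=> h; pose G := grad Om (a *: p + q) - cgrad (fun x => a * phi n x + psi n x).
    rewrite [leLHS](_ : _ = ipv Om (@one_w R) G G); last exact: (integ_dotE Om G G).
    have -> := integ_dotE Om (U n) (U n); have -> := integ_dotE Om (V n) (V n).
    apply: (le_trans _ (le_trans h _)); last first.
      by rewrite expr2 !mulrA.
    have hG : L2v Om G.
      apply: (subspaceB L2v_subspace); last exact: cgrad_L2v.
      exact: (grad_L2v (Hgrad_lin oOm bOm a hp hq)).
    have GUV : ae_eq_on Om G (a *: U n + V n).
      have e2 := cgrad_lin a (tp n).1 (tq n).1.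
      move: (grad_lin oOm bOm a hp hq); apply: filterS => t e Ot.
      have e1 : grad Om (a *: p + q) (vec t) =
        a *: grad Om p (vec t) + grad Om q (vec t) := e Ot.
      have -> : G (vec t) = grad Om (a *: p + q) (vec t) -
        (a *: cgrad (phi n) + cgrad (psi n)) (vec t) by rewrite -e2.
      have -> : (a *: U n + V n) (vec t) =
        a *: (grad Om p (vec t) - cgrad (phi n) (vec t)) +
        (grad Om q (vec t) - cgrad (psi n) (vec t)) by [].
      have -> : (a *: cgrad (phi n) + cgrad (psi n)) (vec t) =
        a *: cgrad (phi n) (vec t) + cgrad (psi n) (vec t) by [].
      by rewrite e1 scalerBr opprD addrACA.
    have hUV := subspaceD L2v_subspace hUa (hV n).
    rewrite le_eqVlt; apply/orP; left; apply/eqP.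
    transitivity (ipv Om (@one_w R) (a *: U n + V n) G).
      exact: (ipv_ae oOm b1 hG hUV hG GUV).
    by rewrite ipvC; apply: (ipv_ae oOm b1 hG hUV hUV GUV).
  apply: (@squeeze_cvgr _ _ _ _ (fun=> 0) (fun n => 2 * a ^+ 2 * integ Om (fun x => dot (U n x) (U n x))
         + 2 * integ Om (fun x => dot (V n x) (V n x)))).
  + apply: nearW => n; rewrite bnd andbT.
    by apply: Rintegral_ge0 => t _; apply: dot_ge0.
  + exact: cvg_cst.
  + rewrite -[0](addr0 (0 : R)) -{1}(mulr0 (2 * a ^+ 2)) -{2}(mulr0 (2 : R)).
    apply: cvgD; apply: cvgM; [exact: cvg_cst|exact: p2|exact: cvg_cst|exact: q2].
Qed.

End SobolevSubspaces.

(** * Piecewise polynomial fields *)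

Section Piecewise.
Variables (R : realType) (N : nat) (Phi : 'I_N -> 'rV[R]_3 -> 'rV[R]_3).

(* Nothing is required on the skeleton of the mesh, where the members of a finite
   element space are arbitrary. *)
Definition cell_null (Y : zmodType) : set ('rV[R]_3 -> Y) :=
  [set v | forall K y, ref_int y -> v (Phi K y) = 0].

Lemma cell_null_subspace (Y : lmodType R) :
  @subspace R ('rV[R]_3 -> Y) (@cell_null Y).
Proof.
split=> [//|a u v hu hv K y hy].
rewrite (_ : (a *: u + v) (Phi K y) = a *: u (Phi K y) + v (Phi K y)) //.
by rewrite hu // hv // scaler0 addr0.
Qed.

Lemma ref_int_tet (x : 'rV[R]_3) : ref_int x -> ref_tet x.
Proof. by move=> h j; apply/ltW/h. Qed.

Lemma lspan_sum (X : lmodType R) (s : seq X) (I : Type) (r : seq I) (P : pred I)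
    (F : I -> X) : (forall i, P i -> lspan s (F i)) ->
  lspan s (\sum_(i <- r | P i) F i).
Proof.
move=> hF; apply: big_ind => //; first exact: lspan0.
by move=> u v hu hv; rewrite -[u]scale1r; apply: lspanP.
Qed.

Hypothesis inj_maps : forall K, set_inj (@ref_tet R) (Phi K).
Hypothesis disjoint_cells : forall K L, K != L ->
  Phi K @` @ref_int R `&` Phi L @` @ref_int R = set0.

Lemma piecewise_fin_dim (Y : lmodType R) (T : 'I_N -> 'rV[R]_3 -> Y -> Y)
    (s : seq ('rV[R]_3 -> Y)) (V : set ('rV[R]_3 -> Y)) :
  (forall K y (a : R) u v, T K y (a *: u + v) = a *: T K y u + T K y v) ->
  (forall v, V v -> forall K, exists2 vh, lspan s vh &
    forall y, ref_int y -> v (Phi K y) = T K y (vh y)) ->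
  @fin_dim R ('rV[R]_3 -> Y) (@cell_null Y) V.
Proof.
move=> Tlin hV.
have T0 K y : T K y 0 = 0.
  have := Tlin K y 1 0 0; rewrite !scale1r addr0 => /eqP.
  by rewrite -subr_eq subrr eq_sym => /eqP.
pose inv K x := xget 0 [set y | ref_int y /\ Phi K y = x].
have invK K y : ref_int y -> inv K (Phi K y) = y.
  move=> hy; have [] : [set z | ref_int z /\ Phi K z = Phi K y] (inv K (Phi K y)).
    by apply: (@xgetPex _ _ [set z | ref_int z /\ Phi K z = Phi K y]); exists y.
  by move=> hz; apply: inj_maps; rewrite inE; apply: ref_int_tet.
pose E K (vh : 'rV[R]_3 -> Y) : 'rV[R]_3 -> Y := fun x =>
  if `[< (Phi K @` @ref_int R) x >] then T K (inv K x) (vh (inv K x)) else 0.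
have Elin K (a : R) u v : E K (a *: u + v) = a *: E K u + E K v.
  apply/funext => x.
  rewrite (_ : (a *: E K u + E K v) x = a *: E K u x + E K v x) //.
  rewrite /E; case: asboolP => _; last by rewrite scaler0 addr0.
  exact: Tlin.
exists [seq E K vh | K <- enum 'I_N, vh <- s] => v Vv.
have [vh hvh] := choice (fun K => let: ex_intro2 vh a b := hV v Vv K in
  ex_intro (fun vh => lspan s vh /\ forall y, ref_int y -> v (Phi K y) = T K y (vh y))
    vh (conj a b)).
exists (\sum_K E K (vh K)).
  apply: lspan_sum => K _; have := lspan_image (Elin K) (hvh K).1.
  apply: lspan_sub => f /mapP[g gs ->].
  by apply: allpairs_f => //; rewrite mem_enum.
move=> K y hy.
rewrite (_ : (v - \sum_L E L (vh L)) (Phi K y) =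
  v (Phi K y) - (\sum_L E L (vh L)) (Phi K y)) // fct_sumE.
rewrite (bigD1 K) //= big1 => [|L LK].
  rewrite addr0 /E asboolT; last by exists y.
  by rewrite invK // -(hvh K).2 // subrr.
rewrite /E asboolF // => hL.
have : (Phi L @` @ref_int R `&` Phi K @` @ref_int R) (Phi K y) by split=> //; exists y.
by rewrite disjoint_cells.
Qed.

End Piecewise.

Section Polynomials.
Variable R : realType.
Implicit Types (k : nat) (x : 'rV[R]_3).

Lemma poly_of_subspace k (P : pred nat) :
  @subspace R ('rV[R]_3 -> R^o) (@poly_of R k P).
Proof.
split.
  exists (fun _ _ _ => 0) => x.
  by rewrite big1 // => a _; rewrite big1 // => b _; rewrite big1 // => d _; rewrite !mul0r.
move=> t f g [c hc] [e he]; exists (fun a b d => t * c a b d + e a b d) => x.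
rewrite (_ : (t *: f + g) x = t * f x + g x) // hc he.
rewrite mulr_sumr -big_split /=; apply: eq_bigr => a _.
rewrite mulr_sumr -big_split /=; apply: eq_bigr => b _.
rewrite mulr_sumr -big_split /=; apply: eq_bigr => d _.
by ring.
Qed.

Definition monomial (a b d : nat) : 'rV[R]_3 -> R^o :=
  fun x => x 0 0 ^+ a * x 0 1 ^+ b * x 0 2 ^+ d.

Definition monomials k : seq ('rV[R]_3 -> R^o) :=
  [seq monomial i.1.1 i.1.2 i.2 | i : 'I_k.+1 * 'I_k.+1 * 'I_k.+1].

Lemma monomials_mem k a b d : (a <= k)%N -> (b <= k)%N -> (d <= k)%N ->
  monomial a b d \in monomials k.
Proof.
move=> ak bk dk; apply/mapP.
exists (Ordinal (ak : (a < k.+1)%N), Ordinal (bk : (b < k.+1)%N),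
  Ordinal (dk : (d < k.+1)%N)) => //.
by rewrite mem_enum.
Qed.

Lemma monomialsP k f : f \in monomials k -> exists a b d,
  [/\ (a <= k)%N, (b <= k)%N, (d <= k)%N & f = monomial a b d].
Proof.
move=> /mapP[[[a b] d] _ ->]; exists a, b, d.
by split=> //=; rewrite -ltnS.
Qed.

Lemma poly_of_monomials k P f : @poly_of R k P f -> lspan (monomials k) f.
Proof.
move=> [c hc].
have -> : f = \sum_(a < k.+1) \sum_(b < k.+1) \sum_(d < k.+1 | P (a + b + d)%N)
    c a b d *: monomial a b d.
  apply/funext => x; rewrite hc fct_sumE; apply: eq_bigr => a _.
  rewrite fct_sumE; apply: eq_bigr => b _; rewrite fct_sumE.
  apply: eq_bigr => d _.
  by rewrite -[RHS]/(c a b d * (x 0 0 ^+ a * x 0 1 ^+ b * x 0 2 ^+ d)) !mulrA.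
apply: lspan_sum => a _; apply: lspan_sum => b _; apply: lspan_sum => d _.
rewrite -[_ *: _]addr0; apply: lspanP; last exact: lspan0.
by apply: lspan_mem; apply: monomials_mem; rewrite -ltnS.
Qed.

Lemma monomialsS k f : lspan (monomials k) f -> lspan (monomials k.+1) f.
Proof.
apply: lspan_sub => g /monomialsP[a [b [d [ak bk dk ->]]]].
by apply: monomials_mem; apply: leqW.
Qed.

Lemma monomial_coord_mem k a b d i : (a <= k)%N -> (b <= k)%N -> (d <= k)%N ->
  (fun x => monomial a b d x * x 0 i) \in monomials k.+1.
Proof.
move=> ak bk dk; move: i; apply: ord3P.
- rewrite (_ : (fun x => _) = monomial a.+1 b d).
    by apply: monomials_mem => //; apply: leqW.
  by apply/funext => x; rewrite /monomial exprSr; ring.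
- rewrite (_ : (fun x => _) = monomial a b.+1 d).
    by apply: monomials_mem => //; apply: leqW.
  by apply/funext => x; rewrite /monomial exprSr; ring.
- rewrite (_ : (fun x => _) = monomial a b d.+1).
    by apply: monomials_mem => //; apply: leqW.
  by apply/funext => x; rewrite /monomial exprSr; ring.
Qed.

Lemma monomials_coord k f i : lspan (monomials k) f ->
  lspan (monomials k.+1) (fun x => f x * x 0 i).
Proof.
move=> hf.
pose M (g : 'rV[R]_3 -> R^o) : 'rV[R]_3 -> R^o := fun x => g x * x 0 i.
have Mlin (a : R) u v : M (a *: u + v) = a *: M u + M v.
  apply/funext => x.
  rewrite (_ : (a *: M u + M v) x = a * (u x * x 0 i) + v x * x 0 i) // /M.
  by rewrite (_ : (a *: u + v) x = a * u x + v x) // mulrDl mulrA.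
apply: lspan_sub (lspan_image Mlin hf) => _ /mapP[g /monomialsP[a [b [d [ak bk dk ->]]]] ->].
exact: monomial_coord_mem.
Qed.

Definition vmonomials k : seq ('rV[R]_3 -> 'rV[R]_3) :=
  [seq (fun x => f x *: delta_mx 0 i) | i <- enum 'I_3, f <- monomials k].

Lemma vmonomials_span k (v : 'rV[R]_3 -> 'rV[R]_3) :
  (forall i, lspan (monomials k) (fun x => v x 0 i)) -> lspan (vmonomials k) v.
Proof.
move=> hv.
pose M i (g : 'rV[R]_3 -> R^o) : 'rV[R]_3 -> 'rV[R]_3 := fun x => g x *: delta_mx 0 i.
have Mlin i (a : R) u w : M i (a *: u + w) = a *: M i u + M i w.
  apply/funext => x.
  rewrite (_ : (a *: M i u + M i w) x = a *: (u x *: delta_mx 0 i) + w x *: delta_mx 0 i) //.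
  by rewrite /M (_ : (a *: u + w) x = a * u x + w x) // scalerDl scalerA.
have -> : v = \sum_i M i (fun x => v x 0 i).
  by apply/funext => x; rewrite fct_sumE [LHS]row_sum_delta.
apply: lspan_sum => i _; apply: lspan_sub (lspan_image (Mlin i) (hv i)).
move=> _ /mapP[g gs ->]; apply/allpairsP; exists (i, g).
by split=> //; rewrite mem_enum.
Qed.

Lemma nedelec_ref_subspace k : subspace (@nedelec_ref R k).
Proof.
split.
  exists 0, 0; split=> [i|i|x|x].
  - have := subspace0 (poly_of_subspace k (fun m => m <= k)%N); congr poly_le.
    by apply/funext => x; rewrite mxE.
  - have := subspace0 (poly_of_subspace k.+1 (fun m => m == k.+1)%N); congr poly_hom.
    by apply/funext => x; rewrite mxE.
  - by rewrite /dot big1 // => i _; rewrite mxE mulr0.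
  - by rewrite (_ : (0 + 0 : 'rV[R]_3) = 0) // addr0.
move=> a u v [u1 [q1 [hu1 hq1 d1 e1]]] [u2 [q2 [hu2 hq2 d2 e2]]].
exists (a *: u1 + u2), (a *: q1 + q2); split=> [i|i|x|x].
- have := subspaceP a (poly_of_subspace k (fun m => m <= k)%N) (hu1 i) (hu2 i).
  by congr poly_le; apply/funext => x; rewrite !mxE.
- have := subspaceP a (poly_of_subspace k.+1 (fun m => m == k.+1)%N) (hq1 i) (hq2 i).
  by congr poly_hom; apply/funext => x; rewrite !mxE.
- have := d1 x; have := d2 x; rewrite /dot !sum_ord3 !mxE => h2 h1.
  transitivity (a * (x 0 0 * q1 x 0 0 + x 0 1 * q1 x 0 1 + x 0 2 * q1 x 0 2) +
    (x 0 0 * q2 x 0 0 + x 0 1 * q2 x 0 1 + x 0 2 * q2 x 0 2)); first by ring.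
  by rewrite h1 h2 mulr0 addr0.
- rewrite (_ : (a *: u + v) x = a *: u x + v x) // e1 e2.
  by rewrite scalerDr addrACA.
Qed.

Lemma nedelec_ref_span k v : @nedelec_ref R k v -> lspan (vmonomials k.+1) v.
Proof.
move=> [u [q [hu hq _ e]]]; apply: vmonomials_span => i.
have -> : (fun x => v x 0 i) =
    (1 : R) *: ((fun x => u x 0 i) : 'rV[R]_3 -> R^o) + (fun x => q x 0 i).
  by rewrite scale1r; apply/funext => x; rewrite e mxE.
apply: lspanP; first by apply: monomialsS; apply: poly_of_monomials (hu i).
exact: poly_of_monomials (hq i).
Qed.

Lemma rt_ref_subspace k : subspace (@rt_ref R k).
Proof.
split.
  exists 0, (fun=> 0); split=> [i||x].
  - have := subspace0 (poly_of_subspace k (fun m => m <= k)%N); congr poly_le.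
    by apply/funext => x; rewrite mxE.
  - exact: (subspace0 (poly_of_subspace k (fun m => m == k)%N)).
  - by rewrite scale0r addr0.
move=> a u v [u1 [q1 [hu1 hq1 e1]]] [u2 [q2 [hu2 hq2 e2]]].
exists (a *: u1 + u2), (fun x => a * q1 x + q2 x); split=> [i||x].
- have := subspaceP a (poly_of_subspace k (fun m => m <= k)%N) (hu1 i) (hu2 i).
  by congr poly_le; apply/funext => x; rewrite !mxE.
- exact: (subspaceP a (poly_of_subspace k (fun m => m == k)%N) hq1 hq2).
- rewrite (_ : (a *: u + v) x = a *: u x + v x) // e1 e2.
  by rewrite scalerDr addrACA scalerDl scalerA.
Qed.

Lemma rt_ref_span k v : @rt_ref R k v -> lspan (vmonomials k.+1) v.
Proof.
move=> [u [q [hu hq e]]]; apply: vmonomials_span => i.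
have -> : (fun x => v x 0 i) =
    (1 : R) *: ((fun x => u x 0 i) : 'rV[R]_3 -> R^o) + (fun x => q x * x 0 i).
  by rewrite scale1r; apply/funext => x; rewrite e !mxE.
apply: lspanP; first by apply: monomialsS; apply: poly_of_monomials (hu i).
by apply: monomials_coord; apply: poly_of_monomials hq.
Qed.

End Polynomials.

Section FiniteElementSpaces.
Variables (R : realType) (Om Gi Go : set 'rV[R]_3).
Variables (N : nat) (Phi : 'I_N -> 'rV[R]_3 -> 'rV[R]_3).
Hypotheses (oOm : open Om) (bOm : bounded_set Om).
Hypothesis mesh : is_mesh Om Gi Go Phi.
Implicit Types k : nat.

Lemma mesh_inj K : set_inj (@ref_tet R) (Phi K).
Proof. by case: (mesh_maps mesh K). Qed.

Lemma cell_null_ae (Y : zmodType) (v : 'rV[R]_3 -> Y) :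
  cell_null Phi v -> ae_eq_on Om v (fun=> 0).
Proof.
move=> hv; apply: negligibleS (mesh_null mesh) => t /= /not_implyP[Ot vt].
split=> // -[K _ [y hy e]]; apply: vt.
by rewrite -e hv.
Qed.

Lemma lagrange_subspace k :
  @subspace R ('rV[R]_3 -> R^o) (lagrange_space Om Phi k).
Proof.
have hH := H0grad_subspace oOm bOm.
have hP := poly_of_subspace R k (fun m => m <= k)%N.
split=> [|a p q [hp cp] [hq cq]].
  split=> [|K]; first exact: subspace0 hH.
  by exists (fun=> 0) => //; exact: subspace0 hP.
split=> [|K]; first exact: (subspaceP a hH hp hq).
have [f hf ef] := cp K; have [g hg eg] := cq K.
exists (fun x => a * f x + g x); first exact: (subspaceP a hP hf hg).
by move=> x hx; rewrite -ef // -eg.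
Qed.

Lemma lagrange_fin_dim k :
  @fin_dim R ('rV[R]_3 -> R^o) (@cell_null R N Phi R^o) (lagrange_space Om Phi k).
Proof.
apply: (piecewise_fin_dim mesh_inj (mesh_disjoint mesh)
  (T := fun _ _ u => u) (s := monomials R k)) => // p [_ hp] K.
have [f hf ef] := hp K; exists f => //.
exact: poly_of_monomials hf.
Qed.

Lemma nedelec_subspace k : subspace (nedelec_space Om Gi Phi k).
Proof.
have hH := Himp_curl_subspace oOm bOm Gi.
have hP := nedelec_ref_subspace R k.
split=> [|a u v [hu cu] [hv cv]].
  split=> [|K]; first exact: subspace0 hH.
  by exists 0 => [|x hx]; [exact: subspace0 hP|rewrite mul0mx].
split=> [|K]; first exact: (subspaceP a hH hu hv).
have [f hf ef] := cu K; have [g hg eg] := cv K.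
exists (a *: f + g); first exact: (subspaceP a hP hf hg).
move=> x hx; rewrite (_ : (a *: u + v) (Phi K x) = a *: u (Phi K x) + v (Phi K x)) //.
by rewrite ef // eg // scalemxAl -mulmxDl.
Qed.

Lemma nedelec_fin_dim k :
  fin_dim (@cell_null R N Phi 'rV[R]_3) (nedelec_space Om Gi Phi k).
Proof.
apply: (piecewise_fin_dim mesh_inj (mesh_disjoint mesh)
  (T := fun K y u => u *m invmx ('J (Phi K) y)^T) (s := vmonomials R k.+1)).
  by move=> K y a u v; rewrite mulmxDl scalemxAl.
move=> v [_ hv] K; have [f hf ef] := hv K; exists f => //.
exact: nedelec_ref_span hf.
Qed.

Lemma rt_subspace k : subspace (rt_space Om Gi Phi k).
Proof.
have hH := Himp_div_subspace oOm bOm Gi.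
have hP := rt_ref_subspace R k.
split=> [|a u v [hu cu] [hv cv]].
  split=> [|K]; first exact: subspace0 hH.
  by exists 0 => [|x hx]; [exact: subspace0 hP|rewrite mul0mx scaler0].
split=> [|K]; first exact: (subspaceP a hH hu hv).
have [f hf ef] := cu K; have [g hg eg] := cv K.
exists (a *: f + g); first exact: (subspaceP a hP hf hg).
move=> x hx; rewrite (_ : (a *: u + v) (Phi K x) = a *: u (Phi K x) + v (Phi K x)) //.
rewrite ef // eg // (_ : (a *: f + g) x = a *: f x + g x) //.
by rewrite mulmxDl scalerDr -scalemxAl !scalerA [a * _]mulrC.
Qed.

Lemma rt_fin_dim k :
  fin_dim (@cell_null R N Phi 'rV[R]_3) (rt_space Om Gi Phi k).
Proof.
apply: (piecewise_fin_dim mesh_inj (mesh_disjoint mesh)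
  (T := fun K y u => (\det ('J (Phi K) y))^-1 *: (u *m 'J (Phi K) y))
  (s := vmonomials R k.+1)).
  by move=> K y a u v; rewrite mulmxDl scalerDr -scalemxAl !scalerA [a * _]mulrC.
move=> v [_ hv] K; have [f hf ef] := hv K; exists f => //.
exact: rt_ref_span hf.
Qed.

End FiniteElementSpaces.

(** * Traces on the faces of a cell *)

Section MatrixContinuity.
Variables (R : realType) (T : topologicalType).

Lemma row_cvg n (f : T -> 'rV[R]_n) (x : T) :
  (forall i, {for x, continuous (fun y => f y 0 i)}) -> {for x, continuous f}.
Proof.
move=> cf; apply/cvg_ballP => e e0.
have h : \forall y \near x, forall i, ball (f x 0 i) e (f y 0 i).
  by apply: filter_forall => i; move/cvg_ballP: (cf i); apply.
by apply: filterS h => y hy; split=> // i j; rewrite ord1.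
Qed.

Lemma sum_continuous_at (I : Type) (r : seq I) (P : pred I) (F : I -> T -> R) x :
  (forall i, {for x, continuous (F i)}) ->
  {for x, continuous (fun y => \sum_(i <- r | P i) F i y)}.
Proof. by move=> h; apply: cvg_big => [|i _]; [exact: add_continuous|exact: h]. Qed.

Lemma prod_continuous_at (I : Type) (r : seq I) (P : pred I) (F : I -> T -> R) x :
  (forall i, {for x, continuous (F i)}) ->
  {for x, continuous (fun y => \prod_(i <- r | P i) F i y)}.
Proof. by move=> h; apply: cvg_big => [|i _]; [exact: mul_continuous|exact: h]. Qed.

Lemma det_continuous_at n (A : T -> 'M[R]_n) x :
  (forall i j, {for x, continuous (fun y => A y i j)}) ->
  {for x, continuous (fun y => \det (A y))}.
Proof.
move=> h; apply: sum_continuous_at => s.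
have h1 : {for x, continuous (fun y => \prod_i A y i (s i))}.
  by apply: prod_continuous_at => i; apply: h.
have h2 : (fun=> (-1) ^+ s : R) @ x --> ((-1) ^+ s : R) by exact: cvg_cst.
exact: (cvgM h2 h1).
Qed.

Lemma invmx_continuous_at n (A : T -> 'M[R]_n) x :
  (forall i j, {for x, continuous (fun y => A y i j)}) -> A x \in unitmx ->
  forall i j, {for x, continuous (fun y => invmx (A y) i j)}.
Proof.
move=> h Ax i j; have cd := det_continuous_at h.
have dx : \det (A x) != 0 by move: Ax; rewrite unitmxE unitfE.
have ca : {for x, continuous (fun y => \adj (A y) i j)}.
  rewrite (_ : (fun y => _) = fun y => (-1) ^+ (j + i) *
      \det (row' j (col' i (A y)))); last by apply/funext => y; rewrite mxE.
  have h1 : {for x, continuous (fun y => \det (row' j (col' i (A y))))}.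
    apply: det_continuous_at => k l.
    rewrite (_ : (fun y => _) = fun y => A y (lift j k) (lift i l)) //.
    by apply/funext => y; rewrite !mxE.
  have h2 : (fun=> (-1) ^+ (j + i) : R) @ x --> ((-1) ^+ (j + i) : R) by exact: cvg_cst.
  exact: (cvgM h2 h1).
have ne : \forall y \near x, \det (A y) != 0.
  have op : open [set s : R | s != 0] by exact: open_neq.
  exact: (cd _ (open_nbhs_nbhs (conj op dx))).
have lim : (fun y => (\det (A y))^-1 * \adj (A y) i j) @ x -->
    ((\det (A x))^-1 * \adj (A x) i j) by exact: (cvgM (cvgV dx cd) ca).
have val y : \det (A y) != 0 -> invmx (A y) i j = (\det (A y))^-1 * \adj (A y) i j.
  by move=> d; rewrite /invmx unitmxE unitfE d !mxE.
suff : (fun y => invmx (A y) i j) @ x --> invmx (A x) i j by [].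
rewrite val //; apply: cvg_trans lim; apply: near_eq_cvg.
by apply: filterS ne => y /val ->.
Qed.

End MatrixContinuity.

Section ReferenceTetrahedron.
Variable R : realType.
Implicit Types (x y : 'rV[R]_3) (j : 'I_4) (i : 'I_4).

Lemma bcE x j : bc x j = if unlift ord0 j is Some m then x 0 m
  else 1 - (x 0 0 + x 0 1 + x 0 2).
Proof. by rewrite /bc sum_ord3. Qed.

Lemma bc_affine (a b : R) x y j : a + b = 1 ->
  bc (a *: x + b *: y) j = a * bc x j + b * bc y j.
Proof.
move=> ab; rewrite !bcE; case: unlift => [m|]; rewrite !mxE //.
by rewrite -[in LHS]ab; ring.
Qed.

Lemma bc_continuous j x : {for x, continuous (fun y => bc y j)}.
Proof.
rewrite (_ : (fun y => bc y j) = fun y => if unlift ord0 j is Some m then y 0 m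
  else 1 - \sum_m y 0 m) //.
case: unlift => [m|]; first exact: coord_continuous.
have h1 : {for x, continuous (fun y : 'rV[R]_3 => \sum_m y 0 m)}.
  by apply: sum_continuous_at => m; apply: coord_continuous.
have h2 : {for x, continuous (fun _ : 'rV[R]_3 => 1 : R)} by exact: cst_continuous.
exact: (cvgB h2 h1).
Qed.

Lemma ref_tet_coord x (m : 'I_3) : ref_tet x -> 0 <= x 0 m <= 1.
Proof.
move=> h.
have h0 (l : 'I_3) : 0 <= x 0 l by have := h (lift ord0 l); rewrite bcE liftK.
rewrite h0 /=; have := h ord0; rewrite /bc unlift_none subr_ge0.
apply: le_trans; rewrite (bigD1 m) //= lerDl.
by apply: sumr_ge0.
Qed.

Lemma ref_tet_closed : closed (@ref_tet R).
Proof.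
rewrite (_ : @ref_tet R = \bigcap_(j in [set: 'I_4]) [set x | 0 <= bc x j]).
  apply: closed_bigI => j _.
  apply: (@closed_comp _ _ (fun x : 'rV[R]_3 => bc x j) [set s | 0 <= s]).
    by move=> x _; apply: bc_continuous.
  exact: closed_ge.
by apply/seteqP; split=> [x h j _|x h j]; apply: h.
Qed.

Lemma ref_tet_compact : compact (@ref_tet R).
Proof.
have hc : compact [set v : 'rV[R]_3 | forall m, `[0, 1]%classic (v 0 m)].
  exact: (@rV_compact R 3 (fun=> `[0, 1]%classic) (fun=> @segment_compact R _ _)).
apply: (subclosed_compact ref_tet_closed hc).
by move=> x h m; rewrite /= in_itv; apply: ref_tet_coord.
Qed.

Lemma ref_int_center : exists x : 'rV[R]_3, ref_int x.
Proof.
exists (const_mx (1 / 4)) => j; rewrite bcE.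
by case: unlift => [m|]; rewrite !mxE; lra.
Qed.

Lemma bc_ref_vertex i j : bc (ref_vertex R i) j = (i == j)%:R.
Proof.
rewrite /bc; case: unliftP => [m ->|->]; first by rewrite mxE.
case: (unliftP ord0 i) => [m ->|->].
  rewrite (bigD1 m) //= big1 => [|l lm]; rewrite !mxE.
    by rewrite eqxx addr0 subrr.
  by rewrite (inj_eq lift_inj) eq_sym (negbTE lm).
by rewrite big1 ?subr0 ?eqxx // => l _; rewrite mxE.
Qed.

Lemma face_point_tet i (z : R * R) : ref_triangle z -> ref_tet (face_point i z).
Proof.
move=> [z1 z2 z12] j.
pose s := z.1 + z.2.
pose v k := ref_vertex R (lift i k).
have -> : bc (face_point i z) j = (1 - s) * bc (v 0) j + z.1 * bc (v 1) j + z.2 * bc (v 2) j.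
  rewrite /face_point /face_edge1 /face_edge2 -/(v 0) -/(v 1) -/(v 2) /s.
  by rewrite !bcE; case: unlift => [m|]; rewrite !mxE; ring.
by rewrite /v !bc_ref_vertex !addr_ge0 // mulr_ge0 // subr_ge0.
Qed.

End ReferenceTetrahedron.

Section CellTrace.
Variables (R : realType) (F : 'rV[R]_3 -> 'rV[R]_3).
Hypothesis hF : cell_map F.
Implicit Types (x y : 'rV[R]_3) (v h : 'rV[R]_3 -> 'rV[R]_3).

Lemma cell_map_nbhd : exists O : set 'rV[R]_3,
  [/\ open O, @ref_tet R `<=` O,
      forall x i j, O x -> {for x, continuous (fun y => 'J F y i j)} &
      forall x, O x -> 'J F x \in unitmx].
Proof.
case: hF => [[U [oU sU dU]] _ uJ].
exists (U `&` [set x | 'J F x \in unitmx]); split.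
- rewrite openE => x [Ux uJx]; apply: filterI; first exact: open_nbhs_nbhs.
  have cJ i j : {for x, continuous (fun y => 'J F y i j)}.
    have [_ c] := dU x Ux.
    exact: (continuous_comp c (@coord_continuous _ _ _ i j _)).
  have cd := det_continuous_at cJ.
  have dx : \det ('J F x) != 0 by move: uJx; rewrite /= unitmxE unitfE.
  have op : open [set s : R | s != 0] by exact: open_neq.
  have ne : \forall y \near x, \det ('J F y) != 0.
    exact: (cd _ (open_nbhs_nbhs (conj op dx))).
  by apply: filterS ne => y; rewrite /= unitmxE unitfE.
- by move=> x hx; split; [apply: sU|apply: uJ].
- move=> x i j [Ux _]; have [_ c] := dU x Ux.
  exact: (continuous_comp c (@coord_continuous _ _ _ i j _)).
- by move=> x [].
Qed.

Lemma cell_map_continuous x : ref_tet x -> {for x, continuous F}.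
Proof.
case: hF => [[U [oU sU dU]] _ _] hx.
have [d _] := dU x (sU x hx).
exact: (differentiable_continuous d).
Qed.

Lemma cell_closure y : ref_tet y -> closure (F @` @ref_int R) (F y).
Proof.
move=> hy B hB; have [c hc] := ref_int_center R.
pose g (s : R) : 'rV[R]_3 := (1 - s) *: y + s *: c.
have cg : {for 0, continuous g}.
  apply: row_cvg => i.
  rewrite (_ : (fun s => g s 0 i) = fun s => (1 - s) * y 0 i + s * c 0 i); last first.
    by apply/funext => s; rewrite !mxE.
  have h0 : {for (0 : R), continuous (fun _ : R => 1 : R)} by exact: cst_continuous.
  have h1 : {for (0 : R), continuous (fun s : R => 1 - s)} by exact: (cvgB h0 cvg_id).
  have h2 a : {for (0 : R), continuous (fun _ : R => a : R)} by exact: cst_continuous.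
  exact: (cvgD (cvgM h1 (h2 (y 0 i))) (cvgM cvg_id (h2 (c 0 i)))).
have g0 : g 0 = y by rewrite /g subr0 scale1r scale0r addr0.
have hFg : nbhs (0 : R) ((F \o g) @^-1` B).
  have cFg : {for 0, continuous (F \o g)}.
    by apply: continuous_comp => //; rewrite g0; exact: cell_map_continuous.
  by apply: (cFg B); rewrite /= g0.
have /nbhs_ballP[e /= e0 he] := hFg.
pose s := Num.min (e / 2) 1.
have s0 : 0 < s by rewrite lt_min ltr01 andbT divr_gt0.
have s1 : s <= 1 by rewrite ge_min lexx orbT.
exists (F (g s)); split.
  exists (g s) => // j; rewrite /g bc_affine ?subrK //.
  apply: ltr_wpDl; first by rewrite mulr_ge0 ?subr_ge0.
  by rewrite mulr_gt0.
apply: he; rewrite /ball /= sub0r normrN gtr0_norm //.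
by rewrite (le_lt_trans (y := e / 2)) ?ge_min ?lexx // ltr_pdivrMr // ltr_pMr // ltr1n.
Qed.

(* [F] is injective on the compact tetrahedron, so [F y' -> F y] forces
   [y' -> y]. *)
Lemma cell_trace_eq v h y : ref_tet y -> {for y, continuous h} ->
  (forall z, ref_int z -> v (F z) = h z) -> cell_trace F v (F y) = h y.
Proof.
move=> hy ch vh.
have prop := within_nbhs_proper (cell_closure hy).
apply: cvg_lim; first exact: norm_hausdorff.
move=> A hA.
have /nbhs_ballP[e /= e0 he] : nbhs y (h @^-1` A) by apply: ch.
pose C := @ref_tet R `\` ball y e.
have cC : compact C.
  apply: (subclosed_compact _ (@ref_tet_compact R)); last by move=> ? [].
  rewrite /C setDE; apply: closedI; first exact: ref_tet_closed.
  by apply: open_closedC; apply: ball_open.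
have cFC : closed (F @` C).
  apply: compact_closed; first exact: norm_hausdorff.
  apply: continuous_compact => //; apply: continuous_in_subspaceT => z.
  by rewrite inE => -[hz _]; apply: cell_map_continuous.
have oFC : nbhs (F y) (~` (F @` C)).
  apply: open_nbhs_nbhs; split; first exact: closed_openC.
  move=> [z [hz nz] zy]; apply: nz.
  case: hF => _ inj _; rewrite (inj z y) ?inE //; exact: ballxx.
rewrite /within; apply: filterS oFC => x nx [z hz zx].
rewrite /= -zx vh //; apply: he; apply: contrapT => nz.
by apply: nx; exists z => //; split=> //; apply: ref_int_tet.
Qed.

Lemma lspan_continuous k v i x : lspan (vmonomials R k) v ->
  {for x, continuous (fun y => v y 0 i)}.
Proof.
move=> /(_ [set v : 'rV[R]_3 -> 'rV[R]_3 | {for x, continuous (fun y => v y 0 i)}]).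
apply=> [|w].
  split=> [|a u w cu cw] /=.
    rewrite (_ : (fun y => _) = fun=> 0); first exact: cst_continuous.
    by apply/funext => y; rewrite mxE.
  rewrite (_ : (fun y => _) = fun y => a * u y 0 i + w y 0 i); last first.
    by apply/funext => y; rewrite !mxE.
  have ca : {for x, continuous (fun _ : 'rV[R]_3 => a : R)} by exact: cst_continuous.
  exact: (cvgD (cvgM ca cu) cw).
move=> /allpairsP[[j f] [_ /monomialsP[a [b [d [_ _ _ ->]]]] ->]] /=.
rewrite (_ : (fun y => _) = fun y : 'rV[R]_3 =>
    y 0 0 ^+ a * y 0 1 ^+ b * y 0 2 ^+ d * (i == j)%:R); last first.
  by apply/funext => y; rewrite !mxE.
have ce n l : {for x, continuous (fun y : 'rV[R]_3 => y 0 l ^+ n)}.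
  have c1 : {for x, continuous (fun y : 'rV[R]_3 => y 0 l)} by exact: coord_continuous.
  exact: (continuous_comp c1 (@exprn_continuous _ n _)).
have ca : {for x, continuous (fun _ : 'rV[R]_3 => (i == j)%:R : R)} by exact: cst_continuous.
exact: (cvgM (cvgM (cvgM (ce a 0) (ce b 1)) (ce d 2)) ca).
Qed.

End CellTrace.

(** * The boundary term *)

Section FaceIntegrals.
Variables (R : realType) (F : 'rV[R]_3 -> 'rV[R]_3) (i : 'I_4).
Hypothesis hF : cell_map F.
Implicit Types (x y : 'rV[R]_3) (z : R * R) (u v : 'rV[R]_3 -> 'rV[R]_3).

Let D : set (R * R) := @ref_triangle R.

Lemma ref_triangle_measurable : measurable D.
Proof.
have -> : D = (fst @^-1` `[0, +oo[) `&` (snd @^-1` `[0, +oo[) `&`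
    ((fun z => z.1 + z.2) @^-1` `]-oo, 1]).
  apply/seteqP; split=> z; rewrite /= !in_itv /= ?andbT.
    by move=> [].
  by move=> [[]].
have h (f : R * R -> R) (A : set R) : measurable_fun setT f -> measurable A ->
    measurable (f @^-1` A).
  by move=> mf mA; rewrite -[X in measurable X]setTI; apply: mf.
apply: measurableI; first apply: measurableI.
- by apply: h => //; exact: measurable_fst.
- by apply: h => //; exact: measurable_snd.
- by apply: h => //; apply: measurable_funD; [exact: measurable_fst|exact: measurable_snd].
Qed.

Lemma ref_triangle_lty : (leb2 R D < +oo)%E.
Proof.
have mm : measurable (`[0, 1] : set R) by [].
apply: (@le_lt_trans _ _ (leb2 R (`[0, 1] `*` `[0, 1])%R)).
  apply: le_measure.
  - by rewrite inE; exact: ref_triangle_measurable.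
  - by rewrite inE; exact: measurableX.
  - move=> z [z1 z2 z12]; split; rewrite /= in_itv /=; apply/andP; split=> //; lra.
have h2 := @product_measure1E _ _ _ _ R (@lebesgue_measure R) (@lebesgue_measure R)
  _ _ mm mm.
rewrite [X in (X < _)%E]h2.
have [r hr] : exists r : R, lebesgue_measure (`[0, 1] : set R) = r%:E.
  rewrite lebesgue_measure_itv /= lte_fin.
  by case: ifP => _; [exists (1 - 0)|exists 0].
by rewrite [X in (X * _)%E]hr [X in (_ * X)%E]hr -!EFinM ltry.
Qed.

Lemma face_bounded_measurable (W : set 'rV[R]_3) (phi : 'rV[R]_3 -> R) :
  open W -> @ref_tet R `<=` W -> (forall x, W x -> {for x, continuous phi}) ->
  bounded_measurable D (fun z => phi (face_point i z)).
Proof.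
move=> oO sO cphi; split; last first.
  have [M [Mr hM]] : bounded_set (phi @` @ref_tet R).
    apply/compact_bounded/continuous_compact; last exact: ref_tet_compact.
    by apply: continuous_in_subspaceT => x; rewrite inE => /sO; apply: cphi.
  exists (M + 1) => z Dz; apply: (hM (M + 1)); first by lra.
  by exists (face_point i z) => //; apply: face_point_tet.
pose fp x := face_point i (x 0 0, x 0 1).
have cfp x : {for x, continuous fp}.
  apply: row_cvg => j; rewrite /fp /face_point /=.
  rewrite (_ : (fun y => _) = fun y : 'rV[R]_3 => ref_vertex R (lift i 0) 0 j +
    y 0 0 * face_edge1 R i 0 j + y 0 1 * face_edge2 R i 0 j); last first.
    by apply/funext => y; rewrite !mxE.
  have cc a : {for x, continuous (fun _ : 'rV[R]_3 => a : R)} by exact: cst_continuous.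
  have c1 l : {for x, continuous (fun y : 'rV[R]_3 => y 0 l)} by exact: coord_continuous.
  exact: (cvgD (cvgD (cc _) (cvgM (c1 0) (cc _))) (cvgM (c1 1) (cc _))).
have oP : open (fp @^-1` W) by apply: open_comp => // x _; apply: cfp.
have m1 : measurable_fun (@vec R @^-1` (fp @^-1` W)) ((phi \o fp) \o @vec R).
  apply: continuous_vec_measurable => // x Ox.
  by apply: continuous_comp; [apply: cfp|apply: cphi].
have e z : fp (vec (z, 0)) = face_point i z by rewrite /fp vec0 vec1; case: z.
have m2 : measurable_fun D (fun z : R * R => ((z, 0) : R * R * R)).
  by apply: measurable_funTS; apply: measurable_fun_pair.
rewrite (_ : (fun z => _) = (phi \o fp \o @vec R) \o (fun z : R * R => (z, 0))).
  apply: (measurable_comp _ _ m1 m2); first exact: open_vec_measurable.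
  by move=> _ [z Dz <-]; rewrite /= e; apply/sO/face_point_tet.
by apply/funext => z; rewrite /= e.
Qed.

Definition nedelec_on_cell v : Prop := exists k, exists2 vh, @nedelec_ref R k vh &
  forall x, ref_int x -> v (F x) = vh x *m invmx ('J F x)^T.

Lemma nedelec_on_cell_trace v : nedelec_on_cell v ->
  exists W : set 'rV[R]_3, exists h : 'rV[R]_3 -> 'rV[R]_3, [/\ open W, @ref_tet R `<=` W,
    forall x j, W x -> {for x, continuous (fun y => h y 0 j)},
    forall x, ref_int x -> v (F x) = h x &
    forall x, ref_tet x -> cell_trace F v (F x) = h x].
Proof.
move=> [k [vh hvh e]]; have [W [oO sO cJ uJ]] := cell_map_nbhd hF.
pose h y := vh y *m invmx ('J F y)^T.
have ch x j : W x -> {for x, continuous (fun y => h y 0 j)}.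
  move=> Ox; rewrite (_ : (fun y => _) =
    fun y => \sum_l vh y 0 l * invmx ('J F y)^T l j); last first.
    by apply/funext => y; rewrite mxE.
  apply: sum_continuous_at => l.
  have c1 : {for x, continuous (fun y => vh y 0 l)}.
    exact: lspan_continuous (nedelec_ref_span hvh).
  have c2 : {for x, continuous (fun y => invmx ('J F y)^T l j)}.
    apply: invmx_continuous_at; last by rewrite unitmx_tr uJ.
    move=> a b; rewrite (_ : (fun y => _) = fun y => 'J F y b a); first exact: cJ.
    by apply/funext => y; rewrite mxE.
  exact: (cvgM c1 c2).
exists W, h; split=> // x hx; apply: (cell_trace_eq hF hx _ e).
by apply: row_cvg => j; apply: ch; apply: sO.
Qed.

Lemma cell_trace_lin (a : R) u v y : nedelec_on_cell u -> nedelec_on_cell v ->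
  ref_tet y -> cell_trace F (a *: u + v) (F y) =
    a *: cell_trace F u (F y) + cell_trace F v (F y).
Proof.
move=> /nedelec_on_cell_trace[W [h [_ sO ch eh th]]].
move=> /nedelec_on_cell_trace[P [g [_ sP cg eg tg]]] hy.
rewrite th // tg //.
apply: (@cell_trace_eq _ _ hF _ (fun x => a *: h x + g x)) => // [|x hx].
  apply: row_cvg => j.
  rewrite (_ : (fun x => _) = fun x => a * h x 0 j + g x 0 j); last first.
    by apply/funext => x; rewrite !mxE.
  have ca : {for y, continuous (fun _ : 'rV[R]_3 => a : R)} by exact: cst_continuous.
  exact: (cvgD (cvgM ca (ch y j (sO y hy))) (cg y j (sP y hy))).
by rewrite (_ : (a *: u + v) (F x) = a *: u (F x) + v (F x)) // eh // eg.
Qed.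

Lemma cell_trace_bounded_measurable v j : nedelec_on_cell v ->
  bounded_measurable D (fun z => cell_trace F v (F (face_point i z)) 0 j).
Proof.
move=> /nedelec_on_cell_trace[W [h [oO sO ch eh th]]].
apply: (@eq_bounded_measurable _ _ _ _ (fun z => h (face_point i z) 0 j)).
  by move=> z Dz; rewrite th //; apply: face_point_tet.
exact: (@face_bounded_measurable W (fun y => h y 0 j) oO sO (fun x => ch x j)).
Qed.

Lemma face_cross_continuous : exists W : set 'rV[R]_3, [/\ open W, @ref_tet R `<=` W &
  forall x j, W x -> {for x, continuous (fun y =>
    cross (face_edge1 R i *m 'J F y) (face_edge2 R i *m 'J F y) 0 j)}].
Proof.
have [W [oO sO cJ _]] := cell_map_nbhd hF; exists W; split=> // x j Ox.
have c (w : 'rV[R]_3) l : {for x, continuous (fun y => (w *m 'J F y) 0 l)}.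
  rewrite (_ : (fun y => _) = fun y => \sum_m w 0 m * 'J F y m l); last first.
    by apply/funext => y; rewrite mxE.
  apply: sum_continuous_at => m.
  have cw : {for x, continuous (fun _ : 'rV[R]_3 => w 0 m : R)} by exact: cst_continuous.
  exact: (cvgM cw (cJ x m l Ox)).
rewrite (_ : (fun y => _) = fun y =>
  (face_edge1 R i *m 'J F y) 0 (j + 1) * (face_edge2 R i *m 'J F y) 0 (j + 2) -
  (face_edge1 R i *m 'J F y) 0 (j + 2) * (face_edge2 R i *m 'J F y) 0 (j + 1)).
  exact: (cvgB (cvgM (c _ _) (c _ _)) (cvgM (c _ _) (c _ _))).
by apply/funext => y; rewrite mxE.
Qed.

Lemma face_cross_bounded_measurable j :
  bounded_measurable D (fun z => face_cross F i z 0 j).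
Proof.
have [W [oO sO c]] := face_cross_continuous.
exact: (@face_bounded_measurable W (fun y =>
  cross (face_edge1 R i *m 'J F y) (face_edge2 R i *m 'J F y) 0 j) oO sO (fun x => c x j)).
Qed.

Lemma face_area_bounded_measurable :
  bounded_measurable D (fun z => enorm (face_cross F i z)).
Proof.
have [W [oO sO c]] := face_cross_continuous.
pose w y := cross (face_edge1 R i *m 'J F y) (face_edge2 R i *m 'J F y).
apply: (@face_bounded_measurable W (fun y => enorm (w y)) oO sO) => x Ox.
have cd : {for x, continuous (fun y => dot (w y) (w y))}.
  by apply: sum_continuous_at => j; exact: (cvgM (c x j Ox) (c x j Ox)).
exact: (continuous_comp cd (@sqrt_continuous R _)).
Qed.

Lemma face_normal_bounded_measurable j :
  bounded_measurable D (fun z => face_normal F i z 0 j).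
Proof.
have [mc _] := face_cross_bounded_measurable j.
have [ma _] := face_area_bounded_measurable.
split.
  have mi : measurable_fun D (fun z => (enorm (face_cross F i z))^-1).
    rewrite (_ : (fun z => _) = (fun s : R => s `^ (-1)) \o (fun z => enorm (face_cross F i z))).
      by apply: measurableT_comp ma; apply: measurable_powR.
    by apply/funext => z /=; rewrite powR_inv1 // sqrtr_ge0.
  rewrite (_ : (fun z => _) = fun z => (enorm (face_cross F i z))^-1 * face_cross F i z 0 j).
    exact: measurable_funM mi mc.
  by apply/funext => z; rewrite mxE.
exists 1 => z _; rewrite mxE; set w := face_cross F i z.
have [->|w0] := eqVneq (enorm w) 0; first by rewrite invr0 mul0r normr0.
have wp : 0 < enorm w by rewrite lt_def w0 sqrtr_ge0.
rewrite normrM normfV (gtr0_norm wp) ler_pdivrMl // mulr1.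
rewrite -sqrtr_sqr; apply: ler_wsqrtr.
by rewrite expr2 /dot (bigD1 j) //= lerDl; apply: sumr_ge0 => l _; rewrite -expr2 sqr_ge0.
Qed.

End FaceIntegrals.

Section BoundaryForm.
Variables (R : realType).
Implicit Types (u v w : 'rV[R]_3 -> 'rV[R]_3) (F : 'rV[R]_3 -> 'rV[R]_3).

Definition face_integrand F (i : 'I_4) u v (z : R * R) : R :=
  let x := F (face_point i z) in
  let n := face_normal F i z in
  dot (tangential n (cell_trace F u x)) (tangential n (cell_trace F v x))
  * enorm (face_cross F i z).

Lemma tangential_lin (a : R) (n x y : 'rV[R]_3) :
  tangential n (a *: x + y) = a *: tangential n x + tangential n y.
Proof.
apply/rowP => j; rewrite /tangential !mxE /dot !sum_ord3 !mxE; ring.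
Qed.

Lemma dot_linl (a : R) (x y w : 'rV[R]_3) :
  dot (a *: x + y) w = a * dot x w + dot y w.
Proof. by rewrite /dot !sum_ord3 !mxE; ring. Qed.

Lemma face_integrand_bounded_measurable F i u v : cell_map F ->
  nedelec_on_cell F u -> nedelec_on_cell F v ->
  bounded_measurable (@ref_triangle R) (face_integrand F i u v).
Proof.
move=> hF hu hv.
have hn j := face_normal_bounded_measurable i hF j.
have ht w j : nedelec_on_cell F w -> bounded_measurable (@ref_triangle R)
    (fun z => tangential (face_normal F i z) (cell_trace F w (F (face_point i z))) 0 j).
  move=> hw; have tr l := cell_trace_bounded_measurable i hF l hw.
  rewrite (_ : (fun z => _) = fun z => cell_trace F w (F (face_point i z)) 0 j +
    -1 * ((\sum_l cell_trace F w (F (face_point i z)) 0 l * face_normal F i z 0 l)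
      * face_normal F i z 0 j)); last first.
    by apply/funext => z; rewrite !mxE mulN1r.
  apply: bounded_measurableD => //.
  apply: bounded_measurableM; first exact: bounded_measurable_cst.
  apply: bounded_measurableM => //; apply: bounded_measurable_sum => l.
  exact: bounded_measurableM.
apply: bounded_measurableM; last exact: face_area_bounded_measurable.
apply: bounded_measurable_sum => j.
by apply: bounded_measurableM; apply: ht.
Qed.

Lemma face_integral_lin F i (a : R) u v w : cell_map F ->
  nedelec_on_cell F u -> nedelec_on_cell F v -> nedelec_on_cell F w ->
  \int[leb2 R]_(z in @ref_triangle R) face_integrand F i (a *: u + v) w z =
  a * \int[leb2 R]_(z in @ref_triangle R) face_integrand F i u w z +
  \int[leb2 R]_(z in @ref_triangle R) face_integrand F i v w z.
Proof.
move=> hF hu hv hw.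
have hi u' : nedelec_on_cell F u' -> (leb2 R).-integrable (@ref_triangle R)
    (EFin \o face_integrand F i u' w).
  move=> hu'; apply: (@bounded_measurable_integrable _ _ _ (leb2 R)).
  - exact: ref_triangle_measurable.
  - exact: ref_triangle_lty.
  - exact: face_integrand_bounded_measurable.
rewrite -(@Rintegral_lin _ _ _ (leb2 R) _ (@ref_triangle_measurable R) a _ _
  (hi u hu) (hi v hv)).
apply: eq_Rintegral => z; rewrite inE => hz.
rewrite /face_integrand cell_trace_lin //; last exact: face_point_tet.
by rewrite tangential_lin dot_linl mulrDl mulrA.
Qed.

Variables (Gi : set 'rV[R]_3) (N : nat) (Phi : 'I_N -> 'rV[R]_3 -> 'rV[R]_3).
Hypothesis maps : forall K, cell_map (Phi K).

Lemma bformE u v : bform Gi Phi u v = \sum_(K < N)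
  \sum_(i < 4 | `[< Phi K @` @ref_face R i `<=` Gi >])
    \int[leb2 R]_(z in @ref_triangle R) face_integrand (Phi K) i u v z.
Proof. by []. Qed.

Lemma bformC u v : bform Gi Phi u v = bform Gi Phi v u.
Proof.
rewrite !bformE; apply: eq_bigr => K _; apply: eq_bigr => i _.
by apply: eq_Rintegral => z _; rewrite /face_integrand dotC.
Qed.

Lemma bform_ge0 u : 0 <= bform Gi Phi u u.
Proof.
rewrite bformE; apply: sumr_ge0 => K _; apply: sumr_ge0 => i _.
apply: Rintegral_ge0 => z _; rewrite mulr_ge0 ?sqrtr_ge0 //.
exact: dot_ge0.
Qed.

Lemma bform_bilinear V : (forall v, V v -> forall K, nedelec_on_cell (Phi K) v) ->
  bilinear_on V (bform Gi Phi).
Proof.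
move=> hV; have h w : V w -> linear_on V (fun u => bform Gi Phi u w).
  move=> hw a u v hu hv; rewrite !bformE.
  rewrite mulr_sumr -big_split /=; apply: eq_bigr => K _.
  rewrite mulr_sumr -big_split /=; apply: eq_bigr => i _.
  by apply: face_integral_lin => //; apply: hV.
split=> [|w hw a u v hu hv]; first exact: h.
rewrite (bformC w) (bformC w u) (bformC w v).
exact: (h w hw a u v hu hv).
Qed.

Lemma nedelec_space_on_cell Om k v : nedelec_space Om Gi Phi k v ->
  forall K, nedelec_on_cell (Phi K) v.
Proof. by move=> [_ h] K; have [vh hvh e] := h K; exists k, vh. Qed.

Lemma bform_cell_null v : (forall K, nedelec_on_cell (Phi K) v) ->
  cell_null Phi v -> bform Gi Phi v v = 0.
Proof.
move=> hv v0; rewrite bformE big1 // => K _; rewrite big1 // => i _.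
rewrite (@eq_Rintegral _ _ _ _ _ (fun=> 0)); last first.
  move=> z; rewrite inE => hz; rewrite /face_integrand.
  rewrite (@cell_trace_eq _ _ (maps K) v (fun=> 0)).
  - by rewrite /tangential dot0l scale0r subr0 dot0l mul0r.
  - exact: face_point_tet.
  - exact: cst_continuous.
  - by move=> y hy; apply: v0.
by rewrite /Rintegral integral0.
Qed.

End BoundaryForm.

(** * The discrete mixed problem *)

Section LinearOn.
Variables (R : realType) (X Y : lmodType R).

Lemma linear_on_add (V : set X) f g : linear_on V f -> linear_on V g ->
  linear_on V (fun v => f v + g v).
Proof. by move=> hf hg a u v hu hv; rewrite hf // hg //; ring. Qed.

Lemma linear_on_opp (V : set X) f : linear_on V f -> linear_on V (fun v => - f v).
Proof. by move=> hf a u v hu hv; rewrite hf //; ring. Qed.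

Lemma linear_on_scale (V : set X) (c : R) f : linear_on V f ->
  linear_on V (fun v => c * f v).
Proof. by move=> hf a u v hu hv; rewrite hf //; ring. Qed.

Lemma linear_onS (V W : set X) f : V `<=` W -> linear_on W f -> linear_on V f.
Proof. by move=> VW hf a u v hu hv; apply: hf; apply: VW. Qed.

Lemma bilinear_onS (V W : set X) f : V `<=` W -> bilinear_on W f -> bilinear_on V f.
Proof.
move=> VW [hl hr]; split=> v hv.
- exact: linear_onS VW (hl v (VW v hv)).
- exact: linear_onS VW (hr v (VW v hv)).
Qed.

Lemma linear_on_fst (V : set X) (W : set Y) f : linear_on V f ->
  @linear_on R (X * Y)%type (V `*` W) (fun v => f v.1).
Proof. by move=> hf a [u1 u2] [v1 v2] [/= h1 _] [/= h2 _]; apply: hf. Qed.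

Lemma linear_on_snd (V : set X) (W : set Y) f : linear_on W f ->
  @linear_on R (X * Y)%type (V `*` W) (fun v => f v.2).
Proof. by move=> hf a [u1 u2] [v1 v2] [/= _ h1] [/= _ h2]; apply: hf. Qed.

Lemma subspace_prod (V : set X) (W : set Y) : subspace V -> subspace W ->
  @subspace R (X * Y)%type (V `*` W).
Proof.
move=> hV hW; split; first by split; [exact: subspace0 hV|exact: subspace0 hW].
move=> a [u1 u2] [v1 v2] [/= h1 h2] [/= h3 h4].
by split; [exact: (subspaceP a hV h1 h3)|exact: (subspaceP a hW h2 h4)].
Qed.

Lemma dual_norm_ge0 (V : set X) (nrm g : X -> R) :
  V 0 -> nrm 0 <= 1 -> (0 <= dual_norm V nrm g)%E.
Proof.
move=> V0 n0; apply: (@le_trans _ _ `|g 0|%:E); first by rewrite lee_fin.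
by apply: ereal_sup_ubound; exists 0.
Qed.

Lemma dual_norm_bound (V : set X) (nrm g : X -> R) (r : R) v : subspace V ->
  linear_on V g -> (forall s u, V u -> 0 <= s -> nrm (s *: u) = s * nrm u) ->
  V v -> 0 < r -> nrm v <= r ->
  ((g v)%:E <= r%:E * dual_norm V nrm g)%E.
Proof.
move=> hV hg hn Vv r0 nv.
have r0' : 0 <= r^-1 by rewrite invr_ge0 ltW.
apply: (@le_trans _ _ (r%:E * `|g (r^-1 *: v)|%:E)%E).
  rewrite -EFinM lee_fin (linear_onZ _ hV hg) // normrM ger0_norm //.
  by rewrite mulrA divff ?gt_eqF // mul1r ler_norm.
rewrite lee_pmul2l //; apply: ereal_sup_ubound.
exists (r^-1 *: v) => //; split; first exact: subspaceZ.
by rewrite hn // ler_pdivrMl // mulr1.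
Qed.

End LinearOn.

Lemma addr3_ge0_eq0 (R : realFieldType) (u v w : R) :
  0 <= u -> 0 <= v -> 0 <= w -> u + v + w = 0 -> [/\ u = 0, v = 0 & w = 0].
Proof. by move=> h1 h2 h3 h4; split; lra. Qed.

Lemma addr3_only1 (R : pzRingType) (t u v w u' v' w' : R) :
  u + v + w = t * (u' + v' + w') -> v = 0 -> w = 0 -> v' = 0 -> w' = 0 ->
  u = t * u'.
Proof. by move=> h e1 e2 e3 e4; move: h; rewrite e1 e2 e3 e4 !addr0. Qed.

Lemma addr3_only2 (R : pzRingType) (t u v w u' v' w' : R) :
  u + v + w = t * (u' + v' + w') -> u = 0 -> w = 0 -> u' = 0 -> w' = 0 ->
  v = t * v'.
Proof. by move=> h e1 e2 e3 e4; move: h; rewrite e1 e2 e3 e4 !add0r !addr0. Qed.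

Lemma addr3_only3 (R : pzRingType) (t u v w u' v' w' : R) :
  u + v + w = t * (u' + v' + w') -> u = 0 -> v = 0 -> u' = 0 -> v' = 0 ->
  w = t * w'.
Proof. by move=> h e1 e2 e3 e4; move: h; rewrite e1 e2 e3 e4 !add0r. Qed.

Lemma sqr_addr3_le (R : realFieldType) (u v w : R) :
  (u + v + w) * (u + v + w) <= 3 * (u ^+ 2 + v ^+ 2 + w ^+ 2).
Proof.
have := sqr_ge0 (u - v); have := sqr_ge0 (u - w); have := sqr_ge0 (v - w).
by move=> h1 h2 h3; nra.
Qed.

Lemma le_dual_sum (R : realType) (w c l1 l2 l3 : R) (d1 d2 d3 : \bar R) :
  0 < c -> (0 <= d1)%E -> (0 <= d2)%E -> (0 <= d3)%E ->
  w * w <= c * (l1 + l2 + l3) ->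
  (0 < w -> [/\ (l1%:E <= w%:E * d1)%E, (l2%:E <= w%:E * d2)%E
    & (l3%:E <= w%:E * d3)%E]) ->
  (w%:E <= c%:E * (d1 + d2 + d3))%E.
Proof.
move=> c0 h1 h2 h3 ww hl; have h12 := adde_ge0 h1 h2; have h123 := adde_ge0 h12 h3.
have [w0|w0] := leP w 0.
  apply: (@le_trans _ _ 0%E); first by rewrite lee_fin.
  by apply: mule_ge0 => //; rewrite lee_fin ltW.
have [b1 b2 b3] := hl w0.
have b : ((l1 + l2 + l3)%:E <= w%:E * (d1 + d2 + d3))%E.
  rewrite (ge0_muleDr _ h12 h3) (ge0_muleDr _ h1 h2) !EFinD.
  by apply: leeD => //; apply: leeD.
rewrite -(@lee_pmul2l _ w%:E) // muleCA -EFinM.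
apply: (@le_trans _ _ (c * (l1 + l2 + l3))%:E); first by rewrite lee_fin.
by rewrite EFinM lee_pmul2l.
Qed.

Section WellPosed.
Variables (R : realType) (Om : set 'rV[R]_3).
Hypotheses (oOm : open Om) (bOm : bounded_set Om).
Local Notation field := ('rV[R]_3 -> 'rV[R]_3).
Local Notation scalar := ('rV[R]_3 -> R^o).
Variables (eps mu : 'rV[R]_3 -> R) (gamma tau : R).
Hypotheses (weps : bounded_weight Om eps) (eps0 : forall x, Om x -> 0 < eps x).
Hypotheses (wmu : bounded_weight Om (inv_w mu))
  (mu0 : forall x, Om x -> 0 < inv_w mu x).
Hypotheses (gamma0 : 0 < 1 + gamma) (tau0 : 0 < tau).
Variables (Vg : set scalar) (Vc Vd : set field) (Vl : set ('rV[R]_3 -> R)).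
Hypotheses (sVg : @subspace R scalar Vg) (sVc : subspace Vc) (sVd : subspace Vd).
Hypotheses (Hg : forall p, Vg p -> Hgrad Om p) (Hc : forall E, Vc E -> Hcurl Om E)
  (Hd : forall B, Vd B -> Hdiv Om B).
Variables (Nf : set field) (Ns : set scalar).
Hypotheses (sNf : subspace Nf) (sNs : @subspace R scalar Ns).
Hypotheses (Nf_ae : forall v, Nf v -> ae_eq_on Om v (fun=> 0))
  (Ns_ae : forall p, Ns p -> ae_eq_on Om p (fun=> 0)).
Hypotheses (fVg : @fin_dim R scalar Ns Vg) (fVc : fin_dim Nf Vc) (fVd : fin_dim Nf Vd).
Variable b : field -> field -> R.
Hypotheses (bil : bilinear_on Vc b) (bC : forall u v, b u v = b v u)
  (b0 : forall v, 0 <= b v v) (bN : forall v, Vc v -> Nf v -> b v v = 0).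
Hypothesis seqV : discrete_sequence Om Vg Vc Vd Vl.

Let ip := ipv Om.
Let im := inv_w mu.

Let LB B : Vd B -> L2v Om B. Proof. by move=> /Hd /Hdiv_L2v. Qed.
Let LE E : Vc E -> L2v Om E. Proof. by move=> /Hc /Hcurl_L2v. Qed.
Let LcE E : Vc E -> L2v Om (curl Om E). Proof. by move=> /Hc /curl_L2v. Qed.
Let Lp p : Vg p -> L2 Om p. Proof. by move=> /Hg /Hgrad_L2. Qed.
Let Lgp p : Vg p -> L2v Om (grad Om p). Proof. by move=> /Hg /grad_L2v. Qed.
Let LdB B : Vd B -> L2 Om (div Om B). Proof. by move=> /Hd /div_L2. Qed.

Let ip_lin w z : bounded_weight Om w -> L2v Om z -> linear_on (L2v Om) (ip w z).
Proof. by move=> hw hz; apply: (ipv_bilinear oOm hw).2. Qed.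

Let ip_linl w z : bounded_weight Om w -> L2v Om z -> linear_on (L2v Om) (ip w ^~ z).
Proof. by move=> hw hz; apply: (ipv_bilinear oOm hw).1. Qed.

Let ip_curl_lin w z : bounded_weight Om w -> L2v Om z ->
  linear_on Vc (fun E => ip w z (curl Om E)).
Proof.
move=> hw hz a u v hu hv; rewrite /ip ![ipv Om w z _]ipvC.
have h := Hcurl_lin oOm bOm a (Hc hu) (Hc hv).
have hh := L2v_lin oOm a (LcE hu) (LcE hv).
rewrite (ipv_ae oOm hw (curl_L2v h) hh hz (curl_lin oOm bOm a (Hc hu) (Hc hv))).
exact: (ipv_linl oOm a hw (LcE hu) (LcE hv) hz).
Qed.

Let ip_grad_lin w z : bounded_weight Om w -> L2v Om z ->
  @linear_on R scalar Vg (fun p => ip w z (grad Om p)).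
Proof.
move=> hw hz a u v hu hv; rewrite /ip ![ipv Om w z _]ipvC.
have h := Hgrad_lin oOm bOm a (Hg hu) (Hg hv).
have hh := L2v_lin oOm a (Lgp hu) (Lgp hv).
rewrite -(ipv_linl oOm a hw (Lgp hu) (Lgp hv) hz).
exact: (ipv_ae oOm hw (grad_L2v h) hh hz (grad_lin oOm bOm a (Hg hu) (Hg hv))).
Qed.

Let ips_div_lin z : L2 Om z -> linear_on Vd (fun B => ips Om z (div Om B)).
Proof.
move=> hz a u v hu hv; rewrite ![ips Om z _]ipsC.
have h := Hdiv_lin oOm bOm a (Hd hu) (Hd hv).
have hh := L2_lin oOm a (LdB hu) (LdB hv).
rewrite -(ips_linl oOm a (LdB hu) (LdB hv) hz).
exact: (ips_ae oOm (div_L2 h) hh hz (div_lin oOm bOm a (Hd hu) (Hd hv))).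
Qed.

Let curl_ae0 E : Vc E -> ae_eq_on Om E (fun=> 0) -> ae_eq_on Om (curl Om E) (fun=> 0).
Proof.
move=> hE E0; have [h1 h2] := curlP (Hc hE).
apply: (weak_curl_ae oOm bOm _ (weak_curl0 Om)); split=> // phi p1 p2.
rewrite -h2 // !integ_dotE; apply/esym; apply: ipv_ae => //.
- exact: one_w_bounded.
- exact: LE.
- exact: L2v_0.
- exact: ccurl_L2v.
Qed.

Let grad_ae0 p : Vg p -> ae_eq_on Om p (fun=> 0) -> ae_eq_on Om (grad Om p) (fun=> 0).
Proof.
move=> hp p0; have [h1 h2] := gradP (Hg hp).
apply: (weak_grad_ae oOm bOm _ (weak_grad0 Om)); split=> // phi c1 c2.
rewrite -h2 //; apply/esym.
exact: (ips_ae oOm (Lp hp) (L2_0 _) (cdiv_L2 oOm bOm c1) p0).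
Qed.

Let div_ae0 B : Vd B -> ae_eq_on Om B (fun=> 0) -> ae_eq_on Om (div Om B) (fun=> 0).
Proof.
move=> hB B0; have [h1 h2] := divP (Hd hB).
apply: (weak_div_ae oOm bOm _ (weak_div0 Om)); split=> // phi p1 p2.
rewrite -h2 // !integ_dotE; apply/esym; apply: ipv_ae => //.
- exact: one_w_bounded.
- exact: LB.
- exact: L2v_0.
- exact: cgrad_L2v.
Qed.

Let ip_ae0 w u v : bounded_weight Om w -> L2v Om u -> L2v Om v ->
  ae_eq_on Om v (fun=> 0) -> ip w u v = 0.
Proof.
move=> hw hu hv v0; rewrite /ip ipvC (ipv_ae oOm hw hv (L2v_0 _) hu v0).
exact: (linear_on0 (L2v_subspace oOm) (ip_linl hw hu)).
Qed.

Let ips_ae0 u v : L2 Om u -> L2 Om v -> ae_eq_on Om v (fun=> 0) -> ips Om u v = 0.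
Proof.
move=> hu hv v0; rewrite ipsC (ips_ae oOm hv (L2_0 _) hu v0).
exact: (linear_on0 (L2_subspace oOm) ((ips_bilinear oOm).1 u hu)).
Qed.

Let V0 := ker_div Om Vd.

Let V0d : V0 `<=` Vd. Proof. by move=> B []. Qed.

Let sV0 : subspace V0.
Proof.
split.
  by split; [exact: subspace0 sVd|exact: div0].
move=> a u v [hu du] [hv dv]; split; first exact: (subspaceP a sVd hu hv).
move: (div_lin oOm bOm a (Hd hu) (Hd hv)) du dv.
by apply: filterS3 => t h1 h2 h3 Ot; rewrite h1 // h2 // h3 // mulr0 addr0.
Qed.

Let curl_V0 E : Vc E -> exists2 B, V0 B & ae_eq_on Om (curl Om E) B.
Proof.
move=> hE; have [_ hs _ _ hz] := seqV.
have [B hB EB] := hs E hE; exists B => //; split=> //.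
have [h1 h2] := divP (Hd hB).
have wE : weak_div Om (curl Om E) (div Om B).
  split=> // phi p1 p2; rewrite -h2 // !integ_dotE; apply: ipv_ae => //.
  - exact: one_w_bounded.
  - exact: LcE.
  - exact: LB.
  - exact: cgrad_L2v.
have dE : Hdiv Om (curl Om E) by split; [exact: LcE|exists (div Om B)].
exact: ae_eq_on_trans (weak_div_ae oOm bOm wE (divP dE)) (hz E hE).
Qed.

Let V0_orthogonal C : Vd C -> exists2 C0, V0 C0 &
  forall D, V0 D -> ip im (C - C0) D = 0.
Proof.
move=> hC.
have bl : bilinear_on V0 (ip im).
  apply: (bilinear_onS _ (ipv_bilinear oOm wmu)) => B hB.
  by apply: LB; apply: V0d.
have null_triple v : V0 v -> ip im v v = 0 -> ae_eq_on Om v (fun=> 0).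
  by move=> /V0d hv; apply: (ipv_eq0 oOm wmu mu0 (LB hv)).
have [|u v hu hv /(null_triple v hv)|||C0 hC0 e] := representation sNf sV0 (fin_dimS V0d fVd) bl
    _ _ (l := ip im C).
- by move=> v /V0d hv /Nf_ae; apply: ip_ae0 => //; apply: LB.
- by apply: ip_ae0 => //; apply: LB; apply: V0d.
- apply: (linear_onS _ (ip_lin wmu (LB hC))) => B hB.
  by apply: LB; apply: V0d.
- move=> v hv /(null_triple v hv); apply: ip_ae0 => //; first exact: LB.
  by apply: LB; apply: V0d.
- exists C0 => // D hD; have LD := LB (V0d hD).
  rewrite (linear_onB (ip_linl wmu LD)); [|exact: LB|by apply: LB; apply: V0d].
  by rewrite e // subrr.
Qed.

Local Notation triple := ((field * field) * scalar)%type.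

Let W : set triple := (Vd `*` Vc) `*` Vg.
Let W0 : set triple := (V0 `*` Vc) `*` Vg.
Let NW : set triple := (Nf `*` Nf) `*` Ns.

Let sW : @subspace R triple W.
Proof. by apply: subspace_prod => //; apply: subspace_prod. Qed.

Let sW0 : @subspace R triple W0.
Proof. by apply: subspace_prod => //; apply: subspace_prod. Qed.

Let sNW : @subspace R triple NW.
Proof. by apply: subspace_prod => //; apply: subspace_prod. Qed.

Let W0W : W0 `<=` W.
Proof. by move=> x [[/V0d ? ?] ?]. Qed.

Let fW0 : @fin_dim R triple NW W0.
Proof. by apply: fin_dim_prod => //; apply: fin_dim_prod => //; apply: fin_dimS fVd. Qed.

Let lB (x : triple -> R) (f : field -> R) : x = (fun y => f y.1.1) ->
  linear_on Vd f -> @linear_on R triple W x.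
Proof.
move=> -> h; exact: (@linear_on_fst _ _ _ (Vd `*` Vc) Vg (fun y => f y.1)
  (@linear_on_fst _ _ _ Vd Vc f h)).
Qed.

Let lE (x : triple -> R) (f : field -> R) : x = (fun y => f y.1.2) ->
  linear_on Vc f -> @linear_on R triple W x.
Proof.
move=> -> h; exact: (@linear_on_fst _ _ _ (Vd `*` Vc) Vg (fun y => f y.2)
  (@linear_on_snd _ _ _ Vd Vc f h)).
Qed.

Let lp (x : triple -> R) (f : scalar -> R) : x = (fun y => f y.2) ->
  @linear_on R scalar Vg f -> @linear_on R triple W x.
Proof. by move=> -> h; exact: (@linear_on_snd _ _ _ (Vd `*` Vc) Vg f h). Qed.

Definition step_form (x y : triple) : R :=
  (2 / tau * ip im x.1.1 y.1.1 + ip im (curl Om x.1.2) y.1.1) +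
  (2 / tau * ip eps x.1.2 y.1.2 + ip eps (grad Om x.2) y.1.2
    - ip im x.1.1 (curl Om y.1.2) + (1 + gamma) * b x.1.2 y.1.2) +
  (2 / tau * ips Om x.2 y.2 - ip eps x.1.2 (grad Om y.2)).

Definition energy_form (x y : triple) : R :=
  2 / tau * ip im x.1.1 y.1.1 + 2 / tau * ip eps x.1.2 y.1.2
  + (1 + gamma) * b x.1.2 y.1.2 + 2 / tau * ips Om x.2 y.2.

Definition full_form (x y : triple) : R :=
  (2 / tau * ip im x.1.1 y.1.1 + ips Om (div Om x.1.1) (div Om y.1.1)) +
  (2 / tau * ip eps x.1.2 y.1.2 + tau / 2 * ip im (curl Om x.1.2) (curl Om y.1.2)
    + (1 + gamma) * b x.1.2 y.1.2) +
  (2 / tau * ips Om x.2 y.2 + tau / 2 * ip eps (grad Om x.2) (grad Om y.2)).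

Let lin_B w z : bounded_weight Om w -> L2v Om z ->
  @linear_on R triple W (fun y => ip w z y.1.1).
Proof.
move=> hw hz; apply: (lB (f := ip w z)) => //.
by apply: (linear_onS _ (ip_lin hw hz)) => B; apply: LB.
Qed.

Let lin_E w z : bounded_weight Om w -> L2v Om z ->
  @linear_on R triple W (fun y => ip w z y.1.2).
Proof.
move=> hw hz; apply: (lE (f := ip w z)) => //.
by apply: (linear_onS _ (ip_lin hw hz)) => B; apply: LE.
Qed.

Let lin_cE w z : bounded_weight Om w -> L2v Om z ->
  @linear_on R triple W (fun y => ip w z (curl Om y.1.2)).
Proof.
move=> hw hz; apply: (lE (f := fun E => ip w z (curl Om E))) => //.
exact: ip_curl_lin.
Qed.

Let lin_gp w z : bounded_weight Om w -> L2v Om z ->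
  @linear_on R triple W (fun y => ip w z (grad Om y.2)).
Proof.
move=> hw hz; apply: (lp (f := fun p => ip w z (grad Om p))) => //.
exact: ip_grad_lin.
Qed.

Let lin_p z : L2 Om z -> @linear_on R triple W (fun y => ips Om z y.2).
Proof.
move=> hz; apply: (lp (f := fun p => ips Om z p)) => //.
by apply: (linear_onS _ ((ips_bilinear oOm).2 z hz)) => p; apply: Lp.
Qed.

Let lin_dB z : L2 Om z -> @linear_on R triple W (fun y => ips Om z (div Om y.1.1)).
Proof.
move=> hz; apply: (lB (f := fun B => ips Om z (div Om B))) => //.
exact: ips_div_lin.
Qed.

Let lin_b z : Vc z -> @linear_on R triple W (fun y => b z y.1.2).
Proof. by move=> hz; apply: (lE (f := b z)) => //; apply: bil.2. Qed.

Let linl (f g : triple -> R) : (forall y, f y = g y) ->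
  @linear_on R triple W g -> @linear_on R triple W f.
Proof. by move=> fg hg a u v hu hv; rewrite !fg hg. Qed.

Let add f g := @linear_on_add R triple W f g.
Let opp f := @linear_on_opp R triple W f.
Let scl c f := @linear_on_scale R triple W c f.

Let form_bilinear : @bilinear_on R triple W step_form.
Proof.
split=> -[[B E] p] [[/= hB hE] hp]; last first.
  pose T1 := add (scl (2 / tau) (lin_B wmu (LB hB))) (lin_B wmu (LcE hE)).
  pose T2 := add (add (add (scl (2 / tau) (lin_E weps (LE hE)))
    (lin_E weps (Lgp hp))) (opp (lin_cE wmu (LB hB)))) (scl (1 + gamma) (lin_b hE)).
  pose T3 := add (scl (2 / tau) (lin_p (Lp hp))) (opp (lin_gp weps (LE hE))).
  exact: (add (add T1 T2) T3).
pose T1 := add (scl (2 / tau) (lin_B wmu (LB hB))) (lin_cE wmu (LB hB)).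
pose T2 := add (add (add (scl (2 / tau) (lin_E weps (LE hE)))
  (lin_gp weps (LE hE))) (opp (lin_B wmu (LcE hE)))) (scl (1 + gamma) (lin_b hE)).
pose T3 := add (scl (2 / tau) (lin_p (Lp hp))) (opp (lin_E weps (Lgp hp))).
apply: linl (add (add T1 T2) T3) => y.
rewrite /step_form /= /ip (ipvC Om im y.1.1) (ipvC Om im (curl Om y.1.2)).
rewrite (ipvC Om eps y.1.2) (ipvC Om eps (grad Om y.2)) (ipvC Om im y.1.1).
by rewrite (ipvC Om eps y.1.2) (bC y.1.2) (ipsC Om y.2).
Qed.

Let energyC x y : energy_form x y = energy_form y x.
Proof. by rewrite /energy_form /ip (ipvC Om im) (ipvC Om eps) bC ipsC. Qed.

Let energy_bilinear : @bilinear_on R triple W energy_form.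
Proof.
have h x : W x -> @linear_on R triple W (energy_form x).
  move: x => [[B E] p] [[/= hB hE] hp].
  exact: (add (add (add (scl (2 / tau) (lin_B wmu (LB hB)))
    (scl (2 / tau) (lin_E weps (LE hE)))) (scl (1 + gamma) (lin_b hE)))
    (scl (2 / tau) (lin_p (Lp hp)))).
by split=> x hx; [apply: linl (h x hx) => y; apply: energyC|apply: h].
Qed.

Let fullC x y : full_form x y = full_form y x.
Proof.
rewrite /full_form /ip (ipvC Om im x.1.1) (ipvC Om eps x.1.2) bC (ipsC Om x.2).
by rewrite (ipsC Om (div Om x.1.1)) (ipvC Om im (curl Om x.1.2))
  (ipvC Om eps (grad Om x.2)).
Qed.

Let full_bilinear : @bilinear_on R triple W full_form.
Proof.
have h x : W x -> @linear_on R triple W (full_form x).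
  move: x => [[B E] p] [[/= hB hE] hp].
  pose T1 := add (scl (2 / tau) (lin_B wmu (LB hB))) (lin_dB (LdB hB)).
  pose T2 := add (add (scl (2 / tau) (lin_E weps (LE hE)))
    (scl (tau / 2) (lin_cE wmu (LcE hE)))) (scl (1 + gamma) (lin_b hE)).
  pose T3 := add (scl (2 / tau) (lin_p (Lp hp))) (scl (tau / 2) (lin_gp weps (Lgp hp))).
  exact: (add (add T1 T2) T3).
by split=> x hx; [apply: linl (h x hx) => y; apply: fullC|apply: h].
Qed.

Definition null_triple (x : triple) : Prop :=
  [/\ ae_eq_on Om x.1.1 (fun=> 0), ae_eq_on Om x.1.2 (fun=> 0),
      ae_eq_on Om x.2 (fun=> 0) & b x.1.2 x.1.2 = 0].

Let ip_mu_ge0 u : 0 <= ip im u u.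
Proof. by apply: ipv_ge0 => x /mu0 /ltW. Qed.

Let ip_eps_ge0 u : 0 <= ip eps u u.
Proof. by apply: ipv_ge0 => x /eps0 /ltW. Qed.

Let tau2 : 0 < 2 / tau. Proof. by rewrite divr_gt0. Qed.

Let energy_ge0 x : 0 <= energy_form x x.
Proof.
have t2 := ltW tau2; have g2 := ltW gamma0.
by rewrite /energy_form !addr_ge0 // mulr_ge0 // ips_ge0.
Qed.

Let full_ge0 x : 0 <= full_form x x.
Proof.
have t2 := ltW tau2; have g2 := ltW gamma0.
have t3 : 0 <= tau / 2 by rewrite divr_ge0 // ltW.
by rewrite /full_form !addr_ge0 // ?ips_ge0 // mulr_ge0 // ips_ge0.
Qed.

Let energy_nul x : W x -> energy_form x x = 0 -> null_triple x.
Proof.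
move=> [[hB hE] hp]; rewrite /energy_form => e0.
have h1 := mulr_ge0 (ltW tau2) (ip_mu_ge0 x.1.1).
have h2 := mulr_ge0 (ltW tau2) (ip_eps_ge0 x.1.2).
have h3 := mulr_ge0 (ltW gamma0) (b0 x.1.2).
have h4 := mulr_ge0 (ltW tau2) (ips_ge0 Om x.2).
have key (c t : R) : 0 < c -> c * t = 0 -> t = 0.
  by move=> c0 /eqP; rewrite mulf_eq0 gt_eqF //= => /eqP.
split.
- apply: (ipv_eq0 oOm wmu mu0 (LB hB)); apply: (key _ _ tau2).
  by move: h1 h2 h3 h4 e0; rewrite /ip; lra.
- apply: (ipv_eq0 oOm weps eps0 (LE hE)); apply: (key _ _ tau2).
  by move: h1 h2 h3 h4 e0; rewrite /ip; lra.
- apply: (ips_eq0 oOm (Lp hp)); apply: (key _ _ tau2).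
  by move: h1 h2 h3 h4 e0; lra.
- by apply: (key _ _ gamma0); move: h1 h2 h3 h4 e0; lra.
Qed.

Let NW_nul x : W x -> NW x -> null_triple x.
Proof.
move=> [[hB hE] hp] [[nB nE] np].
by split; [exact: Nf_ae|exact: Nf_ae|exact: Ns_ae|exact: bN].
Qed.

Let b_nul u v : Vc u -> Vc v -> b v v = 0 -> b u v = 0.
Proof.
by move=> hu hv; apply: (psd_cauchy_schwarz sVc bil (fun u v _ _ => bC u v)
  (fun u _ => b0 u) hu hv).
Qed.

Let nul_energy x : W x -> null_triple x -> energy_form x x = 0.
Proof.
move=> [[hB hE] hp] [nB nE np bE]; rewrite /energy_form bE.
rewrite (ip_ae0 wmu (LB hB) (LB hB) nB) (ip_ae0 weps (LE hE) (LE hE) nE).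
by rewrite (ips_ae0 (Lp hp) (Lp hp) np) !mulr0 !addr0.
Qed.

Let nul_full x : W x -> null_triple x -> full_form x x = 0.
Proof.
move=> [[hB hE] hp] [nB nE np bE]; rewrite /full_form bE.
rewrite (ip_ae0 wmu (LB hB) (LB hB) nB) (ip_ae0 weps (LE hE) (LE hE) nE).
rewrite (ips_ae0 (Lp hp) (Lp hp) np) (ips_ae0 (LdB hB) (LdB hB) (div_ae0 hB nB)).
rewrite (ip_ae0 wmu (LcE hE) (LcE hE) (curl_ae0 hE nE)).
by rewrite (ip_ae0 weps (Lgp hp) (Lgp hp) (grad_ae0 hp np)) !mulr0 !addr0.
Qed.

Let form_nul u v : W u -> W v -> null_triple v -> step_form u v = 0.
Proof.
move=> [[hB hE] hp] [[kB kE] kp] [nB nE np bE]; rewrite /step_form.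
rewrite (b_nul hE kE bE) (ip_ae0 wmu (LB hB) (LB kB) nB).
rewrite (ip_ae0 wmu (LcE hE) (LB kB) nB) (ip_ae0 weps (LE hE) (LE kE) nE).
rewrite (ip_ae0 weps (Lgp hp) (LE kE) nE) (ips_ae0 (Lp hp) (Lp kp) np).
rewrite (ip_ae0 wmu (LB hB) (LcE kE) (curl_ae0 kE nE)).
rewrite (ip_ae0 weps (LE hE) (Lgp kp) (grad_ae0 kp np)).
by rewrite !mulr0 !subr0 !addr0.
Qed.

Let form_energy x : step_form x x = energy_form x x.
Proof.
rewrite /step_form /energy_form /ip (ipvC Om im (curl Om x.1.2)) (ipvC Om eps (grad Om x.2)).
by ring.
Qed.

Section Data.
Variables (B0 E0 : field) (p0 : scalar) (j0 j1 : field).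
Hypotheses (hB0 : Vd B0) (hE0 : Vc E0) (hp0 : Vg p0) (hj0 : L2v Om j0)
  (hj1 : L2v Om j1).

Let g : data R := step_data Om b eps mu gamma tau B0 E0 p0 j0 j1.

Definition load_form (y : triple) : R := rhs_B g y.1.1 + rhs_E g y.1.2 + rhs_p g y.2.

Let hj : L2v Om (fun x => j1 x + j0 x).
Proof.
have := L2v_lin oOm 1 hj1 hj0; congr L2v.
by rewrite scale1r.
Qed.

Let w1 : bounded_weight Om (@one_w R) := one_w_bounded oOm bOm.

Let load_lin : @linear_on R triple W load_form.
Proof.
pose T1 := add (scl (2 / tau) (lin_B wmu (LB hB0))) (opp (lin_B wmu (LcE hE0))).
pose T2 := add (add (add (add (scl (2 / tau) (lin_E weps (LE hE0)))
  (opp (lin_E weps (Lgp hp0)))) (lin_cE wmu (LB hB0)))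
  (opp (scl (1 + gamma) (lin_b hE0)))) (opp (lin_E w1 hj)).
pose T3 := add (scl (2 / tau) (lin_p (Lp hp0))) (lin_gp weps (LE hE0)).
exact: (add (add T1 T2) T3).
Qed.

Let load_nul v : W v -> null_triple v -> load_form v = 0.
Proof.
move=> [[kB kE] kp] [nB nE np bE].
have -> : load_form v = (2 / tau * ip im B0 v.1.1 - ip im (curl Om E0) v.1.1) +
    (2 / tau * ip eps E0 v.1.2 - ip eps (grad Om p0) v.1.2
      + ip im B0 (curl Om v.1.2) - (1 + gamma) * b E0 v.1.2
      - ip (@one_w R) (fun x => j1 x + j0 x) v.1.2) +
    (2 / tau * ips Om p0 v.2 + ip eps E0 (grad Om v.2)) by [].
rewrite (b_nul hE0 kE bE) (ip_ae0 wmu (LB hB0) (LB kB) nB).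
rewrite (ip_ae0 wmu (LcE hE0) (LB kB) nB) (ip_ae0 weps (LE hE0) (LE kE) nE).
rewrite (ip_ae0 weps (Lgp hp0) (LE kE) nE) (ips_ae0 (Lp hp0) (Lp kp) np).
rewrite (ip_ae0 wmu (LB hB0) (LcE kE) (curl_ae0 kE nE)) (ip_ae0 w1 hj (LE kE) nE).
rewrite (ip_ae0 weps (LE hE0) (Lgp kp) (grad_ae0 kp np)).
by rewrite !mulr0 !subr0 !addr0.
Qed.

Let exists_solution : exists2 x, W0 x & forall y, W0 y -> step_form x y = load_form y.
Proof.
have e0 v : W0 v -> step_form v v = 0 -> null_triple v.
  by move=> /W0W hv; rewrite form_energy; apply: energy_nul.
apply: (@representation R triple NW W0 step_form) => //.
- exact: bilinear_onS W0W form_bilinear.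
- move=> v /W0W hv nv; rewrite form_energy; apply: nul_energy => //.
  exact: NW_nul.
- by move=> u v hu hv /(e0 v hv); apply: form_nul; apply: W0W.
- exact: linear_onS W0W load_lin.
- by move=> v hv /(e0 v hv); apply: load_nul; apply: W0W.
Qed.
Definition row_B (x : triple) C := 2 / tau * ip im x.1.1 C + ip im (curl Om x.1.2) C.
Definition row_E (x : triple) F := 2 / tau * ip eps x.1.2 F + ip eps (grad Om x.2) F
  - ip im x.1.1 (curl Om F) + (1 + gamma) * b x.1.2 F.
Definition row_p (x : triple) (q : scalar) := 2 / tau * ips Om x.2 q - ip eps x.1.2 (grad Om q).

Let ipd w z : bounded_weight Om w -> L2v Om z -> linear_on Vd (ip w z).
Proof. by move=> hw hz; apply: (linear_onS _ (ip_lin hw hz)) => B; apply: LB. Qed.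

Let ipc w z : bounded_weight Om w -> L2v Om z -> linear_on Vc (ip w z).
Proof. by move=> hw hz; apply: (linear_onS _ (ip_lin hw hz)) => B; apply: LE. Qed.

Let ipg z : L2 Om z -> @linear_on R scalar Vg (ips Om z).
Proof.
by move=> hz; apply: (linear_onS _ ((ips_bilinear oOm).2 z hz)) => p; apply: Lp.
Qed.

Let fB_lin x : W x -> linear_on Vd (row_B x).
Proof.
move=> [[hB hE] hp].
exact: (linear_on_add (linear_on_scale (2 / tau) (ipd wmu (LB hB))) (ipd wmu (LcE hE))).
Qed.

Let fE_lin x : W x -> linear_on Vc (row_E x).
Proof.
move=> [[hB hE] hp].
exact: (linear_on_add (linear_on_add (linear_on_add
  (linear_on_scale (2 / tau) (ipc weps (LE hE))) (ipc weps (Lgp hp)))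
  (linear_on_opp (ip_curl_lin wmu (LB hB)))) (linear_on_scale (1 + gamma) (bil.2 _ hE))).
Qed.

Let fp_lin x : W x -> @linear_on R scalar Vg (row_p x).
Proof.
move=> [[hB hE] hp].
exact: (linear_on_add (linear_on_scale (2 / tau) (ipg (Lp hp)))
  (linear_on_opp (ip_grad_lin weps (LE hE)))).
Qed.

Let gB_lin : linear_on Vd (rhs_B g).
Proof.
exact: (linear_on_add (linear_on_scale (2 / tau) (ipd wmu (LB hB0)))
  (linear_on_opp (ipd wmu (LcE hE0)))).
Qed.

Let gE_lin : linear_on Vc (rhs_E g).
Proof.
exact: (linear_on_add (linear_on_add (linear_on_add (linear_on_add
  (linear_on_scale (2 / tau) (ipc weps (LE hE0)))
  (linear_on_opp (ipc weps (Lgp hp0)))) (ip_curl_lin wmu (LB hB0)))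
  (linear_on_opp (linear_on_scale (1 + gamma) (bil.2 _ hE0))))
  (linear_on_opp (ipc w1 hj))).
Qed.

Let gp_lin : @linear_on R scalar Vg (rhs_p g).
Proof.
exact: (linear_on_add (linear_on_scale (2 / tau) (ipg (Lp hp0)))
  (ip_grad_lin weps (LE hE0))).
Qed.

Let formE x y : step_form x y = row_B x y.1.1 + row_E x y.1.2 + row_p x y.2.
Proof. by []. Qed.

Let solvesP x : solves Om Vg Vc Vd b eps mu gamma tau g x.1.1 x.1.2 x.2 <->
  W x /\ forall C F q, Vd C -> Vc F -> Vg q ->
    [/\ row_B x C = rhs_B g C, row_E x F = rhs_E g F & row_p x q = rhs_p g q].
Proof. by split=> [[h1 h2 h3 h4]|[[[h1 h2] h3] h4]]; split. Qed.

Hypothesis dual : in_dual_ker_div Om Vd mu (rhs_B g).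

Let solution_solves x : W0 x -> (forall y, W0 y -> step_form x y = load_form y) ->
  solves Om Vg Vc Vd b eps mu gamma tau g x.1.1 x.1.2 x.2.
Proof.
move=> hx e; apply/solvesP; have hW := W0W hx; split=> // C F q hC hF hq.
have z0 := subspace0 sV0; have zc := subspace0 sVc; have zg := subspace0 sVg.
have zd := V0d z0.
have fB0 := linear_on0 sVd (fB_lin hW); have gB0 := linear_on0 sVd gB_lin.
have fE0 := linear_on0 sVc (fE_lin hW); have gE0 := linear_on0 sVc gE_lin.
have fp0 := linear_on0 sVg (fp_lin hW); have gp0 := linear_on0 sVg gp_lin.
split; last first.
- have h : row_B x 0 + row_E x 0 + row_p x q = rhs_B g 0 + rhs_E g 0 + rhs_p g q :=
    e ((0, 0), q) (conj (conj z0 zc) hq).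
  by move: h; rewrite fB0 gB0 fE0 gE0 !add0r.
- have h : row_B x 0 + row_E x F + row_p x 0 = rhs_B g 0 + rhs_E g F + rhs_p g 0 :=
    e ((0, F), 0) (conj (conj z0 hF) zg).
  by move: h; rewrite fB0 gB0 fp0 gp0 !add0r !addr0.
(* Both sides of the first equation vanish at [C - C0]. *)
have [C0 hC0 orth] := V0_orthogonal hC.
have hC0d := V0d hC0; have hC1 : Vd (C - C0) by apply: subspaceB.
have eC0 : row_B x C0 = rhs_B g C0.
  have h : row_B x C0 + row_E x 0 + row_p x 0 = rhs_B g C0 + rhs_E g 0 + rhs_p g 0 :=
    e ((C0, 0), 0) (conj (conj hC0 zc) zg).
  by move: h; rewrite fE0 gE0 fp0 gp0 !addr0.
have gC1 : rhs_B g (C - C0) = 0 by apply: dual.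
have fC1 : row_B x (C - C0) = 0.
  have [[hB hE] _] := hx; have [D hD ED] := curl_V0 hE.
  have h1 : ip im x.1.1 (C - C0) = 0 by rewrite /ip ipvC; exact: orth.
  have h2 : ip im (curl Om x.1.2) (C - C0) = 0.
    rewrite /ip /im (ipv_ae oOm wmu (LcE hE) (LB (V0d hD)) (LB hC1) ED) ipvC.
    exact: orth.
  by rewrite /row_B h1 h2 mulr0 addr0.
rewrite -(subrK C0 C) (linear_onD (fB_lin hW)) // (linear_onD gB_lin) //.
by rewrite fC1 gC1 eC0.
Qed.

Let solution_unique x x' : solves Om Vg Vc Vd b eps mu gamma tau g x.1.1 x.1.2 x.2 ->
  solves Om Vg Vc Vd b eps mu gamma tau g x'.1.1 x'.1.2 x'.2 ->
  [/\ ae_eq_on Om x'.1.1 x.1.1, ae_eq_on Om x'.1.2 x.1.2 & ae_eq_on Om x'.2 x.2].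
Proof.
move=> /solvesP[hx ex] /solvesP[hx' ex'].
have hd : W (x' - x) by apply: subspaceB.
have h0 : step_form (x' - x) (x' - x) = 0.
  rewrite (linear_onB (form_bilinear.1 _ hd)) //.
  have [[hB hE] hp] := hd.
  have [a1 a2 a3] := ex _ _ _ hB hE hp; have [c1 c2 c3] := ex' _ _ _ hB hE hp.
  by rewrite !formE a1 a2 a3 c1 c2 c3 subrr.
move: h0; rewrite form_energy => /(energy_nul hd)[nB nE np _].
have sub (T : zmodType) (u v : 'rV[R]_3 -> T) :
    ae_eq_on Om (u - v) (fun=> 0) -> ae_eq_on Om u v.
  apply: filterS => t h Ot; apply/eqP; rewrite -subr_eq0; apply/eqP.
  exact: h Ot.
by split; apply: sub.
Qed.

Definition normB B := norm_div Om mu tau B.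
Definition normE E := norm_curl Om b eps mu gamma tau E.
Definition normp (p : scalar) := norm_grad Om eps tau p.

Definition sq_normB B := 2 / tau * ip im B B + ips Om (div Om B) (div Om B).
Definition sq_normE E := 2 / tau * ip eps E E + tau / 2 * ip im (curl Om E) (curl Om E)
  + (1 + gamma) * b E E.
Definition sq_normp (p : scalar) := 2 / tau * ips Om p p + tau / 2 * ip eps (grad Om p) (grad Om p).

Let fullE x : full_form x x = sq_normB x.1.1 + sq_normE x.1.2 + sq_normp x.2.
Proof. by []. Qed.

Let sq_normB_ge0 B : 0 <= sq_normB B.
Proof. by rewrite /sq_normB addr_ge0 ?ips_ge0 // mulr_ge0 // ltW. Qed.

Let tau3 : 0 <= tau / 2. Proof. by rewrite divr_ge0 // ltW. Qed.

Let sq_normE_ge0 E : 0 <= sq_normE E.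
Proof. by rewrite /sq_normE !addr_ge0 // mulr_ge0 // ltW. Qed.

Let sq_normp_ge0 p : 0 <= sq_normp p.
Proof. by rewrite /sq_normp addr_ge0 // mulr_ge0 ?ips_ge0 // ltW. Qed.

Let full_hom s x : W x -> full_form (s *: x) (s *: x) = s ^+ 2 * full_form x x.
Proof.
move=> hx; have hs : W (s *: x) by apply: subspaceZ.
have e1 : full_form (s *: x) (s *: x) = s * full_form x (s *: x) :=
  linear_onZ s sW (full_bilinear.1 _ hs) hx.
have e2 : full_form x (s *: x) = s * full_form x x := linear_onZ s sW (full_bilinear.2 _ hx) hx.
apply: (etrans e1); apply: (etrans (congr1 (fun t => s * t) e2)).
exact: (etrans (mulrA _ _ _) (congr1 (fun t => t * _) (esym (expr2 s)))).
Qed.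

Let P0 : [/\ sq_normB 0 = 0, sq_normE 0 = 0 & sq_normp 0 = 0].
Proof.
have h0 := full_hom 0 (subspace0 sW).
have h : sq_normB 0 + sq_normE 0 + sq_normp 0 = 0.
  by move: h0; rewrite scaler0 expr0n mul0r.
exact: (addr3_ge0_eq0 (sq_normB_ge0 0) (sq_normE_ge0 0) (sq_normp_ge0 0) h).
Qed.

Let sqrt_hom (s u v : R) : 0 <= s -> u = s ^+ 2 * v -> Num.sqrt u = s * Num.sqrt v.
Proof. by move=> s0 ->; rewrite sqrtrM ?sqr_ge0 // sqrtr_sqr ger0_norm. Qed.

Let normB_hom s B : Vd B -> 0 <= s -> normB (s *: B) = s * normB B.
Proof.
move=> hB s0; apply: sqrt_hom => //; have [z1 z2 z3] := P0.
have h : sq_normB (s *: B) + sq_normE (s *: 0) + sq_normp (s *: 0) = s ^+ 2 * (sq_normB B + sq_normE 0 + sq_normp 0) :=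
  full_hom s (conj (conj hB (subspace0 sVc)) (subspace0 sVg) : W ((B, 0), 0)).
exact: (addr3_only1 h (etrans (congr1 sq_normE (scaler0 _ s)) z2)
  (etrans (congr1 sq_normp (scaler0 _ s)) z3) z2 z3).
Qed.

Let normE_hom s E : Vc E -> 0 <= s -> normE (s *: E) = s * normE E.
Proof.
move=> hE s0; apply: sqrt_hom => //; have [z1 z2 z3] := P0.
have h : sq_normB (s *: 0) + sq_normE (s *: E) + sq_normp (s *: 0) = s ^+ 2 * (sq_normB 0 + sq_normE E + sq_normp 0) :=
  full_hom s (conj (conj (subspace0 sVd) hE) (subspace0 sVg) : W ((0, E), 0)).
exact: (addr3_only2 h (etrans (congr1 sq_normB (scaler0 _ s)) z1)
  (etrans (congr1 sq_normp (scaler0 _ s)) z3) z1 z3).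
Qed.

Let normp_hom s p : Vg p -> 0 <= s -> normp (s *: p) = s * normp p.
Proof.
move=> hp s0; apply: sqrt_hom => //; have [z1 z2 z3] := P0.
have h : sq_normB (s *: 0) + sq_normE (s *: 0) + sq_normp (s *: p) = s ^+ 2 * (sq_normB 0 + sq_normE 0 + sq_normp p) :=
  full_hom s (conj (conj (subspace0 sVd) (subspace0 sVc)) hp : W ((0, 0), p)).
exact: (addr3_only3 h (etrans (congr1 sq_normB (scaler0 _ s)) z1)
  (etrans (congr1 sq_normE (scaler0 _ s)) z2) z1 z2).
Qed.

Let solution_bound k x : 0 < k -> W0 x -> full_form x x <= k * energy_form x x ->
    step_form x x = load_form x ->
  ((normB x.1.1 + normE x.1.2 + normp x.2)%:E <= (3 * k)%:E *
    (dual_norm V0 normB (rhs_B g) + dual_norm Vc normE (rhs_E g)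
     + dual_norm Vg normp (rhs_p g)))%E.
Proof.
move=> k0 hx fk e; have [[hB hE] hp] := hx.
have [z1 z2 z3] := P0; have hBd := V0d hB.
set X := normB x.1.1 + normE x.1.2 + normp x.2.
have pB : 0 <= normB x.1.1 by apply: sqrtr_ge0.
have pE : 0 <= normE x.1.2 by apply: sqrtr_ge0.
have pp : 0 <= normp x.2 by apply: sqrtr_ge0.
have n0 (u : R) : u = 0 -> Num.sqrt u <= 1 by move=> ->; rewrite sqrtr0.
have D1 : (0 <= dual_norm V0 normB (rhs_B g))%E.
  by apply: dual_norm_ge0; [exact: subspace0 sV0|exact: n0].
have D2 : (0 <= dual_norm Vc normE (rhs_E g))%E.
  by apply: dual_norm_ge0; [exact: subspace0 sVc|exact: n0].
have D3 : (0 <= dual_norm Vg normp (rhs_p g))%E.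
  by apply: (@dual_norm_ge0 R scalar); [exact: subspace0 sVg|exact: n0].
have XB : normB x.1.1 <= X by rewrite /X -addrA lerDl addr_ge0.
have XE : normE x.1.2 <= X by rewrite /X addrAC lerDr addr_ge0.
have Xp : normp x.2 <= X by rewrite /X lerDr addr_ge0.
have sq (u : R) : 0 <= u -> Num.sqrt u ^+ 2 = u by move=> hu; rewrite sqr_sqrtr.
have XX : X * X <= 3 * k * load_form x.
  rewrite -e form_energy -mulrA; apply: (@le_trans _ _ (3 * full_form x x)); last first.
    by rewrite ler_pM2l.
  rewrite fullE -(sq _ (sq_normB_ge0 x.1.1)) -(sq _ (sq_normE_ge0 x.1.2)) -(sq _ (sq_normp_ge0 x.2)).
  exact: sqr_addr3_le.
apply: (le_dual_sum _ D1 D2 D3 XX); first by rewrite mulr_gt0.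
move=> X0; split.
- exact: (dual_norm_bound sV0 (linear_onS V0d gB_lin)
    (fun s u hu => @normB_hom s u (V0d hu)) hB X0 XB).
- exact: (dual_norm_bound sVc gE_lin normE_hom hE X0 XE).
- exact: (@dual_norm_bound R scalar Vg normp _ _ _ sVg gp_lin normp_hom hp X0 Xp).
Qed.

Lemma step_well_posed k : 0 < k -> (forall x, W0 x -> full_form x x <= k * energy_form x x) ->
  exists B E p,
    [/\ solves Om Vg Vc Vd b eps mu gamma tau g B E p,
        forall B' E' p', solves Om Vg Vc Vd b eps mu gamma tau g B' E' p' ->
          [/\ ae_eq_on Om B' B, ae_eq_on Om E' E & ae_eq_on Om p' p]
      & ((normB B + normE E + normp p)%:E <= (3 * k)%:E *
          (dual_norm V0 normB (rhs_B g) + dual_norm Vc normE (rhs_E g)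
           + dual_norm Vg normp (rhs_p g)))%E].
Proof.
move=> k0 hk; have [x hx e] := exists_solution.
have hs := solution_solves hx e.
exists x.1.1, x.1.2, x.2; split=> // [B' E' p' h|].
  exact: (@solution_unique x ((B', E'), p') hs h).
exact: (solution_bound k0 hx (hk x hx) (e x hx)).
Qed.

End Data.

Theorem well_posed_of_fin_dim : well_posed Om Vg Vc Vd b eps mu gamma tau
  (admissible_data Om Vg Vc Vd b eps mu gamma tau).
Proof.
have [k k0 hk] : exists2 k : R, 0 < k &
    forall x, W0 x -> full_form x x <= k * energy_form x x.
  apply: (inverse_inequality sNW sW0 fW0).
  - exact: bilinear_onS W0W energy_bilinear.
  - exact: bilinear_onS W0W full_bilinear.
  - by move=> x y _ _; apply: energyC.
  - by move=> x y _ _; apply: fullC.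
  - by move=> x _; apply: energy_ge0.
  - by move=> x _; apply: full_ge0.
  - by move=> x /W0W hx nx; apply: nul_energy (NW_nul hx nx).
  - by move=> x /W0W hx /(energy_nul hx); apply: nul_full.
exists (3 * k); first by rewrite mulr_gt0.
move=> _ [[B0 [E0 [p0 [j0 [j1 [hB0 hE0 hp0 [hj0 hj1] ->]]]]]] dual].
exact: (step_well_posed hB0 hE0 hp0 hj0 hj1 dual k0 hk).
Qed.

End WellPosed.

(** * Domain and coefficients *)

Section DomainAndCoefficients.
Variable R : realType.
Implicit Types (Om : set 'rV[R]_3) (w : 'rV[R]_3 -> R).

Lemma coord_le_enorm (x : 'rV[R]_3) i : `|x 0 i| <= enorm x.
Proof.
rewrite -sqrtr_sqr; apply: ler_wsqrtr.
rewrite expr2 /dot (bigD1 i) //= lerDl.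
by apply: sumr_ge0 => j _; rewrite -expr2 sqr_ge0.
Qed.

Lemma eball_bounded (c : 'rV[R]_3) (r : R) : bounded_set (eball c r).
Proof.
exists (`|c| + r); split; first exact: num_real.
move=> M hM x hx /=; apply: le_trans (ltW hM).
rewrite -[x](subrK c) addrC; apply: (le_trans (ler_normD _ _)).
rewrite lerD2l; apply: le_trans (ltW hx).
rewrite [leLHS]/Num.norm /= mx_normrE; apply/bigmax_leP; split=> [|[i j] _].
  exact: sqrtr_ge0.
by rewrite (ord1 i); apply: coord_le_enorm.
Qed.

Lemma coefficient_gt0 Om w x : coefficient Om w -> Om x -> 0 < w x.
Proof.
move=> [_ [a [b [a0 h]]]] /h /andP[h1 _].
exact: lt_le_trans h1.
Qed.

Lemma coefficient_bounded_weight Om w : open Om -> coefficient Om w ->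
  bounded_weight Om w.
Proof.
move=> oOm hw; have [cw [a [b [a0 h]]]] := hw.
split; first exact: continuous_vec_measurable.
exists b => t Dt; have w0 := coefficient_gt0 hw Dt.
by rewrite gtr0_norm //; have /andP[] := h _ Dt.
Qed.

Lemma coefficient_inv Om w : coefficient Om w -> coefficient Om (inv_w w).
Proof.
move=> hw; have [cw [a [b [a0 h]]]] := hw; split=> [x Ox|].
  have wx : w x != 0 by rewrite gt_eqF // (coefficient_gt0 hw Ox).
  exact: (cvgV wx (cw x Ox)).
have [[x Ox]|nOm] := pselect (exists x, Om x).
  have b0 : 0 < b.
    by have /andP[h1 h2] := h x Ox; apply: lt_le_trans a0 (le_trans h1 h2).
  exists b^-1, a^-1; split=> [|y Oy]; first by rewrite invr_gt0.
  have /andP[h1 h2] := h y Oy; have wy := coefficient_gt0 hw Oy.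
  by rewrite /inv_w !lef_pV2 ?posrE // h1 h2.
by exists 1, 1; split=> // x Ox; case: nOm; exists x.
Qed.

End DomainAndCoefficients.

Theorem theorem3p2 (R : realType)
    (Ob : set 'rV[R]_3) (c : 'rV[R]_3) (rho : R)
    (eps mu : 'rV[R]_3 -> R) (gamma tau : R)
    (N : nat) (Phi : 'I_N -> 'rV[R]_3 -> 'rV[R]_3) (kg kc kd kl : nat) :
  let S := eball c rho in
  let Om := comp_domain Ob S in
  let Gi := Gamma_i Ob S in
  let Go := Gamma_o Ob S in
  let Vg := lagrange_space Om Phi kg in
  let Vc := nedelec_space Om Gi Phi kc in
  let Vd := rt_space Om Gi Phi kd in
  let Vl := L2h Om Phi kl in
  let b := bform Gi Phi in
  open Ob -> connected Ob -> Ob !=set0 -> bounded_set Ob ->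
  0 < rho -> closure Ob `<=` S ->
  lipschitz_domain Om ->
  coefficient Om eps -> coefficient Om mu ->
  0 < 1 + gamma -> 0 < tau ->
  is_mesh Om Gi Go Phi ->
  (0 < kg)%N ->
  discrete_sequence Om Vg Vc Vd Vl ->
  well_posed Om Vg Vc Vd b eps mu gamma tau
    (admissible_data Om Vg Vc Vd b eps mu gamma tau).
Proof.
move=> S Om Gi Go Vg Vc Vd Vl b _ _ _ _ _ _ [oOm _] heps hmu g0 t0 mesh _ seqV.
have bOm : bounded_set Om.
  have [M [Mr hM]] := eball_bounded c rho; exists M; split=> // r Mr' x [Sx _].
  exact: hM Sx.
have maps K := mesh_maps mesh K.
have on_cell v : Vc v -> forall K, nedelec_on_cell (Phi K) v.
  exact: nedelec_space_on_cell.
apply: (@well_posed_of_fin_dim R Om oOm bOm eps mu gamma tau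
  (coefficient_bounded_weight oOm heps) (fun x => coefficient_gt0 heps)
  (coefficient_bounded_weight oOm (coefficient_inv hmu))
  (fun x => coefficient_gt0 (coefficient_inv hmu)) g0 t0 Vg Vc Vd Vl
  (lagrange_subspace Phi oOm bOm kg) (nedelec_subspace Gi Phi oOm bOm kc)
  (rt_subspace Gi Phi oOm bOm kd) _ _ _
  (@cell_null R N Phi 'rV[R]_3) (@cell_null R N Phi R^o)).
- by move=> p [[]].
- by move=> E [[]].
- by move=> B [[]].
- exact: cell_null_subspace.
- exact: cell_null_subspace.
- by move=> v; apply: (cell_null_ae mesh).
- by move=> p; apply: (cell_null_ae mesh).
- exact: (lagrange_fin_dim mesh kg).
- exact: (nedelec_fin_dim mesh kc).
- exact: (rt_fin_dim mesh kd).
- exact: (bform_bilinear _ maps on_cell).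
- exact: bformC.
- exact: bform_ge0.
- by move=> v /on_cell hv; apply: (bform_cell_null _ maps hv).
- exact: seqV.
Qed.
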